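(* A continuous-time completely integrable contact system is solvable in quadratures.
   Context: All objects are smooth. A contact manifold $(M^{2n-1},\xi)$ is a manifold of dimension $2n-1$ with a completely non-integrable hyperplane distribution $\xi$. An $n$-dimensional foliation $\mathcal F$ on $M$ is co-Legendrian if it is transverse to $\xi$ and $T\mathcal F\cap\xi$ is integrable; the resulting $(n-1)$-dimensional foliation $\mathcal G$ is the associated Legendrian foliation. A completely integrable contact manifold is a contact manifold with a co-Legendrian foliation $\mathcal F$ such that on each leaf $F$ of $\mathcal F$ the codimension one foliation $\mathcal G$ has a holonomy invariant transverse smooth measure, i.e. a nowhere zero 1-form $\alpha_F$ on $F$ (depending smoothly on the leaf) with $\ker\alpha_F=T\mathcal G$ and $i_u\alpha_F=L_u\alpha_F=0$ for all $u$ tangent to $\mathcal G$. A continuous-time completely integrable contact system on it is a contact vector field $w$ (its flow preserves $\xi$) that preserves $\mathcal F$ leaf-wise (so $w$ is tangent to $\mathcal F$) and preserves the transverse measure of $\mathcal G$. To solve a system of differential equations in quadratures means to obtain its solution by a finite number of ''algebraic'' operations (including inversion of functions) and ''quadratures'', i.e. integrations of known functions. Here the system is $\dot x=w(x)$, considered locally, and the given (known) data are the contact structure (e.g. a contact form $\lambda_0$ defining $\xi$), $n-1$ functionally independent first integrals $f_1,\dots,f_{n-1}$ whose common level sets are the leaves of $\mathcal F$, and the contact vector field $w$. *)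

(* Defs.v *)
From HB Require Import structures.
From mathcomp Require Import all_boot all_order all_algebra.
From mathcomp Require Import all_classical all_reals all_analysis.

Set Implicit Arguments.
Unset Strict Implicit.
Unset Printing Implicit Defensive.

Import Order.TTheory GRing.Theory Num.Theory.
Import numFieldNormedType.Exports.

Local Open Scope classical_set_scope.
Local Open Scope ring_scope.

(* The problem is local, so the manifold is an open subset M of R^N. Vectors
   and covectors are both row vectors; vector fields and 1-forms are maps
   'rV_N -> 'rV_N whose values outside M are irrelevant. *)

Section Calculus.
Variable R : realType.

Definition iterD (V W : normedModType R) (vs : seq V) (g : V -> W) : V -> W :=
  foldr (fun v h => 'D_v h) g vs.

(* C^infinity on U (meant for U open) *)
Definition smooth (V W : normedModType R) (U : set V) (g : V -> W) : Prop :=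
  forall (vs : seq V) (x : V), U x -> differentiable (iterD vs g) x.

Variable N : nat.
Implicit Types (x v : 'rV[R]_N) (M U : set 'rV[R]_N).

Definition pairing (a v : 'rV[R]_N) : R := \sum_(i < N) a 0 i * v 0 i.

(* (d lambda)_x (u, v) = (D_u lambda)(v) - (D_v lambda)(u) *)
Definition ext_deriv (lambda : 'rV[R]_N -> 'rV[R]_N) x (u v : 'rV[R]_N) : R :=
  pairing ('D_u lambda x) v - pairing ('D_v lambda x) u.

(* (L_u a)_x (v), in coordinates
   L_u a = \sum_k (\sum_j (u_j d_j a_k + a_j d_k u_j)) dx_k.
   If u is tangent to a foliation F and v is tangent to F at x, the value
   depends only on the restriction of a to the leaves, and it is the Lie
   derivative computed inside the leaf. *)
Definition lie_deriv (u a : 'rV[R]_N -> 'rV[R]_N) x v : R :=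
  pairing ('D_(u x) a x) v + pairing (a x) ('D_v u x).

(* D is tangent to a foliation of codimension c *)
Definition integrable_distribution M (c : nat)
    (D : 'rV[R]_N -> set 'rV[R]_N) : Prop :=
  forall p, M p -> exists (U : set 'rV[R]_N) (g : 'rV[R]_N -> 'rV[R]_c),
    [/\ open U, U p, U `<=` M, smooth U g &
        forall x, U x -> \rank ('J g x) = c /\
                         D x = [set v | 'd g x v = 0]].

End Calculus.

Section ContactGeometry.
Variables (R : realType) (N : nat).
Implicit Types (M U : set 'rV[R]_N) (lambda alpha w u : 'rV[R]_N -> 'rV[R]_N).

(* xi = ker lambda; complete non-integrability of xi is the nondegeneracy of
   d lambda on xi. *)
Definition contact_form M lambda : Prop :=
  smooth M lambda /\
  forall x, M x -> lambda x != 0 /\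
    forall u : 'rV[R]_N, pairing (lambda x) u = 0 -> u != 0 ->
      exists v : 'rV[R]_N,
        pairing (lambda x) v = 0 /\ ext_deriv lambda x u v != 0.

(* q functionally independent functions, gathered into f; they define the
   foliation by their common level sets. *)
Definition independent_functions (q : nat) M (f : 'rV[R]_N -> 'rV[R]_q) :
  Prop := smooth M f /\ forall x, M x -> \rank ('J f x) = q.

Definition tangentF (q : nat) (f : 'rV[R]_N -> 'rV[R]_q) (x : 'rV[R]_N) :
  set 'rV[R]_N := [set v | 'd f x v = 0].

Definition tangentG (q : nat) lambda (f : 'rV[R]_N -> 'rV[R]_q)
    (x : 'rV[R]_N) : set 'rV[R]_N :=
  tangentF f x `&` [set v | pairing (lambda x) v = 0].

(* As xi has codimension 1, F is transverse to xi at x iff T_x F is not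
   contained in xi_x; then T F /\ xi has codimension q + 1 in R^N. *)
Definition co_Legendrian (q : nat) M lambda (f : 'rV[R]_N -> 'rV[R]_q) :
    Prop :=
  (forall x, M x ->
     exists v : 'rV[R]_N, tangentF f x v /\ pairing (lambda x) v != 0) /\
  integrable_distribution M q.+1 (tangentG lambda f).

(* The smooth leafwise form (alpha_F)_F is given by an extension alpha to M;
   every condition involves only its restriction to the leaves of F. The
   fields u tangent to G may be defined on open subsets of M only. *)
Definition transverse_measure (q : nat) M lambda (f : 'rV[R]_N -> 'rV[R]_q)
    alpha : Prop :=
  [/\ smooth M alpha,
      forall x, M x ->
        exists v : 'rV[R]_N, tangentF f x v /\ pairing (alpha x) v != 0,
      forall x, M x -> forall v : 'rV[R]_N, tangentF f x v ->
        (pairing (alpha x) v = 0 <-> tangentG lambda f x v) &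
      forall U u, open U -> U `<=` M -> smooth U u ->
        (forall x, U x -> tangentG lambda f x (u x)) ->
        forall x, U x -> pairing (alpha x) (u x) = 0 /\
          forall v : 'rV[R]_N, tangentF f x v -> lie_deriv u alpha x v = 0].

(* Contact: L_w lambda vanishes on xi. *)
Definition contact_field M lambda w : Prop :=
  smooth M w /\
  forall x, M x -> forall v : 'rV[R]_N,
    pairing (lambda x) v = 0 -> lie_deriv w lambda x v = 0.

Definition integrable_contact_system (q : nat) M lambda
    (f : 'rV[R]_N -> 'rV[R]_q) alpha w : Prop :=
  [/\ contact_field M lambda w,
      forall x, M x -> tangentF f x (w x) &
      forall x, M x -> forall v : 'rV[R]_N,
        tangentF f x v -> lie_deriv w alpha x v = 0].

End ContactGeometry.

Section Quadratures.
Variables (R : realType) (N : nat) (M : set 'rV[R]_N).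
Local Notation mu := (@lebesgue_measure R).

(* quad data A g: on the set A, the function g is obtained from the functions
   in data (defined on M) by finitely many algebraic operations, inversions
   and quadratures. There is no rule for differentiation, for limits, or for
   gluing functions known on different sets.
   - quad_integral allows parameters; the substitution s = a + (t - a) * r
     reduces an integral from a to a variable t to one over [0, 1].
   - quad_inverse covers implicit functions, hence roots of equations: invert
     (x, y) |-> (x, F (x, y)). *)
Inductive quad (data : set ('rV[R]_N -> R)) :
    forall k : nat, set 'rV[R]_k -> ('rV[R]_k -> R) -> Prop :=
| quad_data g : data g -> quad data M g
| quad_cst k (A : set 'rV[R]_k) (c : R) : quad data A (fun=> c)
| quad_coord k (A : set 'rV[R]_k) (i : 'I_k) : quad data A (fun x => x 0 i)
| quad_add k (A : set 'rV[R]_k) g h :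
    quad data A g -> quad data A h -> quad data A (fun x => g x + h x)
| quad_mul k (A : set 'rV[R]_k) g h :
    quad data A g -> quad data A h -> quad data A (fun x => g x * h x)
| quad_inv k (A : set 'rV[R]_k) g :
    quad data A g -> (forall x, A x -> g x != 0) ->
    quad data A (fun x => (g x)^-1)
| quad_comp k l (A : set 'rV[R]_k) (B : set 'rV[R]_l)
    (g : 'rV[R]_l -> R) (h : 'rV[R]_k -> 'rV[R]_l) :
    quad data B g -> (forall i, quad data A (fun x => h x 0 i)) ->
    (forall x, A x -> B (h x)) -> quad data A (fun x => g (h x))
| quad_integral k (A : set 'rV[R]_k) (B : set 'rV[R]_(k + 1))
    (g : 'rV[R]_(k + 1) -> R) (a b : R) :
    quad data B g ->
    (forall x s, A x -> a <= s <= b -> B (row_mx x s%:M)) ->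
    quad data A (fun x => \int[mu]_(s in `[a, b]) g (row_mx x s%:M))
| quad_inverse k (A B : set 'rV[R]_k) (g h : 'rV[R]_k -> 'rV[R]_k)
    (i : 'I_k) :
    open A -> open B -> (forall j, quad data A (fun x => g x 0 j)) ->
    (forall x, A x -> B (g x) /\ h (g x) = x) ->
    (forall y, B y -> A (h y) /\ g (h y) = y) ->
    quad data B (fun y => h y 0 i)
| quad_restrict k (A A' : set 'rV[R]_k) g g' :
    quad data A g -> A' `<=` A -> (forall x, A' x -> g' x = g x) ->
    quad data A' g'.

(* The contact form, the first integrals and the vector field are known
   together with their partial derivatives. The transverse measure is not
   among the known data. *)
Inductive known_data (q : nat) (lambda : 'rV[R]_N -> 'rV[R]_N)
    (f : 'rV[R]_N -> 'rV[R]_q) (w : 'rV[R]_N -> 'rV[R]_N) :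
    set ('rV[R]_N -> R) :=
| known_form vs i : known_data lambda f w (fun x => iterD vs lambda x 0 i)
| known_integral vs i : known_data lambda f w (fun x => iterD vs f x 0 i)
| known_field vs i : known_data lambda f w (fun x => iterD vs w x 0 i).

Definition solution_in_quadratures (data : set ('rV[R]_N -> R))
    (w : 'rV[R]_N -> 'rV[R]_N) (p : 'rV[R]_N) : Prop :=
  exists (eps : R) (gamma : R -> 'rV[R]_N),
    [/\ 0 < eps, gamma 0 = p,
        forall t, `|t| < eps ->
          M (gamma t) /\ is_derive t 1 gamma (w (gamma t)) &
        forall i, quad data [set z : 'rV[R]_1 | `|z 0 0| < eps]
                            (fun z => gamma (z 0 0) 0 i)].

(* The general solution near p, as a function of (x, t) in R^(N + 1). *)
Definition flow_in_quadratures (data : set ('rV[R]_N -> R))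
    (w : 'rV[R]_N -> 'rV[R]_N) (p : 'rV[R]_N) : Prop :=
  exists (U : set 'rV[R]_N) (eps : R) (Phi : 'rV[R]_N -> R -> 'rV[R]_N),
    [/\ [/\ open U, U p, U `<=` M & 0 < eps],
        forall x, U x -> Phi x 0 = x,
        forall x t, U x -> `|t| < eps ->
          M (Phi x t) /\ is_derive t 1 (Phi x) (w (Phi x t)) &
        forall i, quad data
          [set z : 'rV[R]_(N + 1) | U (lsubmx z) /\ `|rsubmx z 0 0| < eps]
          (fun z => Phi (lsubmx z) (rsubmx z 0 0) 0 i)].

(* Every initial value problem is solved. Near a point where w does not vanish
   the solution is moreover known as a function of time and of the initial
   condition. At a zero of w the solution is constant. *)
Definition solvable_in_quadratures (data : set ('rV[R]_N -> R))
    (w : 'rV[R]_N -> 'rV[R]_N) : Prop :=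
  forall p, M p ->
    solution_in_quadratures data w p /\
    (w p != 0 -> flow_in_quadratures data w p).

End Quadratures.

(* Main.v *)
From HB Require Import structures.
Require Import Defs.
From mathcomp Require Import all_boot all_order all_algebra.
From mathcomp Require Import all_classical all_reals all_analysis.
From mathcomp Require Import ring lra.
Set Implicit Arguments.
Unset Strict Implicit.
Unset Printing Implicit Defensive.

Import Order.TTheory GRing.Theory Num.Theory.
Import numFieldNormedType.Exports.

Local Open Scope classical_set_scope.
Local Open Scope ring_scope.

(** Let q = n - 1, so that the dimension is N = q + (1 + q), and let
    H = lambda(w) be the contact Hamiltonian of w. A zero of w is a constant
    solution. Near a point p with w(p) <> 0 the proof computes, from the known
    functions, coordinates (y, S, a) in R^q x R x R^q in which
        w = chi d/dS - sum_j (d chi / d y_j) d/da_j,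
    where the function chi of y is 1 or one of the y_i. This field V is
    constant along its own trajectories, so its flow is Y |-> Y + t V(Y), and
    inverting the coordinates gives the flow of w (flow_of_straightened).

    The conditions on alpha mean that alpha is closed along the leaves of F
    (measure_closed), hence that alpha(w) is constant on each leaf. On vectors
    tangent to the leaves alpha and lambda have the same kernel. Therefore, if
    H = chi k with k nowhere zero and chi constant on the leaves, then
    nu = lambda / k equals (chi / alpha(w)) alpha along the leaves wherever
    chi <> 0, and so nu is closed along the leaves, everywhere by density
    (straightened_factor). As alpha is not known, k has to be extracted from H:
    - if H(p) <> 0, take k = H and chi = 1 (straightened_transverse);
    - if H(p) = 0, the zero set of H is a union of leaves, and nondegeneracy
      of the contact form gives dH(p) <> 0. The values of H on a transversal
      of F can then replace one of the first integrals, say y_i; now H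
      vanishes where y_i does, and H = y_i k with k the average of dH / dy_i
      over a segment (straightened_tangent, straightened_coordinate).

    Integrating nu radially along the leaves gives a function S with
    nu = dS + sum_j a_j dy_j (form_decomposition). By nondegeneracy (y, S, a)
    are coordinates (darboux_inj). In these Darboux coordinates the equation
    saying that w is a contact field reads w(S) = chi, w(a_j) = - d chi / dy_j
    (derive_darboux_field).

    All constructions stay within a class of functions, known, generated by
    algebraic operations, substitutions, integrals over [0, 1] and inversions
    of local diffeomorphisms, with the side conditions that make the class
    stable under differentiation (known_sound). The inverse function theorem
    (local_chart) and differentiation under the integral sign
    (differentiable_unit_integral) are what allows one to work in it. *)

(* the iterated derivative, not the lemma on iterated functions *)
Local Notation iterD := Defs.iterD.

(** * Derivatives of maps between row vectors *)
Section Calculus.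
Variable R : realType.
Implicit Types U V W : normedModType R.

Lemma coord_le_norm k (x : 'rV[R]_k) i : `|x 0 i| <= `|x|.
Proof.
rewrite [leRHS]/Num.Def.normr /= mx_normrE.
exact: (le_bigmax _ (fun ij : 'I_1 * 'I_k => `|x ij.1 ij.2|) (0, i)).
Qed.

Lemma rV_norm_le k (x : 'rV[R]_k) c :
  0 <= c -> (forall i, `|x 0 i| <= c) -> `|x| <= c.
Proof.
move=> c0 h; rewrite [leLHS]/Num.Def.normr /= mx_normrE (bigmax_le _ c0)//=.
by move=> [i j] _ /=; rewrite ord1.
Qed.

Lemma rV_norm_lt k (x : 'rV[R]_k) c :
  0 < c -> (forall i, `|x 0 i| < c) -> `|x| < c.
Proof.
move=> c0 h; rewrite [ltLHS]/Num.Def.normr /= mx_normrE; apply/bigmax_ltP; split => //.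
by move=> [i j] _ /=; rewrite ord1.
Qed.

Lemma mulmx_norm_le k l (A : 'M[R]_(k, l)) :
  exists2 c, 0 < c & forall x : 'rV[R]_k, `|x *m A| <= c * `|x|.
Proof.
exists (1 + \sum_i \sum_j `|A i j|).
  by rewrite ltr_wpDr// sumr_ge0// => i _; rewrite sumr_ge0.
move=> x; apply: rV_norm_le.
  by rewrite mulr_ge0// addr_ge0// sumr_ge0// => i _; rewrite sumr_ge0.
move=> j; rewrite mxE (le_trans (ler_norm_sum _ _ _))//.
rewrite mulrDl mul1r ler_wpDl// mulr_suml ler_sum// => i _.
rewrite normrM mulrC ler_pM ?coord_le_norm//.
rewrite (bigD1 j)//= lerDl sumr_ge0//.
Qed.

(** Reduces everything about vector valued maps to real functions, which are
    the ones that quadratures speak about. *)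
Lemma differentiable_rV V l (h : V -> 'rV[R]_l) x :
  (forall i, differentiable (fun y => h y 0 i) x) -> differentiable h x.
Proof.
move=> hd.
have -> : h = \sum_(i < l) (fun y => h y 0 i *: delta_mx 0 i).
  apply/funext => y; rewrite fct_sumE; exact: row_sum_delta.
apply: differentiable_sum => i; exact: differentiableZl.
Qed.

Lemma differentiable_rVP V l (h : V -> 'rV[R]_l) x i :
  differentiable h x -> differentiable (fun y => h y 0 i) x.
Proof.
move=> hd; apply: (@differentiable_comp _ _ _ _ h (fun z : 'rV_l => z 0 i)) => //.
exact: differentiable_coord.
Qed.

Lemma derive_rV V l (h : V -> 'rV[R]_l) x v i :
  differentiable h x -> 'D_v (fun y => h y 0 i) x = 'D_v h x 0 i.
Proof.
by move=> hd; rewrite derive_mx ?mxE//; exact: diff_derivable.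
Qed.

Lemma derive_sum_coord k W (g : 'rV[R]_k -> W) x v : differentiable g x ->
  'D_v g x = \sum_i v 0 i *: 'D_(delta_mx 0 i) g x.
Proof.
move=> gd; rewrite deriveE// {1}(row_sum_delta v) linear_sum.
by apply: eq_bigr => i _; rewrite linearZ /= deriveE.
Qed.

Lemma deriveDir V W (g : V -> W) x u v : differentiable g x ->
  'D_(u + v) g x = 'D_u g x + 'D_v g x.
Proof. by move=> gd; rewrite !deriveE// linearD. Qed.

Lemma deriveZDir V W (g : V -> W) x (a : R) v : differentiable g x ->
  'D_(a *: v) g x = a *: 'D_v g x.
Proof. by move=> gd; rewrite !deriveE// linearZ. Qed.

Lemma derive_comp U V W (h : U -> V) (g : V -> W) x v :
  differentiable h x -> differentiable g (h x) ->
  'D_v (fun y => g (h y)) x = 'D_('D_v h x) g (h x).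
Proof.
move=> hd gd; rewrite deriveE ?(deriveE _ hd) ?(deriveE _ gd).
  by rewrite -[fun y => _]/(g \o h) diff_comp.
exact: differentiable_comp.
Qed.

Lemma eq_open_nbhs V (T : Type) (A : set V) (f g : V -> T) x :
  open A -> {in A, f =1 g} -> A x -> \forall y \near x, f y = g y.
Proof.
move=> oA fg Ax; have := open_nbhs_nbhs (conj oA Ax).
by apply: filterS => y Ay; apply: fg; rewrite inE.
Qed.

Lemma eq_open_derive V W (A : set V) (f g : V -> W) x v :
  open A -> {in A, f =1 g} -> A x -> 'D_v f x = 'D_v g x.
Proof.
move=> oA fg Ax; have [->|v0] := eqVneq v 0; first by rewrite !derive0.
by apply: near_eq_derive => //; exact: (eq_open_nbhs oA).
Qed.

Lemma eq_open_differentiable V W (A : set V) (f g : V -> W) x :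
  open A -> {in A, f =1 g} -> A x -> differentiable g x -> differentiable f x.
Proof.
move=> oA fg Ax /diff_locallyP[gc ge].
have [df dfE] : exists df : {linear V -> W},
   continuous df /\ f \o shift x = cst (f x) + df +o_ 0 id.
  exists ('d g x); split => //; apply/eqaddoP => e e0.
  have /eqaddoP /(_ e e0) := ge.
  have : \forall y \near (0:V), f (y + x) = g (y + x).
    have := eq_open_nbhs oA fg Ax; rewrite (near_shift 0) /=.
    by apply: filterS => y /=; rewrite subr0.
  move=> h1 h2; near=> y.
  have : (f \o shift x - (cst (f x) + 'd g x)) y = (g \o shift x - (cst (g x) + 'd g x)) y.
    rewrite /= !fctE /=; congr (_ - (_ + _)).
      by near: y.
    by apply: fg; rewrite inE.
  by move=> ->; near: y.
case: dfE => dc de; apply/diff_locallyP.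
by rewrite (diff_unique dc de).
Unshelve. all: by end_near. Qed.

End Calculus.

(** * Mean values and strict differentiability *)
Section DifferentiableMore.
Variable R : realType.
Implicit Types U V W : normedModType R.

Lemma differentiable_of_linear V W (f : V -> W) (L : {linear V -> W}) x :
  continuous L ->
  (forall e : R, 0 < e ->
     \forall h \near (0 : V), `|f (h + x) - f x - L h| <= e * `|h|) ->
  differentiable f x /\ forall v, 'd f x v = L v.
Proof.
move=> Lc fL.
have fE : f \o shift x = cst (f x) + L +o_ 0 id.
  apply/eqaddoP => e e0; have := fL e e0; apply: filterS => h /=.
  by rewrite !fctE /= opprD addrA.
have dE := diff_unique Lc fE; split; last by rewrite dE.
by apply/diff_locallyP; rewrite dE.
Qed.

Lemma differentiable_approx V W (f : V -> W) x (e : R) :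
  differentiable f x -> 0 < e ->
  \forall h \near (0 : V), `|f (h + x) - f x - 'd f x h| <= e * `|h|.
Proof.
move=> /diff_locallyP[_ /eqaddoP fE] e0; have := fE e e0; apply: filterS => h /=.
by rewrite !fctE /= opprD addrA.
Qed.

Lemma continuous_mulmxr k l (A : 'M[R]_(k, l)) :
  continuous (fun x : 'rV[R]_k => x *m A).
Proof.
have [c c0 cA] := mulmx_norm_le A.
have h : \forall x \near (0 : 'rV[R]_k), `|x *m A| <= c.
  have := @nbhs0_le R 'rV[R]_k 1 ltr01.
  move=> h1; apply: (filterS _ h1) => x x1; apply: (le_trans (cA x)).
  by rewrite ger_pMr.
have := @linear_bounded_continuous R 'rV[R]_k 'rV[R]_l (mulmxr A) => -[+ _].
by apply; apply/ex_bound; exists c; exact: h.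
Qed.

Lemma differentiable_of_mx k l (f : 'rV[R]_k -> 'rV[R]_l) (A : 'M[R]_(k, l)) x :
  (forall e : R, 0 < e ->
     \forall h \near (0 : 'rV_k), `|f (h + x) - f x - h *m A| <= e * `|h|) ->
  differentiable f x /\ forall v, 'D_v f x = v *m A.
Proof.
move=> fA; have [] := @differentiable_of_linear _ _ f (mulmxr A) x.
- exact: continuous_mulmxr.
- exact: fA.
- by move=> df dE; split => // v; rewrite deriveE// dE.
Qed.

(** Identifies a gradient from a first order estimate; needed when the
    coefficients are integrals, so that no differentiation rule applies. *)
Lemma differentiable_of_coef k (f : 'rV[R]_k -> R) (c : 'I_k -> R) x :
  (forall e : R, 0 < e -> \forall h \near (0 : 'rV_k),
     `|f (h + x) - f x - \sum_i h 0 i * c i| <= e * `|h|) ->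
  differentiable f x /\ forall v, 'D_v f x = \sum_i v 0 i * c i.
Proof.
move=> fc; pose F y : 'rV[R]_1 := const_mx (f y).
have [] := @differentiable_of_mx _ _ F (\matrix_(i, j) c i) x.
  move=> e e0; have := fc e e0; apply: filterS => h; apply: le_trans.
  apply: rV_norm_le => // i; rewrite !mxE le_eqVlt; apply/orP; left; apply/eqP.
  by congr (`| _ - _ |); apply: eq_bigr => j _; rewrite mxE.
have fE : f = fun y => F y 0 0 by apply/funext => y; rewrite mxE.
move=> dF DF; split; first by rewrite fE; exact: differentiable_rVP.
move=> v; rewrite fE derive_rV// DF mxE; apply: eq_bigr => j _.
by rewrite mxE.
Qed.

Lemma differentiable_mulmxr k l (A : 'M[R]_(k, l)) (x : 'rV[R]_k) :
  differentiable (fun x : 'rV[R]_k => x *m A) x /\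
  forall v, 'D_v (fun x : 'rV[R]_k => x *m A) x = v *m A.
Proof.
apply: differentiable_of_mx => e e0.
have h (y : 'rV[R]_k) : `|(y + x) *m A - x *m A - y *m A| <= e * `|y|.
  by rewrite mulmxDl addrK subrr normr0 mulr_ge0// ltW.
by apply: (@filterE _ (nbhs (0 : 'rV[R]_k))).
Qed.

Lemma is_derive_line V W (g : V -> W) x v (s : R) :
  differentiable g (x + s *: v) ->
  is_derive s 1 (fun t => g (x + t *: v)) ('D_v g (x + s *: v)).
Proof.
move=> gd; pose l : R -> V := cst x + ( *:%R ^~ v).
have lE : (fun t : R => x + t *: v) = l by [].
have [sd sE] : is_diff s ( *:%R^~ v : R -> V) ( *:%R^~ v) := is_diff_scalel s v.
have ld' : differentiable l s by apply: differentiableD; [exact: differentiable_cst|exact: sd].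
have ld : 'D_1 l s = v.
  rewrite deriveD ?derive_cst ?add0r.
  - by rewrite deriveE ?sE ?scale1r.
  - exact: derivable_cst.
  - exact: diff_derivable.
apply: DeriveDef.
  by apply/diff_derivable/(@differentiable_comp _ _ _ _ l g).
by rewrite (@derive_comp _ _ _ _ l)// ld.
Qed.

Lemma ball_segment V (x y z : V) (d s : R) :
  ball x d y -> ball x d (y + z) -> 0 <= s -> s <= 1 -> ball x d (y + s *: z).
Proof.
rewrite -!ball_normE /= => yd zd s0 s1.
have -> : x - (y + s *: z) = (1 - s) *: (x - y) + s *: (x - (y + z)).
  rewrite !opprD !(addrA x); move: (x - y) => a.
  by rewrite scalerBl scale1r scalerBr addrA subrK.
rewrite (le_lt_trans (ler_normD _ _))// !normrZ !ger0_norm ?subr_ge0//.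
move: yd zd; move: `|x - y| `|x - (y + z)| => a b ad bd.
have [->|s1'] := eqVneq s 1; first by rewrite subrr mul0r add0r mul1r.
have {}s1' : s < 1 by rewrite lt_neqAle s1'.
nra.
Qed.

Lemma mean_value_segment V (g : V -> R) x v :
  (forall s : R, 0 <= s -> s <= 1 -> differentiable g (x + s *: v)) ->
  exists s : R, [/\ 0 <= s, s <= 1 & g (x + v) - g x = 'D_v g (x + s *: v)].
Proof.
move=> gd; pose F (t : R) := g (x + t *: v).
have dF (t : R) : 0 <= t -> t <= 1 -> is_derive t 1 F ('D_v g (x + t *: v)).
  by move=> t0 t1; apply: is_derive_line; exact: gd.
have [||s + E] := @MVT_segment R F (fun t => 'D_v g (x + t *: v)) 0 1 ler01.
- by move=> t; rewrite in_itv /= => /andP[t0 t1]; apply: dF; exact: ltW.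
- apply: derivable_within_continuous => t; rewrite in_itv /= => /andP[t0 t1].
  by apply: ex_derive; exact: dF.
rewrite in_itv /= => /andP[s0 s1]; exists s; split => //.
by move: E; rewrite /F scale1r scale0r addr0 subr0 mulr1.
Qed.

Lemma const_along_segment V W (g : V -> R) x v :
  (forall s : R, 0 <= s -> s <= 1 ->
     differentiable g (x + s *: v) /\ 'D_v g (x + s *: v) = 0) ->
  g (x + v) = g x.
Proof.
move=> gd; have [s s0 s1|s [s0 s1 /eqP]] := @mean_value_segment _ g x v.
  by have [] := gd s s0 s1.
by have [_ ->] := gd s s0 s1 => //; rewrite subr_eq0 => /eqP.
Qed.

(** The increment between any two points near x0, not only from x0 itself, is
    approximated by the differential at x0: it is the derivative at some point
    of the segment, and the partial derivatives are continuous at x0. *)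
Lemma strictly_differentiable k (A : set 'rV[R]_k) (g : 'rV[R]_k -> R) x0 e :
  open A -> A x0 -> (forall x, A x -> differentiable g x) ->
  (forall i, {for x0, continuous ('D_(delta_mx 0 i) g)}) -> 0 < e ->
  exists2 d, 0 < d & ball x0 d `<=` A /\ forall x y, ball x0 d x -> ball x0 d y ->
    `|g y - g x - 'D_(y - x) g x0| <= e * `|y - x|.
Proof.
move=> oA Ax0 gd gc e0.
(* k errors at most e1 have to add up to at most e, also for k = 0 *)
pose e1 := e / (k%:R + 1).
have e10 : 0 < e1 by rewrite divr_gt0// ltr_wpDl.
have : \forall x \near x0, A x /\ forall i, `|'D_(delta_mx 0 i) g x - 'D_(delta_mx 0 i) g x0| <= e1.
  apply: filterI; first exact: open_nbhs_nbhs.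
  have gc' i : \forall x \near x0, `|'D_(delta_mx 0 i) g x - 'D_(delta_mx 0 i) g x0| <= e1.
    move: (gc i) => /cvgrPdist_le /(_ _ e10); apply: filterS => x.
    by rewrite distrC.
  exact: (@filter_forall _ _ _ _ (nbhs_filter x0) gc').
move=> /nbhs_ballP[d /= d0 dA]; exists d => //; split.
  by move=> x /dA [].
move=> x y xd yd.
have [s s0 s1|s [s0 s1]] := @mean_value_segment _ g x (y - x).
  by apply: gd; apply: (dA _ _).1; apply: ball_segment => //; rewrite addrC subrK.
rewrite (addrC x (y - x)) subrK => ->.
have zd : ball x0 d (x + s *: (y - x)) by apply: ball_segment => //; rewrite addrC subrK.
have [Az zl] := dA _ zd.
rewrite (derive_sum_coord _ (gd _ Az)) (derive_sum_coord _ (gd _ Ax0)) -sumrB.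
rewrite (le_trans (ler_norm_sum _ _ _))//.
have : \sum_(i < k) `|(y - x) 0 i *: 'D_(delta_mx 0 i) g (x + s *: (y - x)) -
    (y - x) 0 i *: 'D_(delta_mx 0 i) g x0| <= \sum_(i < k) `|y - x| * e1.
  by apply: ler_sum => i _; rewrite -scalerBr normrM ler_pM// coord_le_norm.
move=> /le_trans; apply; rewrite sumr_const card_ord -mulr_natr -mulrA mulrC.
rewrite ler_wpM2r// /e1 mulrAC ler_pdivrMr ?ltr_wpDl//.
by rewrite mulrDr mulr1 lerDl ltW.
Qed.

Lemma strictly_differentiable_rV k l (A : set 'rV[R]_k)
    (g : 'rV[R]_k -> 'rV[R]_l) x0 e :
  open A -> A x0 -> (forall x, A x -> differentiable g x) ->
  (forall i j, {for x0, continuous ('D_(delta_mx 0 i) (fun x => g x 0 j))}) ->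
  0 < e ->
  exists2 d, 0 < d & ball x0 d `<=` A /\ forall x y, ball x0 d x -> ball x0 d y ->
    `|g y - g x - 'D_(y - x) g x0| <= e * `|y - x|.
Proof.
move=> oA Ax0 gd gc e0.
have : \forall d \near (0:R)^'+, ball x0 d `<=` A /\
    forall j x y, ball x0 d x -> ball x0 d y ->
    `|g y 0 j - g x 0 j - 'D_(y - x) (fun x => g x 0 j) x0| <= e * `|y - x|.
  apply: filterI.
    have /nbhs_ballP[d /= d0 dA] := open_nbhs_nbhs (conj oA Ax0).
    near=> d'; apply: subset_trans dA; apply: le_ball.
    by near: d'; exact: nbhs_right_le.
  suff H j : \forall d \near (0:R)^'+, forall x y, ball x0 d x -> ball x0 d y ->
    `|g y 0 j - g x 0 j - 'D_(y - x) (fun x => g x 0 j) x0| <= e * `|y - x|.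
    exact: filter_forall H.
  have [|d d0 [dA dg]] := strictly_differentiable oA Ax0 _ (fun i => gc i j) e0.
    by move=> x Ax; apply: differentiable_rVP; exact: gd.
  near=> d' => x y xd yd; apply: dg.
    by apply: le_ball xd; near: d'; exact: nbhs_right_le.
  by apply: le_ball yd; near: d'; exact: nbhs_right_le.
move=> H; near (0:R)^'+ => d.
have d0 : 0 < d by [].
exists d => //; have [dA dg] : ball x0 d `<=` A /\
    forall j x y, ball x0 d x -> ball x0 d y ->
    `|g y 0 j - g x 0 j - 'D_(y - x) (fun x => g x 0 j) x0| <= e * `|y - x|.
  by near: d.
split => // x y xd yd; apply: rV_norm_le => [|j].
  by rewrite mulr_ge0// ltW.
by rewrite !mxE -derive_rV ?dg//; exact: gd.
Unshelve. all: by end_near. Qed.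

End DifferentiableMore.

(** * Symmetry of second derivatives, fundamental theorem of calculus *)
Section SchwarzFTC.
Variable R : realType.
Implicit Types U V W : normedModType R.

Lemma ball_addl V (x v : V) (d : R) : ball x d (x + v) = (`|v| < d) :> Prop.
Proof. by rewrite -ball_normE /= opprD addrA subrr sub0r normrN. Qed.

(** Two applications of the mean value theorem. The left hand side is
    symmetric in u and v, which is the reason for the symmetry of second
    derivatives. *)
Lemma second_difference V (g : V -> R) x u v (d t : R) :
  (forall y, ball x d y -> differentiable g y /\ differentiable ('D_u g) y) ->
  0 < t -> t * `|u| + t * `|v| < d ->
  exists2 y, ball x d y &
    g (x + t *: u + t *: v) - g (x + t *: u) - (g (x + t *: v) - g x) =
    t * (t * 'D_v ('D_u g) y).
Proof.
move=> gd t0 td; pose G z := g (z + t *: v) - g z.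
have inb (r s : R) : 0 <= r -> r <= 1 -> 0 <= s -> s <= 1 ->
    ball x d (x + r *: (t *: u) + s *: (t *: v)).
  move=> r0 r1 s0 s1; rewrite -addrA ball_addl.
  rewrite (le_lt_trans (ler_normD _ _))// !normrZ !ger0_norm// ?(ltW t0)//.
  apply: le_lt_trans td; rewrite lerD// ler_piMl// mulr_ge0// ltW//.
have inb0 (r : R) : 0 <= r -> r <= 1 -> ball x d (x + r *: (t *: u)).
  by move=> r0 r1; have := inb r 0 r0 r1 (lexx _) ler01; rewrite scale0r addr0.
have inb1 (r : R) : 0 <= r -> r <= 1 -> ball x d (x + r *: (t *: u) + t *: v).
  by move=> r0 r1; have := inb r 1 r0 r1 ler01 (lexx _); rewrite scale1r.
have shd z : differentiable g (z + t *: v) -> differentiable (fun z => g (z + t *: v)) z.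
  move=> h; apply: (@differentiable_comp _ _ _ _ (fun z => z + t *: v) g) => //.
have shD z w : differentiable g (z + t *: v) ->
    'D_w (fun z => g (z + t *: v)) z = 'D_w g (z + t *: v).
  move=> h; rewrite (@derive_comp _ _ _ _ (fun z => z + t *: v) g)//.
  by rewrite deriveD// derive_id derive_cst addr0.
have [r r0 r1|r [r0 r1]] := @mean_value_segment _ _ G x (t *: u).
  apply: differentiableB; last by apply: (gd _ _).1; exact: inb0.
  by apply: shd; apply: (gd _ _).1; exact: inb1.
rewrite /G => ->; rewrite deriveB; last 2 first.
- by apply: diff_derivable; apply: shd; apply: (gd _ _).1; exact: inb1.
- by apply: diff_derivable; apply: (gd _ _).1; exact: inb0.
have [g1 _] := gd _ (inb1 r r0 r1); have [g0 _] := gd _ (inb0 r r0 r1).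
rewrite shD// !deriveZDir// -scalerBr.
have [s s0 s1|s [s0 s1 ->]] := @mean_value_segment _ _ ('D_u g) (x + r *: (t *: u)) (t *: v).
  by apply: (gd _ _).2; exact: inb.
exists (x + r *: (t *: u) + s *: (t *: v)); first exact: inb.
by rewrite deriveZDir//; apply: (gd _ _).2; exact: inb.
Qed.

Lemma eq_of_cross_values V (A : set V) (F G : V -> R) x : open A -> A x ->
  {for x, continuous F} -> {for x, continuous G} ->
  (forall d, 0 < d -> ball x d `<=` A ->
    exists y z, [/\ ball x d y, ball x d z & F y = G z]) ->
  F x = G x.
Proof.
move=> oA Ax cF cG FG; apply/eqP; rewrite -subr_eq0 -normr_le0.
apply/ler_addgt0Pr => e e0; rewrite add0r.
have e2 : 0 < e / 2 by rewrite divr_gt0.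
have : \forall y \near x, [/\ A y, `|F x - F y| <= e / 2 & `|G x - G y| <= e / 2].
  move: cF => /cvgrPdist_le /(_ _ e2) cF; move: cG => /cvgrPdist_le /(_ _ e2) cG.
  apply: filterS3 (open_nbhs_nbhs (conj oA Ax)) cF cG => y a b c; exact: And3 a b c.
move=> /nbhs_ballP[d /= d0 dA].
have [y [z [yd zd yz]]] : exists y z, [/\ ball x d y, ball x d z & F y = G z].
  by apply: FG => // y /dA [].
have [_ h1 _] := dA _ yd; have [_ _ h2] := dA _ zd; move: h1 h2; rewrite yz.
move: (F x) (G x) (G z) => a b c h1 h2.
rewrite -(subrKA c) (le_trans (ler_normD _ _))// (splitr e) lerD//.
by rewrite distrC.
Qed.

Lemma schwarz V (A : set V) (g : V -> R) x u v : open A -> A x ->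
  (forall y, A y -> [/\ differentiable g y, differentiable ('D_u g) y &
     differentiable ('D_v g) y]) ->
  {for x, continuous ('D_v ('D_u g))} -> {for x, continuous ('D_u ('D_v g))} ->
  'D_v ('D_u g) x = 'D_u ('D_v g) x.
Proof.
move=> oA Ax gd cvu cuv; apply: (eq_of_cross_values oA Ax cvu cuv) => d d0 dA.
have nuv : 0 < `|u| + `|v| + 1 by rewrite ltr_wpDl.
pose t := d / 2 / (`|u| + `|v| + 1).
have t0 : 0 < t by rewrite !divr_gt0.
have td : t * `|u| + t * `|v| < d.
  rewrite -mulrDr /t -mulrA (@le_lt_trans _ _ (d / 2))//; last lra.
  rewrite ger_pMr ?divr_gt0// mulrC ler_pdivrMr// mul1r; lra.
have gu y : ball x d y -> differentiable g y /\ differentiable ('D_u g) y.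
  by move=> /dA/gd[a b c]; exact: conj a b.
have gv y : ball x d y -> differentiable g y /\ differentiable ('D_v g) y.
  by move=> /dA/gd[a b c]; exact: conj a c.
have [y xy E1] := second_difference gu t0 td.
have [z xz E2] : exists2 y, ball x d y &
    g (x + t *: v + t *: u) - g (x + t *: v) - (g (x + t *: u) - g x) =
    t * (t * 'D_u ('D_v g) y).
  by apply: second_difference gv t0 _; rewrite addrC.
exists y, z; apply: And3 xy xz _.
move: E1 E2; generalize ('D_v ('D_u g) y) ('D_u ('D_v g) z) => F G E1 E2.
apply: (mulfI (lt0r_neq0 t0)); apply: (mulfI (lt0r_neq0 t0)); rewrite -E1 -E2.
rewrite (addrAC x (t *: v)).
move: (g (x + t *: u + t *: v)) (g (x + t *: u)) (g (x + t *: v)) (g x) => a b c p; lra.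
Qed.

Lemma Rintegral_FTC (F f : R -> R) :
  (forall s : R, 0 <= s -> s <= 1 -> is_derive s 1 F (f s)) ->
  (forall s : R, 0 <= s -> s <= 1 -> {for s, continuous f}) ->
  \int[@lebesgue_measure R]_(s in `[0, 1]) f s = F 1 - F 0.
Proof.
move=> dF cf; rewrite /Rintegral (@continuous_FTC2 _ f F 0 1)//.
- apply/continuous_in_subspaceT => s; rewrite inE /= in_itv /= => /andP[s0 s1].
  exact: cf.
- have cF (s : R) : 0 <= s -> s <= 1 -> {for s, continuous F}.
    move=> s0 s1; have [dFs _] := dF s s0 s1.
    by apply: differentiable_continuous; apply/derivable1_diffP.
  split.
  + by move=> s; rewrite in_itv /= => /andP[/ltW s0 /ltW s1]; have [] := dF s s0 s1.
  + by apply: cvg_at_right_filter; apply: cF.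
  + by apply: cvg_at_left_filter; apply: cF.
- move=> s; rewrite in_itv /= => /andP[/ltW s0 /ltW s1].
  by rewrite derive1E; have [_ ->] := dF s s0 s1.
Qed.

End SchwarzFTC.

(** * The inverse function theorem *)
Section InverseFunction.
Variable R : realType.

Lemma nbhs_shift (V : normedModType R) (x : V) (A : set V) :
  nbhs x A -> \forall h \near (0 : V), A (h + x).
Proof.
move=> hA; have : \forall y \near x, A y by [].
by rewrite (near_shift 0) /=; apply: filterS => h /=; rewrite subr0.
Qed.

Lemma derive_jacobian k l (f : 'rV[R]_k -> 'rV[R]_l) x v :
  differentiable f x -> 'D_v f x = v *m 'J f x.
Proof. exact: deriveEjacobian. Qed.

Lemma jacobianE k l (f : 'rV[R]_k -> 'rV[R]_l) x i j :
  differentiable f x -> 'J f x i j = 'D_(delta_mx 0 i) (fun y => f y 0 j) x.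
Proof.
move=> fd; rewrite derive_rV// derive_jacobian// !mxE (bigD1 i)//= !mxE !eqxx.
rewrite mul1r big1 ?addr0// => m /negPf mi; rewrite mxE mi andbF mul0r.
by [].
Qed.

Lemma contraction_fixpoint k (p : 'rV[R]_k) (rho : R) (K : 'rV[R]_k -> 'rV[R]_k) :
  0 <= rho ->
  (forall x, `|p - x| <= rho -> `|p - K x| <= rho) ->
  (forall x y, `|p - x| <= rho -> `|p - y| <= rho ->
    `|K x - K y| <= 1 / 2 * `|x - y|) ->
  exists2 x, `|p - x| <= rho & K x = x.
Proof.
move=> rho0 KU Kc.
pose X : completeNormedModType R :=
  HB.pack 'rV[R]_k (Uniform_isComplete.Build 'rV[R]_k (@mx_complete R 1 k)).
pose U : set X := [set x : 'rV[R]_k | `|p - x| <= rho].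
pose f : {fun U >-> U} := HB.pack (K : X -> X) (isFun.Build _ _ U U (K : X -> X) KU).
have h0 : (0:R) <= 1 / 2 by lra.
have [|||x Ux xE] := @banach_fixed_point R X U f.
- exists (NngNum h0); split => /=; first lra.
  by move=> [x y] [/= Ux Uy]; exact: Kc.
- exact: (@closed_closed_ball_ R X).
- by exists p; rewrite /U /= subrr normr0.
by exists x => //; rewrite [RHS]xE.
Qed.

(** After multiplication by the inverse of the Jacobian matrix at p, strict
    differentiability says that f differs from the identity by a 1/2-Lipschitz
    map, so that solving f x = y is finding the fixed point of a contraction.
    The target is a whole ball because later constructions scale coordinates
    towards 0. *)
Lemma inverse_function k (A : set 'rV[R]_k) (f : 'rV[R]_k -> 'rV[R]_k) p :
  open A -> A p -> (forall x, A x -> differentiable f x) ->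
  (forall i j, {for p, continuous ('D_(delta_mx 0 i) (fun x => f x 0 j))}) ->
  (forall x, A x -> 'J f x \in unitmx) ->
  exists (A' : set 'rV[R]_k) (r : R) (g : 'rV[R]_k -> 'rV[R]_k),
    [/\ open A', A' p, A' `<=` A & 0 < r] /\
    [/\ forall x, A' x -> ball (f p) r (f x) /\ g (f x) = x,
        forall y, ball (f p) r y -> A' (g y) /\ f (g y) = y &
        forall y, ball (f p) r y -> differentiable g y].
Proof.
move=> oA Ap fd fc fJ; pose J := 'J f p; pose Ji := invmx J.
have JiK : J *m Ji = 1%:M by rewrite mulmxV// fJ.
have JKi : Ji *m J = 1%:M by rewrite mulVmx// fJ.
have [c c0 cJ] := mulmx_norm_le Ji.
have e0 : 0 < 1 / (2 * c) by rewrite divr_gt0// mulr_gt0.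
have [d d0 [dA dst]] := strictly_differentiable_rV oA Ap fd fc e0.
have st x y : ball p d x -> ball p d y ->
    `|(f y - f x) *m Ji - (y - x)| <= 1 / 2 * `|y - x|.
  move=> xd yd; have := dst x y xd yd; rewrite (derive_jacobian _ (fd p Ap)) -/J => h.
  have -> : (f y - f x) *m Ji - (y - x) = (f y - f x - (y - x) *m J) *m Ji.
    by rewrite [RHS]mulmxBl -(mulmxA _ J) JiK mulmx1.
  apply: (le_trans (cJ _)); apply: (@le_trans _ _ (c * (1 / (2 * c) * `|y - x|))).
    by rewrite ler_pM2l.
  rewrite mulrA ler_wpM2r//; have -> // : c * (1 / (2 * c)) = 1 / 2.
  by field; exact: lt0r_neq0.
have lip x y : ball p d x -> ball p d y -> `|y - x| <= 2 * c * `|f y - f x|.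
  move=> xd yd; have h := st x y xd yd; have h2 := cJ (f y - f x).
  have : `|y - x| <= `|(f y - f x) *m Ji| + `|(f y - f x) *m Ji - (y - x)|.
    by rewrite -{1}(subKr ((f y - f x) *m Ji) (y - x)) ler_normB.
  rewrite -(mulrA 2 c); move: h h2.
  move: (`|(f y - f x) *m Ji|) (`|(f y - f x) *m Ji - (y - x)|) => a b.
  by move: (`|y - x|) (c * _) => z s; lra.
have pd : ball p d p by exact: ballxx.
have inj x y : ball p d x -> ball p d y -> f x = f y -> x = y.
  move=> xd yd xy; apply/esym/eqP; rewrite -subr_eq0 -normr_le0.
  by have := lip x y xd yd; rewrite xy subrr normr0 mulr0.
(* with this radius the contraction K below maps the closed ball of radius
   d / 2 around p to itself: d / 4 from the Lipschitz part, c * r from y *)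
pose r := d / (4 * c).
have r0 : 0 < r by rewrite divr_gt0// mulr_gt0.
have inhalf x : `|p - x| <= d / 2 -> ball p d x.
  by rewrite -ball_normE /= => h; apply: (le_lt_trans h); lra.
have surj y : ball (f p) r y -> exists x, ball p d x /\ f x = y.
  move=> yr0; have yr : `|f p - y| < r by move: yr0; rewrite -ball_normE.
  pose K x := x - (f x - y) *m Ji.
  have [|||x xp Kx] := @contraction_fixpoint k p (d / 2) K.
  - by rewrite divr_ge0// ltW.
  - move=> x xp; rewrite /K.
    have -> : p - (x - (f x - y) *m Ji) =
        (f p - y) *m Ji - ((f p - f x) *m Ji - (p - x)).
      rewrite !mulmxBl; move: (f p *m Ji) (f x *m Ji) (y *m Ji) => a b e.
      by apply/rowP => j; rewrite !mxE; ring.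
    rewrite (le_trans (ler_normB _ _))//.
    have h1 := st x p (inhalf x xp) pd; have h2 := cJ (f p - y).
    have h3 : c * `|f p - y| <= d / 4.
      apply: (@le_trans _ _ (c * r)); first by rewrite ler_pM2l// ltW.
      rewrite /r; have -> // : c * (d / (4 * c)) = d / 4.
      by field; exact: lt0r_neq0.
    move: h1 h2 h3 xp; move: (`|_ *m Ji|) (`|_ - (p - x)|) (`|p - x|) (c * _).
    by move=> a b e s *; lra.
  - move=> x z xp zp; rewrite /K.
    have := st z x (inhalf z zp) (inhalf x xp); congr (_ <= _).
    rewrite -normrN; congr (`|_|).
    rewrite !mulmxBl; move: (f z *m Ji) (f x *m Ji) (y *m Ji) => a b e.
    by apply/rowP => j; rewrite !mxE; ring.
  exists x; split; first exact: inhalf.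
  have {}Kx : (f x - y) *m Ji = 0.
    by have : x - K x = 0; [rewrite Kx subrr|rewrite /K opprB addrC subrK].
  by apply/eqP; rewrite -subr_eq0 -(mulmx1 (f x - y)) -JKi mulmxA Kx mul0mx.
pose A' := [set x | ball p d x /\ ball (f p) r (f x)].
pose g y := xget p [set x | ball p d x /\ f x = y].
have gP y : ball (f p) r y -> ball p d (g y) /\ f (g y) = y.
  by move=> /surj h; exact: (xgetPex p h).
have fgK y : ball (f p) r y -> A' (g y) /\ f (g y) = y.
  by move=> yr; have [h1 h2] := gP y yr; split => //; split => //; rewrite h2.
have gfK x : A' x -> g (f x) = x.
  by move=> [xd fxr]; have [h1 h2] := gP _ fxr; exact: inj.
exists A', r, g; split; split => //.
- rewrite openE => x [xd fxr]; apply: filterI.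
    by apply: open_nbhs_nbhs; split => //; exact: ball_open.
  have /differentiable_continuous fcx := fd x (dA _ xd).
  by apply: fcx; apply: open_nbhs_nbhs; split => //; exact: ball_open.
- by split => //; exact: ballxx.
- by move=> x [/dA].
- by move=> x Ax; split; [case: Ax|exact: gfK].
move=> y0 y0r; have [[x0d fx0r] fx0] := fgK _ y0r; set x0 := g y0 in x0d fx0r fx0.
have Ax0 := dA _ x0d; pose J0 := invmx ('J f x0).
have J0K : 'J f x0 *m J0 = 1%:M by rewrite mulmxV// fJ.
have [c' c'0 cJ0] := mulmx_norm_le J0.
suff [] : differentiable g y0 /\ forall v, 'D_v g y0 = v *m J0 by [].
apply: differentiable_of_mx => e e1.
have e'0 : 0 < e / (2 * c * c') by rewrite divr_gt0// !mulr_gt0.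
have := differentiable_approx (fd _ Ax0) e'0.
move=> /nbhs_ballP[d' /= d'0 d'A].
have n1 : \forall h \near (0 : 'rV[R]_k), ball (f p) r (h + y0).
  have ob : open (ball (f p) r) by exact: ball_open.
  exact: nbhs_shift (open_nbhs_nbhs (conj ob y0r)).
have n2 : \forall h \near (0 : 'rV[R]_k), `|h| < d' / (2 * c).
  by apply: nbhs0_lt; rewrite divr_gt0// mulr_gt0.
apply: (filterS2 _ _ n1 n2) => h hr hd'.
have [[xd fxr] fx] := fgK _ hr; set x := g (h + y0) in xd fxr fx *.
have hx : `|x - x0| <= 2 * c * `|h|.
  by have := lip x0 x x0d xd; rewrite fx fx0 addrK.
have : ball (0 : 'rV[R]_k) d' (x - x0).
  rewrite -ball_normE /= sub0r normrN (le_lt_trans hx)// mulrC.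
  by rewrite -ltr_pdivlMr// mulr_gt0.
move=> /d'A; rewrite subrK fx fx0 addrK -(deriveE _ (fd _ Ax0)).
rewrite (derive_jacobian _ (fd _ Ax0)) => h1.
have -> : x - x0 - h *m J0 = - ((h - (x - x0) *m 'J f x0) *m J0).
  by rewrite mulmxBl -mulmxA J0K mulmx1 opprB.
rewrite normrN (le_trans (cJ0 _))//.
apply: (@le_trans _ _ (c' * (e / (2 * c * c') * (2 * c * `|h|)))).
  by rewrite ler_pM2l//; apply: (le_trans h1); rewrite ler_pM2l.
rewrite le_eqVlt; apply/orP; left; apply/eqP.
by field; rewrite ?lt0r_neq0.
Qed.

End InverseFunction.

(** * Integrals over [0, 1] depending on parameters *)
Section UnitIntegral.
Variable R : realType.
Notation mu := (@lebesgue_measure R).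
Definition cont01 (f : R -> R) :=
  forall s : R, 0 <= s -> s <= 1 -> {for s, continuous f}.

Lemma cont01_integrable f : cont01 f -> mu.-integrable `[0, 1] (EFin \o f).
Proof.
move=> cf; apply: continuous_compact_integrable; first exact: segment_compact.
apply/continuous_in_subspaceT => s; rewrite inE /= in_itv /= => /andP[s0 s1].
exact: cf.
Qed.

Lemma unit_integralD f g : cont01 f -> cont01 g ->
  \int[mu]_(s in `[0, 1]) (f s + g s) =
  \int[mu]_(s in `[0, 1]) f s + \int[mu]_(s in `[0, 1]) g s.
Proof. by move=> cf cg; rewrite RintegralD//; exact: cont01_integrable. Qed.

Lemma unit_integralZ c f : cont01 f ->
  \int[mu]_(s in `[0, 1]) (c * f s) = c * \int[mu]_(s in `[0, 1]) f s.
Proof. by move=> cf; rewrite RintegralZl//; exact: cont01_integrable. Qed.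

Lemma unit_integral_cst c : \int[mu]_(s in `[0, 1]) c = c.
Proof.
rewrite Rintegral_cst//= lebesgue_measure_itv /= lte_fin ltr01.
by rewrite oppr0 adde0 /= mulr1.
Qed.

Lemma eq_unit_integral f g : (forall s : R, 0 <= s -> s <= 1 -> f s = g s) ->
  \int[mu]_(s in `[0, 1]) f s = \int[mu]_(s in `[0, 1]) g s.
Proof.
move=> fg; apply: eq_Rintegral => s; rewrite inE /= in_itv /= => /andP[s0 s1].
exact: fg.
Qed.

Lemma cont01M f g : cont01 f -> cont01 g -> cont01 (fun s => f s * g s).
Proof. by move=> cf cg s s0 s1; apply: continuousM; [exact: cf|exact: cg]. Qed.

Lemma cont01D f g : cont01 f -> cont01 g -> cont01 (fun s => f s + g s).
Proof. by move=> cf cg s s0 s1; apply: continuousD; [exact: cf|exact: cg]. Qed.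

Lemma cont01_cst c : cont01 (fun=> c).
Proof. by move=> s _ _; exact: cst_continuous. Qed.

Lemma cont01_sum (I : Type) (r : seq I) (f : I -> R -> R) :
  (forall i, cont01 (f i)) -> cont01 (fun s => \sum_(i <- r) f i s).
Proof.
move=> cf; elim: r => [|i r IH].
  rewrite (_ : (fun _ => _) = fun=> 0); first exact: cont01_cst.
  by apply/funext => s; rewrite big_nil.
rewrite (_ : (fun _ => _) = fun s => f i s + \sum_(j <- r) f j s).
  exact: cont01D.
by apply/funext => s; rewrite big_cons.
Qed.

Lemma unit_integral_sum (I : Type) (r : seq I) (f : I -> R -> R) :
  (forall i, cont01 (f i)) ->
  \int[mu]_(s in `[0, 1]) (\sum_(i <- r) f i s) =
  \sum_(i <- r) \int[mu]_(s in `[0, 1]) f i s.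
Proof.
move=> cf; elim: r => [|i r IH].
  by rewrite big_nil; under eq_Rintegral do rewrite big_nil; rewrite unit_integral_cst.
under eq_Rintegral do rewrite big_cons.
by rewrite unit_integralD ?big_cons ?IH//; exact: cont01_sum.
Qed.

Lemma unit_integral_le f c : cont01 f ->
  (forall s : R, 0 <= s -> s <= 1 -> `|f s| <= c) ->
  `|\int[mu]_(s in `[0, 1]) f s| <= c.
Proof.
move=> cf fc; apply: le_trans (le_normr_Rintegral _ _) _ => //.
  exact: cont01_integrable.
rewrite -(unit_integral_cst c); apply: le_Rintegral => //.
- by apply: (@cont01_integrable (fun s => `|f s|)) => s s0 s1; apply: continuous_comp; [exact: cf|exact: norm_continuous].
- by apply: (@cont01_integrable (fun=> c)); exact: cont01_cst.
- by move=> s; rewrite /= in_itv /= => /andP[s0 s1]; exact: fc.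
Qed.

Lemma differentiable_row_mx k (x : 'rV[R]_k) (s : R) :
  differentiable (fun s : R => row_mx x (s%:M : 'rV[R]_1)) s.
Proof.
apply: differentiable_rV => i; case: (split_ordP i) => j ->.
  rewrite (_ : (fun _ => _) = fun=> x 0 j); first exact: differentiable_cst.
  by apply/funext => t; rewrite row_mxEl.
rewrite (_ : (fun _ => _) = id) //.
by apply/funext => t; rewrite row_mxEr mxE !ord1 eqxx mulr1n.
Qed.

Lemma norm_row_mx_lt k l (x : 'rV[R]_k) (y : 'rV[R]_l) d :
  `|x| < d -> `|y| < d -> `|row_mx x y| < d.
Proof.
move=> xd yd; apply: rV_norm_lt; first exact: le_lt_trans xd.
move=> i; case: (split_ordP i) => j ->.
  by rewrite row_mxEl (le_lt_trans (coord_le_norm _ _)).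
by rewrite row_mxEr (le_lt_trans (coord_le_norm _ _)).
Qed.

Lemma norm_scalar_mx1 (a : R) : `|(a%:M : 'rV[R]_1)| = `|a|.
Proof.
apply/eqP; rewrite eq_le; apply/andP; split.
  by apply: rV_norm_le => // i; rewrite !mxE !ord1 eqxx.
by have := coord_le_norm (a%:M : 'rV[R]_1) 0; rewrite !mxE eqxx.
Qed.

(** Continuity in the parameter is uniform in s because [0, 1] is compact. *)
Lemma uniform_on_unit k (B : set 'rV[R]_(k + 1)) (F : 'rV[R]_(k + 1) -> R) x (e : R) :
  open B -> (forall s : R, 0 <= s -> s <= 1 -> B (row_mx x s%:M)) ->
  (forall y, B y -> {for y, continuous F}) -> 0 < e ->
  \forall h \near (0 : 'rV[R]_k), forall s : R, 0 <= s -> s <= 1 ->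
    B (row_mx (h + x) s%:M) /\
    `|F (row_mx (h + x) s%:M) - F (row_mx x s%:M)| <= e.
Proof.
move=> oB xB cF e0.
have /compact_near_coveringP cov : compact (`[0, 1]%classic : set R) by exact: segment_compact.
pose P (h : 'rV[R]_k) (s : R) :=
  B (row_mx (h + x) s%:M) /\ `|F (row_mx (h + x) s%:M) - F (row_mx x s%:M)| <= e.
suff : \forall h \near nbhs (0 : 'rV[R]_k), `[0, 1]%classic `<=` P h.
  apply: filterS => h hP s s0 s1; apply: hP; by rewrite /= in_itv /= s0 s1.
apply: cov => s; rewrite /= in_itv /= => /andP[s0 s1].
have e2 : 0 < e / 2 by rewrite divr_gt0.
have n1 := open_nbhs_nbhs (conj oB (xB s s0 s1)).
have /cvgrPdist_le /(_ _ e2) n2 := cF _ (xB s s0 s1).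
have : \forall z \near (row_mx x s%:M : 'rV[R]_(k + 1)),
    B z /\ `|F (row_mx x s%:M) - F z| <= e / 2.
  by apply: filterS2 n1 n2 => z.
move=> /nbhs_ballP[d /= d0 dA].
have inb (h : 'rV[R]_k) (t : R) : `|h| < d -> `|s - t| < d ->
    ball (row_mx x (s%:M : 'rV[R]_1)) d (row_mx (h + x) t%:M).
  move=> hd td; rewrite -ball_normE /= opp_row_mx add_row_mx.
  apply: norm_row_mx_lt; first by rewrite opprD addrCA subrr addr0 normrN.
  by rewrite -raddfB norm_scalar_mx1.
have m1 : \forall t \near s, `|s - t| < d by apply: nbhsx_ballx.
have m2 : \forall h \near (0 : 'rV[R]_k), `|h| < d by exact: nbhs0_lt.
exists ([set t | `|s - t| < d], [set h : 'rV[R]_k | `|h| < d]) => //=.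
move=> [t h] [/= td hd].
have [B1 F1] := dA _ (inb h t hd td).
have [_ F2] : B (row_mx x t%:M) /\ `|F (row_mx x s%:M) - F (row_mx x t%:M)| <= e / 2.
  by have := inb 0 t _ td; rewrite add0r normr0 => /(_ d0)/dA.
split => //.
rewrite -(subrKA (F (row_mx x s%:M))) (le_trans (ler_normD _ _))// (splitr e).
by rewrite lerD// distrC.
Qed.

End UnitIntegral.

Section ParametricIntegral.
Variable R : realType.
Notation mu := (@lebesgue_measure R).

Lemma cont01_row k (B : set 'rV[R]_(k + 1)) (F : 'rV[R]_(k + 1) -> R) x :
  (forall s : R, 0 <= s -> s <= 1 -> B (row_mx x s%:M)) ->
  (forall y, B y -> {for y, continuous F}) -> cont01 (fun s => F (row_mx x s%:M)).
Proof.
move=> xB cF s s0 s1.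
apply: (@continuous_comp _ _ _ (fun s : R => row_mx x (s%:M : 'rV[R]_1)) F).
  exact: (differentiable_continuous (differentiable_row_mx x s)).
by apply: cF; exact: xB.
Qed.

(** By the mean value theorem the error in the first order expansion of the
    integrand at s is a difference of partial derivatives at nearby points,
    which is small uniformly in s. *)
Lemma differentiable_unit_integral k (B : set 'rV[R]_(k + 1))
    (g : 'rV[R]_(k + 1) -> R) x :
  open B -> (forall y, B y -> differentiable g y) ->
  (forall y v, B y -> {for y, continuous ('D_v g)}) ->
  (forall s : R, 0 <= s -> s <= 1 -> B (row_mx x s%:M)) ->
  differentiable (fun x => \int[mu]_(s in `[0, 1]) g (row_mx x s%:M)) x /\
  forall v, 'D_v (fun x => \int[mu]_(s in `[0, 1]) g (row_mx x s%:M)) x =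
     \int[mu]_(s in `[0, 1]) 'D_(row_mx v 0) g (row_mx x s%:M).
Proof.
move=> oB gd gc xB; pose e_ i : 'rV[R]_(k + 1) := row_mx (delta_mx 0 i) 0.
pose c i := \int[mu]_(s in `[0, 1]) 'D_(e_ i) g (row_mx x s%:M).
have Dsum v z : B z -> 'D_(row_mx v 0) g z = \sum_i v 0 i * 'D_(e_ i) g z.
  move=> Bz; have -> : row_mx v 0 = \sum_i v 0 i *: e_ i.
    rewrite {1}(row_sum_delta v); apply/rowP => j; rewrite summxE.
    case: (split_ordP j) => m ->; rewrite ?row_mxEl ?row_mxEr ?summxE.
      by apply: eq_bigr => i _; rewrite [RHS]mxE row_mxEl !mxE.
    by rewrite mxE big1// => i _; rewrite mxE row_mxEr mxE mulr0.
  rewrite (deriveE _ (gd _ Bz)) linear_sum /=; apply: eq_bigr => i _.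
  by rewrite linearZ /= (deriveE _ (gd _ Bz)).
have cD v : cont01 (fun s => 'D_v g (row_mx x s%:M)).
  exact: (@cont01_row _ B ('D_v g) x xB (fun y By => gc y v By)).
have intD v : \int[mu]_(s in `[0, 1]) 'D_(row_mx v 0) g (row_mx x s%:M) =
    \sum_i v 0 i * c i.
  rewrite (@eq_unit_integral _ _ (fun s => \sum_i v 0 i * 'D_(e_ i) g (row_mx x s%:M))).
    rewrite unit_integral_sum; last first.
      by move=> i; apply: cont01M; [exact: cont01_cst|exact: cD].
    by apply: eq_bigr => i _; rewrite unit_integralZ.
  by move=> s s0 s1; apply: Dsum; exact: xB.
suff [dG DG] : differentiable (fun x => \int[mu]_(s in `[0, 1]) g (row_mx x s%:M)) x /\
  forall v, 'D_v (fun x => \int[mu]_(s in `[0, 1]) g (row_mx x s%:M)) x = \sum_i v 0 i * c i.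
  by split => // v; rewrite DG intD.
apply: differentiable_of_coef => e e0.
pose e1 := e / (k%:R + 1).
have e10 : 0 < e1 by rewrite divr_gt0// ltr_wpDl.
have near_D : \forall h \near (0 : 'rV[R]_k), forall i, forall s : R, 0 <= s -> s <= 1 ->
    B (row_mx (h + x) s%:M) /\
    `|'D_(e_ i) g (row_mx (h + x) s%:M) - 'D_(e_ i) g (row_mx x s%:M)| <= e1.
  have H i := uniform_on_unit oB xB (fun y (By : B y) => gc y (e_ i) By) e10.
  exact: (@filter_forall _ _ _ _ (nbhs_filter _) H).
have near_B : \forall h \near (0 : 'rV[R]_k), forall s : R, 0 <= s -> s <= 1 ->
    B (row_mx (h + x) s%:M) /\ `|(fun=> 0 : R) (row_mx (h + x) s%:M) - 0 : R| <= 1.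
  apply: (@uniform_on_unit _ _ B (fun=> 0) x 1) => //.
  by move=> y By; exact: cst_continuous.
have : \forall h \near (0 : 'rV[R]_k),
    (forall s : R, 0 <= s -> s <= 1 -> B (row_mx (h + x) s%:M)) /\
    forall i, forall s : R, 0 <= s -> s <= 1 ->
    `|'D_(e_ i) g (row_mx (h + x) s%:M) - 'D_(e_ i) g (row_mx x s%:M)| <= e1.
  apply: filterS2 near_B near_D => h h1 h2.
  split=> [s s0 s1|i s s0 s1]; first by have [] := h1 s s0 s1.
  by have [] := h2 i s s0 s1.
move=> /nbhs_ballP[d /= d0 dA].
apply/nbhs_ballP; exists d => //= h hd.
have [hB _] := dA _ hd.
pose rest s := g (row_mx (h + x) s%:M) + -1 * g (row_mx x s%:M) +
   -1 * 'D_(row_mx h 0) g (row_mx x s%:M).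
have gcont y : B y -> {for y, continuous g}.
  by move=> By; apply: differentiable_continuous; exact: gd.
have c1 : cont01 (fun s => g (row_mx (h + x) s%:M)) by exact: (@cont01_row _ B).
have c0 : cont01 (fun s => g (row_mx x s%:M)) by exact: (@cont01_row _ B).
have c2 : cont01 (fun s => -1 * g (row_mx x s%:M)).
  by apply: cont01M; [exact: cont01_cst|].
have c3 : cont01 (fun s => -1 * 'D_(row_mx h 0) g (row_mx x s%:M)).
  by apply: cont01M; [exact: cont01_cst|exact: cD].
have -> : \int[mu]_(s in `[0, 1]) g (row_mx (h + x) s%:M) -
    \int[mu]_(s in `[0, 1]) g (row_mx x s%:M) - \sum_i h 0 i * c i =
    \int[mu]_(s in `[0, 1]) rest s.
  rewrite /rest unit_integralD//; last exact: cont01D.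
  rewrite unit_integralD// !unit_integralZ//.
  by rewrite -intD !mulN1r.
apply: unit_integral_le; first by do 2! apply: cont01D => //.
move=> s s0 s1; rewrite /rest !mulN1r.
have zd t : 0 <= t -> t <= 1 -> ball (0 : 'rV[R]_k) d (t *: h).
  move=> t0 t1; have := @ball_segment R _ (0 : 'rV[R]_k) 0 h d t.
  by rewrite !add0r; apply => //; exact: ballxx.
have rowE t : row_mx x s%:M + t *: row_mx h 0 = row_mx (t *: h + x) (s%:M : 'rV[R]_1).
  by rewrite scale_row_mx scaler0 add_row_mx addr0 addrC.
have [t t0 t1|t [t0 t1]] := @mean_value_segment _ _ g (row_mx x s%:M) (row_mx h 0).
  by rewrite rowE; apply: gd; apply: (dA _ (zd t t0 t1)).1.
have {1}-> : row_mx x s%:M + row_mx h 0 = row_mx (h + x) (s%:M : 'rV[R]_1).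
  by rewrite -[row_mx h 0]scale1r rowE scale1r.
move=> ->; rewrite rowE.
have [tB tD] := dA _ (zd t t0 t1).
have -> : 'D_(row_mx h 0) g (row_mx (t *: h + x) s%:M) =
   \sum_i h 0 i * 'D_(e_ i) g (row_mx (t *: h + x) s%:M).
  by rewrite Dsum//; exact: tB.
rewrite Dsum; last exact: xB.
rewrite -sumrB (le_trans (ler_norm_sum _ _ _))//.
have : \sum_(i < k) `|h 0 i * 'D_(e_ i) g (row_mx (t *: h + x) s%:M) -
    h 0 i * 'D_(e_ i) g (row_mx x s%:M)| <= \sum_(i < k) `|h| * e1.
  apply: ler_sum => i _; rewrite -mulrBr normrM ler_pM ?coord_le_norm//.
  exact: tD.
move=> /le_trans; apply; rewrite sumr_const card_ord -mulr_natr -mulrA mulrC.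
rewrite ler_wpM2r// /e1 mulrAC ler_pdivrMr ?ltr_wpDl//.
by rewrite mulrDr mulr1 lerDl ltW.
Qed.

End ParametricIntegral.

(** * Functions known together with all their derivatives *)
Lemma iterD_rcons (R : realType) (V W : normedModType R) vs v (g : V -> W) :
  iterD (rcons vs v) g = iterD vs ('D_v g).
Proof. by elim: vs => //= u vs ->. Qed.

(** What is assumed of the given functions for all known functions to be stable
    under differentiation. *)
Record stable_data (R : realType) N := StableData {
  sd_dom : set 'rV[R]_N;
  sd_fun : set ('rV[R]_N -> R);
  sd_open : open sd_dom;
  sd_diff : forall g x, sd_fun g -> sd_dom x -> differentiable g x;
  sd_D : forall g v, sd_fun g ->
    exists2 g', sd_fun g' & forall x, sd_dom x -> 'D_v g x = g' x }.

Section Known.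
Variables (R : realType) (N : nat) (D : stable_data R N).
Notation mu := (@lebesgue_measure R).

(** The rules of quad with the side conditions under which derivatives of
    known functions are again known. In known_unit_integral smoothness of the
    integrand is assumed on top of being known so that the stability under
    differentiation can be proved by induction on the rules; known_smooth
    shows afterwards that it always holds. Likewise for differentiability of
    the inverse map in known_inverse. *)
Inductive known : forall k : nat, set 'rV[R]_k -> ('rV[R]_k -> R) -> Prop :=
| known_base g : sd_fun D g -> known (sd_dom D) g
| known_cst k (A : set 'rV[R]_k) (c : R) : open A -> known A (fun=> c)
| known_coord k (A : set 'rV[R]_k) (i : 'I_k) :
    open A -> known A (fun x => x 0 i)
| known_add k (A : set 'rV[R]_k) g h :
    known A g -> known A h -> known A (fun x => g x + h x)
| known_mul k (A : set 'rV[R]_k) g h :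
    known A g -> known A h -> known A (fun x => g x * h x)
| known_inv k (A : set 'rV[R]_k) g :
    known A g -> (forall x, A x -> g x != 0) -> known A (fun x => (g x)^-1)
| known_comp k l (A : set 'rV[R]_k) (B : set 'rV[R]_l)
    (g : 'rV[R]_l -> R) (h : 'rV[R]_k -> 'rV[R]_l) :
    known B g -> open A -> (forall i, known A (fun x => h x 0 i)) ->
    (forall x, A x -> B (h x)) -> known A (fun x => g (h x))
| known_unit_integral k (A : set 'rV[R]_k) (B : set 'rV[R]_(k + 1))
    (g : 'rV[R]_(k + 1) -> R) :
    known B g -> smooth B g -> open A ->
    (forall x (s : R), A x -> 0 <= s -> s <= 1 -> B (row_mx x s%:M)) ->
    known A (fun x => \int[mu]_(s in `[0, 1]) g (row_mx x s%:M))
| known_inverse k (A B : set 'rV[R]_k) (g h : 'rV[R]_k -> 'rV[R]_k)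
    (i : 'I_k) :
    open A -> open B -> (forall j, known A (fun x => g x 0 j)) ->
    (forall x, A x -> B (g x) /\ h (g x) = x) ->
    (forall y, B y -> A (h y) /\ g (h y) = y) ->
    (forall x, A x -> 'J g x \in unitmx) ->
    (forall y, B y -> differentiable h y) ->
    known B (fun y => h y 0 i)
| known_restrict k (A A' : set 'rV[R]_k) g g' :
    known A g -> open A' -> A' `<=` A -> (forall x, A' x -> g' x = g x) ->
    known A' g'.

Lemma known_open k (A : set 'rV[R]_k) g : known A g -> open A.
Proof. by elim=> // *; exact: sd_open. Qed.

Lemma known_eq k (A : set 'rV[R]_k) g g' :
  known A g -> (forall x, A x -> g' x = g x) -> known A g'.
Proof. by move=> kg e; apply: (known_restrict kg) => //; exact: known_open kg. Qed.

Lemma known_opp k (A : set 'rV[R]_k) g : known A g -> known A (fun x => - g x).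
Proof.
move=> kg; apply: (@known_eq _ _ (fun x => -1 * g x)).
  by apply: known_mul => //; apply: known_cst; exact: known_open kg.
by move=> x _; rewrite mulN1r.
Qed.

Lemma known_sub k (A : set 'rV[R]_k) g h :
  known A g -> known A h -> known A (fun x => g x - h x).
Proof. by move=> kg kh; apply: known_add => //; exact: known_opp. Qed.

Lemma known_sum k (A : set 'rV[R]_k) (I : Type) (r : seq I) (g : I -> 'rV[R]_k -> R) :
  open A -> (forall i, known A (g i)) -> known A (fun x => \sum_(i <- r) g i x).
Proof.
move=> oA kg; elim: r => [|i r IH].
  by apply: (@known_eq _ _ (fun=> 0)) => [|x _]; [exact: known_cst|rewrite big_nil].
apply: (@known_eq _ _ (fun x => g i x + \sum_(j <- r) g j x)) => [|x _].
  exact: known_add.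
by rewrite big_cons.
Qed.

Lemma known_prod k (A : set 'rV[R]_k) (I : Type) (r : seq I) (g : I -> 'rV[R]_k -> R) :
  open A -> (forall i, known A (g i)) -> known A (fun x => \prod_(i <- r) g i x).
Proof.
move=> oA kg; elim: r => [|i r IH].
  by apply: (@known_eq _ _ (fun=> 1)) => [|x _]; [exact: known_cst|rewrite big_nil].
apply: (@known_eq _ _ (fun x => g i x * \prod_(j <- r) g j x)) => [|x _].
  exact: known_mul.
by rewrite big_cons.
Qed.

Lemma known_det k (A : set 'rV[R]_k) m (F : 'rV[R]_k -> 'M[R]_m) : open A ->
  (forall i j, known A (fun x => F x i j)) -> known A (fun x => \det (F x)).
Proof.
move=> oA kF; apply: known_sum => // s; apply: known_mul; first exact: known_cst.
by apply: known_prod.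
Qed.

Lemma known_invmx k (A : set 'rV[R]_k) m (F : 'rV[R]_k -> 'M[R]_m) i j : open A ->
  (forall i j, known A (fun x => F x i j)) ->
  (forall x, A x -> F x \in unitmx) -> known A (fun x => invmx (F x) i j).
Proof.
move=> oA kF uF.
apply: (@known_eq _ _ (fun x => (\det (F x))^-1 *
   ((-1) ^+ (j + i) * \det (row' j (col' i (F x)))))) => [|x Ax].
  apply: known_mul.
    apply: known_inv; first exact: known_det.
    by move=> x /uF; rewrite unitmxE unitfE.
  apply: known_mul; first exact: known_cst.
  apply: known_det => // a b.
  apply: (@known_eq _ _ (fun x => F x (lift j a) (lift i b))) => // x _.
  by rewrite !mxE.
by rewrite /invmx uF// !mxE.
Qed.

Lemma known_jacobian k l (A : set 'rV[R]_k) (g : 'rV[R]_k -> 'rV[R]_l) i j :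
  (forall x, A x -> differentiable g x) ->
  known A ('D_(delta_mx 0 i) (fun x => g x 0 j)) -> known A (fun x => 'J g x i j).
Proof.
by move=> gd kD; apply: (known_eq kD) => x Ax; rewrite jacobianE//; exact: gd.
Qed.

(** Every rule has a differentiation formula built from known functions:
    Leibniz and chain rules, differentiation under the integral sign, and the
    inverse of the Jacobian matrix, whose entries are quotients of minors. *)
Lemma known_sound k (A : set 'rV[R]_k) g : known A g ->
  [/\ forall x, A x -> differentiable g x, quad (sd_dom D) (sd_fun D) A g &
      forall v, known A ('D_v g)].
Proof.
elim=> {k A g}.
- move=> g bg; split.
  + by move=> x Mx; exact: (sd_diff bg).
  + exact: quad_data.
  + move=> v; have [g' bg' gE] := sd_D v bg.
    by apply: (known_eq (known_base bg')) => x /gE.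
- move=> k A c oA; split.
  + by move=> x _; exact: differentiable_cst.
  + exact: quad_cst.
  + move=> v; apply: (known_eq (known_cst 0 oA)) => x _.
    exact: derive_cst.
- move=> k A i oA; split.
  + by move=> x _; exact: differentiable_coord.
  + exact: quad_coord.
  + move=> v; apply: (known_eq (known_cst (v 0 i) oA)) => x _.
    by rewrite (@derive_rV _ _ _ id)// derive_id.
- move=> k A g h kg [gd gq gD] kh [hd hq hD]; split.
  + by move=> x Ax; apply: differentiableD; [exact: gd|exact: hd].
  + exact: quad_add.
  + move=> v; apply: (known_eq (known_add (gD v) (hD v))) => x Ax.
    by rewrite deriveD//; apply: diff_derivable; [exact: gd|exact: hd].
- move=> k A g h kg [gd gq gD] kh [hd hq hD]; split.
  + by move=> x Ax; apply: differentiableM; [exact: gd|exact: hd].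
  + exact: quad_mul.
  + move=> v; apply: (known_eq (known_add (known_mul kg (hD v)) (known_mul kh (gD v)))) => x Ax.
    by rewrite deriveM//; apply: diff_derivable; [exact: gd|exact: hd].
- move=> k A g kg [gd gq gD] g0; split.
  + by move=> x Ax; apply: differentiableV; [exact: gd|exact: g0].
  + exact: quad_inv.
  + move=> v; have ki := known_inv kg g0.
    apply: (known_eq (known_opp (known_mul (known_mul ki ki) (gD v)))) => x Ax.
    rewrite deriveV//; [|exact: g0|by apply: diff_derivable; exact: gd].
    by rewrite -exprVn expr2 scaleNr.
- move=> k l A B g h kg [gd gq gD] oA kh IH AB.
  have hd x : A x -> differentiable h x.
    by move=> Ax; apply: differentiable_rV => i; have [+ _ _] := IH i; apply.
  split.
  + move=> x Ax; apply: (@differentiable_comp _ _ _ _ h g); first exact: hd.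
    by apply: gd; exact: AB.
  + by apply: (quad_comp gq) => // i; have [] := IH i.
  + move=> v.
    apply: (@known_eq _ _ (fun x => \sum_i 'D_v (fun x => h x 0 i) x * 'D_(delta_mx 0 i) g (h x))).
      apply: known_sum => // i; apply: known_mul; first by have [_ _] := IH i.
      by apply: (known_comp (gD (delta_mx 0 i))).
    move=> x Ax; rewrite (derive_comp _ (hd x Ax)); last by apply: gd; exact: AB.
    rewrite derive_sum_coord; last by apply: gd; exact: AB.
    by apply: eq_bigr => i _; rewrite derive_rV//; exact: hd.
- move=> k A B g kg [gd gq gD] sg oA AB; split.
  + move=> x Ax; apply: (differentiable_unit_integral (known_open kg) _ _ _).1 => //.
    * by move=> y v By; apply: differentiable_continuous; exact: (sg [:: v]).
    * by move=> s; exact: AB.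
  + apply: (@quad_integral _ _ _ _ _ A B) => // x s Ax /andP[s0 s1]; exact: AB.
  + move=> v.
    have ki : known A (fun x => \int[mu]_(s in `[0, 1]) 'D_(row_mx v 0) g (row_mx x s%:M)).
      have sD : smooth B ('D_(row_mx v 0) g).
        by move=> vs x Bx; have := sg (rcons vs (row_mx v 0)) x Bx; rewrite iterD_rcons.
      exact: (known_unit_integral (gD (row_mx v 0)) sD oA AB).
    apply: (known_eq ki) => x Ax.
    apply: (differentiable_unit_integral (known_open kg) _ _ _).2 => //.
    * by move=> y u By; apply: differentiable_continuous; exact: (sg [:: u]).
    * by move=> s; exact: AB.
- move=> k A B g h i oA oB kg IH gB hA uJ hd; split.
  + by move=> y By; apply: differentiable_rVP; exact: hd.
  + by apply: (@quad_inverse _ _ _ _ _ A B g) => // j; have [] := IH j.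
  + move=> v.
    have gd x : A x -> differentiable g x.
      by move=> Ax; apply: differentiable_rV => j; have [+ _ _] := IH j; apply.
    have kh j : known B (fun y => h y 0 j) by exact: (@known_inverse _ A B g h).
    have kJ a b : known B (fun y => invmx ('J g (h y)) a b).
      apply: (@known_comp _ _ B A (fun x => invmx ('J g x) a b) h) => //.
        apply: known_invmx => // c d; apply: known_jacobian => //.
        by have [_ _] := IH d.
      by move=> y /hA[].
    apply: (@known_eq _ _ (fun y => \sum_j v 0 j * invmx ('J g (h y)) j i)).
      by apply: known_sum => // j; apply: known_mul => //; exact: known_cst.
    move=> y By; have [Ahy ghy] := hA y By.
    rewrite (derive_rV _ _ (hd y By)).
    have E : 'D_('D_v h y) g (h y) = v.
      rewrite -(derive_comp _ (hd y By) (gd _ Ahy)).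
      rewrite (@eq_open_derive _ _ _ B _ id)// ?derive_id// => z; rewrite inE => Bz.
      by have [] := hA z Bz.
    have -> : 'D_v h y = v *m invmx ('J g (h y)).
      by rewrite -{2}E (derive_jacobian _ (gd _ Ahy)) -mulmxA mulmxV ?mulmx1// uJ.
    by rewrite mxE.
- move=> k A A' g g' kg [gd gq gD] oA' A'A gg'; split.
  + move=> x A'x; apply: (@eq_open_differentiable _ _ _ A' _ g) => //.
      by move=> z; rewrite inE; exact: gg'.
    by apply: gd; exact: A'A.
  + exact: (quad_restrict gq).
  + move=> v; apply: (known_restrict (gD v)) => // x A'x.
    by apply: (@eq_open_derive _ _ _ A') => // z; rewrite inE; exact: gg'.
Qed.

Lemma known_D k (A : set 'rV[R]_k) g v : known A g -> known A ('D_v g).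
Proof. by move=> /known_sound[]. Qed.

Lemma known_diff k (A : set 'rV[R]_k) g x : known A g -> A x -> differentiable g x.
Proof. by move=> /known_sound[+ _ _]; apply. Qed.

Lemma known_continuous k (A : set 'rV[R]_k) g x :
  known A g -> A x -> {for x, continuous g}.
Proof. by move=> kg Ax; apply: differentiable_continuous; exact: known_diff kg Ax. Qed.

Lemma known_quad k (A : set 'rV[R]_k) g : known A g -> quad (sd_dom D) (sd_fun D) A g.
Proof. by move=> /known_sound[]. Qed.

Lemma known_iterD k (A : set 'rV[R]_k) g vs : known A g -> known A (iterD vs g).
Proof. by move=> kg; elim: vs => //= v vs IH; exact: known_D. Qed.

Lemma known_smooth k (A : set 'rV[R]_k) g : known A g -> smooth A g.
Proof. by move=> kg vs x Ax; apply: known_diff Ax; exact: known_iterD. Qed.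

Lemma known_schwarz k (A : set 'rV[R]_k) g u v x : known A g -> A x ->
  'D_u ('D_v g) x = 'D_v ('D_u g) x.
Proof.
move=> kg Ax; apply: (@schwarz _ _ A) => //; first exact: known_open kg.
- move=> y Ay; split; apply: known_diff Ay => //; exact: known_D.
- by apply: known_continuous Ax; do 2 apply: known_D.
- by apply: known_continuous Ax; do 2 apply: known_D.
Qed.

Definition knownV k l (A : set 'rV[R]_k) (h : 'rV[R]_k -> 'rV[R]_l) :=
  forall i, known A (fun x => h x 0 i).

Lemma knownV_diff k l (A : set 'rV[R]_k) (h : 'rV[R]_k -> 'rV[R]_l) x :
  knownV A h -> A x -> differentiable h x.
Proof.
by move=> kh Ax; apply: differentiable_rV => i; exact: known_diff (kh i) Ax.
Qed.

Lemma knownV_D k l (A : set 'rV[R]_k) (h : 'rV[R]_k -> 'rV[R]_l) v :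
  knownV A h -> knownV A ('D_v h).
Proof.
move=> kh i; apply: (known_eq (known_D v (kh i))) => x Ax.
by rewrite derive_rV//; exact: knownV_diff kh Ax.
Qed.

Lemma known_Dfield k (A : set 'rV[R]_k) g (u : 'rV[R]_k -> 'rV[R]_k) :
  known A g -> knownV A u -> known A (fun x => 'D_(u x) g x).
Proof.
move=> kg ku; apply: (@known_eq _ _ (fun x => \sum_i u x 0 i * 'D_(delta_mx 0 i) g x)).
  apply: known_sum; first exact: known_open kg.
  by move=> i; apply: known_mul => //; exact: known_D.
by move=> x Ax; rewrite derive_sum_coord//; exact: known_diff kg Ax.
Qed.

Lemma known_pairing k (A : set 'rV[R]_k) (a u : 'rV[R]_k -> 'rV[R]_k) : open A ->
  knownV A a -> knownV A u -> known A (fun x => pairing (a x) (u x)).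
Proof.
by move=> oA ka ku; apply: known_sum => // i; exact: known_mul.
Qed.

Lemma known_jac k l (A : set 'rV[R]_k) (g : 'rV[R]_k -> 'rV[R]_l) i j :
  knownV A g -> known A (fun x => 'J g x i j).
Proof.
move=> kg; apply: known_jacobian => [x Ax|]; first exact: knownV_diff kg Ax.
exact: known_D.
Qed.

Lemma knownV_cst k l (A : set 'rV[R]_k) (a : 'rV[R]_l) : open A -> knownV A (fun=> a).
Proof. by move=> oA i; exact: known_cst. Qed.

Lemma knownV_comp k l m (A : set 'rV[R]_k) (B : set 'rV[R]_l)
    (h : 'rV[R]_k -> 'rV[R]_l) (g : 'rV[R]_l -> 'rV[R]_m) : open A ->
  knownV A h -> knownV B g -> (forall x, A x -> B (h x)) ->
  knownV A (fun x => g (h x)).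
Proof. by move=> oA kh kg AB i; exact: (known_comp (kg i)). Qed.

Lemma knownV_mulmx k l m (A : set 'rV[R]_k) (h : 'rV[R]_k -> 'rV[R]_l)
    (P : 'rV[R]_k -> 'M[R]_(l, m)) : open A ->
  knownV A h -> (forall i j, known A (fun x => P x i j)) ->
  knownV A (fun x => h x *m P x).
Proof.
move=> oA kh kP j; apply: (@known_eq _ _ (fun x => \sum_i h x 0 i * P x i j)).
  by apply: known_sum => // i; exact: known_mul.
by move=> x _; rewrite mxE.
Qed.

End Known.

(** * Exterior derivatives and Cartan's formula *)
Section Pairing.
Variables (R : realType) (k : nat).
Implicit Types (a b u v : 'rV[R]_k).

Lemma pairingE a v : pairing a v = \sum_i a 0 i * v 0 i.
Proof. by []. Qed.

Lemma pairingDl a b v : pairing (a + b) v = pairing a v + pairing b v.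
Proof. by rewrite -big_split; apply: eq_bigr => i _; rewrite mxE mulrDl. Qed.

Lemma pairingDr a u v : pairing a (u + v) = pairing a u + pairing a v.
Proof. by rewrite -big_split; apply: eq_bigr => i _; rewrite mxE mulrDr. Qed.

Lemma pairingZl c a v : pairing (c *: a) v = c * pairing a v.
Proof. by rewrite mulr_sumr; apply: eq_bigr => i _; rewrite mxE mulrA. Qed.

Lemma pairingZr c a v : pairing a (c *: v) = c * pairing a v.
Proof. by rewrite mulr_sumr; apply: eq_bigr => i _; rewrite mxE mulrCA. Qed.

Lemma pairingNr a v : pairing a (- v) = - pairing a v.
Proof. by rewrite -scaleN1r pairingZr mulN1r. Qed.

Lemma pairingBr a u v : pairing a (u - v) = pairing a u - pairing a v.
Proof. by rewrite pairingDr pairingNr. Qed.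

Lemma pairing0r a : pairing a 0 = 0.
Proof. by rewrite -(scale0r 0) pairingZr mul0r. Qed.

Lemma pairing_delta a i : pairing a (delta_mx 0 i) = a 0 i.
Proof.
rewrite /pairing (bigD1 i)//= mxE !eqxx mulr1 big1 ?addr0// => j /negPf ji.
by rewrite mxE ji andbF mulr0.
Qed.

Lemma pairing_diff (V : normedModType R) (a b : V -> 'rV[R]_k) (x : V) :
  differentiable a x -> differentiable b x ->
  differentiable (fun y => pairing (a y) (b y)) x.
Proof.
move=> da db; rewrite (_ : (fun _ => _) = \sum_(i < k) (fun y => a y 0 i * b y 0 i)).
  apply: differentiable_sum => i.
  by apply: differentiableM; exact: differentiable_rVP.
by apply/funext => y; rewrite fct_sumE.
Qed.

Lemma derive_pairing (V : normedModType R) (a b : V -> 'rV[R]_k) x (v : V) :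
  differentiable a x -> differentiable b x ->
  'D_v (fun y => pairing (a y) (b y)) x =
  pairing ('D_v a x) (b x) + pairing (a x) ('D_v b x).
Proof.
move=> da db; rewrite (_ : (fun _ => _) = \sum_(i < k) (fun y => a y 0 i * b y 0 i)).
  rewrite derive_sum => [|i].
    rewrite -big_split; apply: eq_bigr => i _ /=.
    rewrite deriveM; try by apply: diff_derivable; exact: differentiable_rVP.
    rewrite (derive_rV _ _ da) (derive_rV _ _ db) addrC.
    by rewrite -![_ *: _]/(_ * _) (mulrC (b x 0 i)).
  apply: diff_derivable.
  by apply: differentiableM; exact: differentiable_rVP.
by apply/funext => y; rewrite fct_sumE.
Qed.

Lemma derive_pairingl (V : normedModType R) (a : V -> 'rV[R]_k) x (v : V) b :
  differentiable a x ->
  'D_v (fun y => pairing (a y) b) x = pairing ('D_v a x) b.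
Proof.
move=> da; have db : differentiable (fun _ : V => b) x by exact: differentiable_cst.
rewrite (derive_pairing _ da db).
by rewrite (_ : 'D_v (fun=> b) x = 0) ?pairing0r ?addr0//; exact: derive_cst.
Qed.

Lemma ext_deriv_sym (lam : 'rV[R]_k -> 'rV[R]_k) x u v :
  ext_deriv lam x u v = - ext_deriv lam x v u.
Proof. by rewrite /ext_deriv opprB. Qed.

Lemma ext_derivDr (lam : 'rV[R]_k -> 'rV[R]_k) x u v v' : differentiable lam x ->
  ext_deriv lam x u (v + v') = ext_deriv lam x u v + ext_deriv lam x u v'.
Proof.
move=> dl.
have e : pairing ('D_(v + v') lam x) u = pairing ('D_v lam x) u + pairing ('D_v' lam x) u.
  by rewrite -pairingDl; congr pairing; exact: deriveDir.
apply: (etrans (congr2 (fun a b : R => a - b) (pairingDr ('D_u lam x) v v') e)).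
by rewrite opprD addrACA.
Qed.

Lemma ext_derivZr (lam : 'rV[R]_k -> 'rV[R]_k) x u c v : differentiable lam x ->
  ext_deriv lam x u (c *: v) = c * ext_deriv lam x u v.
Proof.
move=> dl.
have e : pairing ('D_(c *: v) lam x) u = c * pairing ('D_v lam x) u.
  by rewrite -pairingZl; congr pairing; exact: deriveZDir.
apply: (etrans (congr2 (fun a b : R => a - b) (pairingZr c ('D_u lam x) v) e)).
by rewrite mulrBr.
Qed.

Lemma ext_derivDl (lam : 'rV[R]_k -> 'rV[R]_k) x u u' v : differentiable lam x ->
  ext_deriv lam x (u + u') v = ext_deriv lam x u v + ext_deriv lam x u' v.
Proof.
move=> dl; rewrite (ext_deriv_sym _ _ (u + u')) (ext_derivDr v u u' dl) opprD.
by rewrite (ext_deriv_sym lam x u v) (ext_deriv_sym lam x u' v).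
Qed.

Lemma ext_derivZl (lam : 'rV[R]_k -> 'rV[R]_k) x u c v : differentiable lam x ->
  ext_deriv lam x (c *: u) v = c * ext_deriv lam x u v.
Proof.
move=> dl; rewrite (ext_deriv_sym _ _ (c *: u)) (ext_derivZr v c u dl) -mulrN.
by rewrite (ext_deriv_sym lam x u v).
Qed.

Lemma ext_deriv_id (lam : 'rV[R]_k -> 'rV[R]_k) x u : ext_deriv lam x u u = 0.
Proof. by rewrite /ext_deriv subrr. Qed.

(** Cartan's formula: it replaces the derivatives of u by the exterior
    derivative and a function, which behave well under changes of
    coordinates. *)
Lemma lie_derivE (lam u : 'rV[R]_k -> 'rV[R]_k) x v :
  differentiable lam x -> differentiable u x ->
  lie_deriv u lam x v =
  ext_deriv lam x (u x) v + 'D_v (fun y => pairing (lam y) (u y)) x.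
Proof.
move=> dl du; rewrite derive_pairing// /lie_deriv /ext_deriv.
by rewrite addrA subrK.
Qed.

End Pairing.

(** * Known charts and pullbacks *)
Section Charts.
Variables (R : realType) (N : nat) (D : stable_data R N).
Notation known := (@known R N D).
Notation knownV := (@knownV R N D).

Record chart k (A B : set 'rV[R]_k) (Phi Psi : 'rV[R]_k -> 'rV[R]_k) : Prop := Chart {
  chart_opA : open A; chart_opB : open B;
  chart_kPhi : knownV A Phi; chart_kPsi : knownV B Psi;
  chart_PhiK : forall x, A x -> B (Phi x) /\ Psi (Phi x) = x;
  chart_PsiK : forall y, B y -> A (Psi y) /\ Phi (Psi y) = y }.

Lemma chart_DPhi k (A B : set 'rV[R]_k) Phi Psi y v : chart A B Phi Psi -> B y ->
  'D_('D_v Psi y) Phi (Psi y) = v.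
Proof.
move=> [oA oB kPhi kPsi PhiK PsiK] By; have [APy PPy] := PsiK y By.
rewrite -(derive_comp _ (knownV_diff kPsi By) (knownV_diff kPhi APy)).
rewrite (@eq_open_derive _ _ _ B _ id)// ?derive_id// => z; rewrite inE => Bz.
by have [] := PsiK z Bz.
Qed.

Lemma chart_sym k (A B : set 'rV[R]_k) Phi Psi : chart A B Phi Psi -> chart B A Psi Phi.
Proof. by case. Qed.

Lemma chart_DPsi k (A B : set 'rV[R]_k) Phi Psi x v : chart A B Phi Psi -> A x ->
  'D_('D_v Phi x) Psi (Phi x) = v.
Proof. by move=> /chart_sym; exact: chart_DPhi. Qed.

Lemma known_open_neq0 k (A : set 'rV[R]_k) g : known A g ->
  open (A `&` [set x | g x != 0]).
Proof.
move=> kg; rewrite openE => x [Ax gx]; apply: filterI.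
  by apply: open_nbhs_nbhs; split => //; exact: known_open kg.
have c : g z @[z --> x] --> g x := known_continuous kg Ax.
exact: (cvgr_neq0 _ c gx).
Qed.

Lemma unitmx_of_inj k (P : 'M[R]_k) :
  (forall v : 'rV[R]_k, v *m P = 0 -> v = 0) -> P \in unitmx.
Proof.
move=> h; rewrite -row_free_unit -kermx_eq0; apply/eqP/row_matrixP => i.
by rewrite row0; apply: h; rewrite -row_mul mulmx_ker row0.
Qed.

Lemma known_restrictV k l (A A' : set 'rV[R]_k) (g : 'rV[R]_k -> 'rV[R]_l) :
  knownV A g -> open A' -> A' `<=` A -> knownV A' g.
Proof. by move=> kg oA' A'A i; apply: (known_restrict (kg i)). Qed.

(** A known map with injective derivative at p has a known local inverse.
    The domain is first shrunk to make the Jacobian invertible throughout, as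
    known_inverse requires. *)
Lemma local_chart k (A : set 'rV[R]_k) Phi p : open A -> A p -> knownV A Phi ->
  (forall v, 'D_v Phi p = 0 -> v = 0) ->
  exists A' r Psi, [/\ chart A' (ball (Phi p) r) Phi Psi, A' `<=` A, A' p & 0 < r].
Proof.
move=> oA Ap kPhi inj.
pose A1 := A `&` [set x | \det ('J Phi x) != 0].
have kJ : known A (fun x => \det ('J Phi x)).
  by apply: known_det => // i j; exact: known_jac.
have oA1 : open A1 by exact: known_open_neq0.
have A1p : A1 p.
  split => //=; rewrite -unitfE -unitmxE; apply: unitmx_of_inj => v vJ.
  by apply: inj; rewrite derive_jacobian//; exact: knownV_diff kPhi Ap.
have kPhi1 : knownV A1 Phi by apply: known_restrictV kPhi oA1 _ => x [].
have uJ x : A1 x -> 'J Phi x \in unitmx by move=> [_]; rewrite unitmxE unitfE.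
have [||//|A' [r [Psi [[oA' A'p A'A1 r0] [PhiK PsiK dPsi]]]]] :=
    @inverse_function R k A1 Phi p oA1 A1p.
- by move=> x A1x; exact: knownV_diff kPhi1 A1x.
- by move=> i j; apply: known_continuous A1p; exact: known_D.
exists A', r, Psi; split => //; last by move=> x /A'A1[].
have kPhi' : knownV A' Phi by exact: known_restrictV kPhi1 oA' A'A1.
have oB : open (ball (Phi p) r) by exact: ball_open.
split => // i; apply: (@known_inverse _ _ _ _ A' _ Phi) => //.
by move=> x /A'A1; exact: uJ.
Qed.

Definition pull k (Psi lam : 'rV[R]_k -> 'rV[R]_k) (y : 'rV[R]_k) : 'rV[R]_k :=
  \row_i pairing (lam (Psi y)) ('D_(delta_mx 0 i) Psi y).

Lemma pairing_pull k (Psi lam : 'rV[R]_k -> 'rV[R]_k) y v : differentiable Psi y ->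
  pairing (pull Psi lam y) v = pairing (lam (Psi y)) ('D_v Psi y).
Proof.
move=> dP; rewrite (derive_sum_coord _ dP) !pairingE.
under eq_bigr do rewrite mxE pairingE mulr_suml.
rewrite exchange_big /=; apply: eq_bigr => i _.
rewrite summxE mulr_sumr; apply: eq_bigr => j _.
by rewrite [in RHS]mxE mulrA (mulrAC _ (_ j) _).
Qed.

Lemma differentiable_pull k (B : set 'rV[R]_k) (Psi lam : 'rV[R]_k -> 'rV[R]_k) y :
  knownV B Psi -> B y -> differentiable lam (Psi y) ->
  differentiable (pull Psi lam) y.
Proof.
move=> kP By dl; apply: differentiable_rV => i.
rewrite (_ : (fun _ => _) = fun y => pairing (lam (Psi y)) ('D_(delta_mx 0 i) Psi y)).
  apply: pairing_diff; last exact: knownV_diff (knownV_D _ kP) By.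
  by apply: (@differentiable_comp _ _ _ _ Psi lam) => //; exact: knownV_diff kP By.
by apply/funext => z; rewrite mxE.
Qed.

(** The exterior derivative commutes with pullbacks: the terms with second
    derivatives of Psi cancel by symmetry. *)
Lemma ext_deriv_pull k (B : set 'rV[R]_k) (Psi lam : 'rV[R]_k -> 'rV[R]_k) y u v :
  open B -> knownV B Psi -> B y -> differentiable lam (Psi y) ->
  ext_deriv (pull Psi lam) y u v =
  ext_deriv lam (Psi y) ('D_u Psi y) ('D_v Psi y).
Proof.
move=> oB kP By dl.
have dP z : B z -> differentiable Psi z by move=> Bz; exact: knownV_diff kP Bz.
have dlP : differentiable (fun y => lam (Psi y)) y.
  by apply: (@differentiable_comp _ _ _ _ Psi lam) => //; exact: dP.
have H a b : pairing ('D_a (pull Psi lam) y) b =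
    pairing ('D_('D_a Psi y) lam (Psi y)) ('D_b Psi y) +
    pairing (lam (Psi y)) ('D_a ('D_b Psi) y).
  have dbP : differentiable ('D_b Psi) y := knownV_diff (knownV_D b kP) By.
  rewrite -(derive_pairingl _ _ (differentiable_pull kP By dl)).
  rewrite (@eq_open_derive _ _ _ B _ (fun y => pairing (lam (Psi y)) ('D_b Psi y)) _ _ oB _ By).
    by rewrite (derive_pairing _ dlP dbP) (derive_comp _ (dP y By) dl).
  by move=> z; rewrite inE => Bz; exact: pairing_pull (dP z Bz).
have S : 'D_u ('D_v Psi) y = 'D_v ('D_u Psi) y.
  apply/rowP => i.
  have E a b : 'D_a ('D_b Psi) y 0 i = 'D_a ('D_b (fun z => Psi z 0 i)) y.
    rewrite -(derive_rV a i (knownV_diff (knownV_D b kP) By)).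
    apply: (@eq_open_derive _ _ _ B _ _ _ _ oB _ By) => z; rewrite inE => Bz.
    by rewrite (derive_rV b i (dP z Bz)).
  exact: (etrans (E u v) (etrans (known_schwarz u v (kP i) By) (esym (E v u)))).
apply: (etrans (congr2 (fun a b : R => a - b) (H u v) (H v u))).
rewrite /ext_deriv; move: S.
generalize ('D_u ('D_v Psi) y) ('D_v ('D_u Psi) y) => s1 s2 ->.
generalize (pairing ('D_('D_u Psi y) lam (Psi y)) ('D_v Psi y))
  (pairing ('D_('D_v Psi y) lam (Psi y)) ('D_u Psi y)) (pairing (lam (Psi y)) s2).
by move=> a b c; rewrite opprD addrACA subrr addr0.
Qed.

End Charts.

(** * Contact systems in coordinates *)
Section ContactSystems.
Variables (R : realType) (N : nat) (D : stable_data R N).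
Notation known := (@known R N D).
Notation knownV := (@knownV R N D).
Notation chart := (@chart R N D).

(** A contact system in a form that is invariant under changes of coordinates.
    The leaves are the levels of f. The conditions on Lie derivatives are
    expressed by Cartan's formula: cs_contact says that the Lie derivative of
    lam along w vanishes on ker lam, cs_closed and cs_const say that al is
    closed on the leaves and al(w) constant on them. *)
Record contact_sys k q (W : set 'rV[R]_k) (lam : 'rV[R]_k -> 'rV[R]_k)
    (f : 'rV[R]_k -> 'rV[R]_q) (al w : 'rV[R]_k -> 'rV[R]_k) : Prop := ContactSys {
  cs_open : open W;
  cs_klam : knownV W lam;
  cs_kf : knownV W f;
  cs_kw : knownV W w;
  cs_al : forall x, W x -> differentiable al x;
  cs_nondeg : forall x u, W x -> pairing (lam x) u = 0 -> u != 0 ->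
    exists v, pairing (lam x) v = 0 /\ ext_deriv lam x u v != 0;
  cs_trans : forall x, W x ->
    exists v, 'D_v f x = 0 /\ pairing (lam x) v != 0;
  cs_wf : forall x, W x -> 'D_(w x) f x = 0;
  cs_contact : forall x v, W x -> pairing (lam x) v = 0 ->
    ext_deriv lam x (w x) v + 'D_v (fun y => pairing (lam y) (w y)) x = 0;
  cs_closed : forall x u v, W x -> 'D_u f x = 0 -> 'D_v f x = 0 ->
    ext_deriv al x u v = 0;
  cs_ker : forall x v, W x -> 'D_v f x = 0 ->
    pairing (al x) v = 0 <-> pairing (lam x) v = 0;
  cs_const : forall x v, W x -> 'D_v f x = 0 ->
    'D_v (fun y => pairing (al y) (w y)) x = 0 }.

(** The vector field w in the chart Phi with inverse Psi. *)
Definition push k (Phi Psi w : 'rV[R]_k -> 'rV[R]_k) (y : 'rV[R]_k) : 'rV[R]_k :=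
  'D_(w (Psi y)) Phi (Psi y).

Lemma known_pull k (A B : set 'rV[R]_k) Phi Psi lam : chart A B Phi Psi ->
  knownV A lam -> knownV B (pull Psi lam).
Proof.
move=> [oA oB kPhi kPsi PhiK PsiK] kl i.
apply: (@known_eq _ _ _ _ _ (fun y => pairing (lam (Psi y)) ('D_(delta_mx 0 i) Psi y))).
  apply: known_pairing => //; last exact: knownV_D.
  by apply: knownV_comp kl _ => // y /PsiK[].
by move=> y _; rewrite mxE.
Qed.

Lemma known_push k (A B : set 'rV[R]_k) Phi Psi w : chart A B Phi Psi ->
  knownV A w -> knownV B (push Phi Psi w).
Proof.
move=> [oA oB kPhi kPsi PhiK PsiK] kw i.
have kD : known A (fun x => 'D_(w x) (fun x => Phi x 0 i) x) by exact: known_Dfield.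
have PB y : B y -> A (Psi y) by move=> /PsiK[].
apply: (known_eq (known_comp kD oB kPsi PB)) => y By.
by rewrite (derive_rV _ _ (knownV_diff kPhi (PB y By))).
Qed.

Lemma pairing_pull_push k (A B : set 'rV[R]_k) Phi Psi lam w y :
  chart A B Phi Psi -> B y ->
  pairing (pull Psi lam y) (push Phi Psi w y) = pairing (lam (Psi y)) (w (Psi y)).
Proof.
move=> ch By; have [oA oB kPhi kPsi PhiK PsiK] := ch.
have [APy PPy] := PsiK y By.
rewrite (pairing_pull _ _ (knownV_diff kPsi By)) /push.
congr pairing; have := chart_DPsi (w (Psi y)) ch APy; by rewrite PPy.
Qed.

Lemma contact_sys_pull k q (W A B : set 'rV[R]_k) lam (f : 'rV[R]_k -> 'rV[R]_q)
    al w Phi Psi :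
  contact_sys W lam f al w -> chart A B Phi Psi -> A `<=` W ->
  contact_sys B (pull Psi lam) (fun y => f (Psi y)) (pull Psi al) (push Phi Psi w).
Proof.
move=> S ch AW; have [oA oB kPhi kPsi PhiK PsiK] := ch.
have kl := known_restrictV (cs_klam S) oA AW.
have kw := known_restrictV (cs_kw S) oA AW.
have kf := known_restrictV (cs_kf S) oA AW.
have PA y : B y -> A (Psi y) by move=> /PsiK[].
have PW y : B y -> W (Psi y) by move=> /PA/AW.
have dP y : B y -> differentiable Psi y by move=> By; exact: knownV_diff kPsi By.
have dl y : B y -> differentiable lam (Psi y).
  by move=> By; exact: knownV_diff kl (PA y By).
have df y v : B y -> 'D_v (fun y => f (Psi y)) y = 'D_('D_v Psi y) f (Psi y).
  by move=> By; exact: derive_comp (dP y By) (knownV_diff kf (PA y By)).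
have wE y : B y -> 'D_(push Phi Psi w y) Psi y = w (Psi y).
  move=> By; have [_ PPy] := PsiK y By.
  by have := chart_DPsi (w (Psi y)) ch (PA y By); rewrite PPy.
have pairD (mu : 'rV[R]_k -> 'rV[R]_k) y v : B y -> differentiable mu (Psi y) ->
    'D_v (fun y => pairing (pull Psi mu y) (push Phi Psi w y)) y =
    'D_('D_v Psi y) (fun x => pairing (mu x) (w x)) (Psi y).
  move=> By dmu.
  have dmw : differentiable (fun x => pairing (mu x) (w x)) (Psi y).
    by apply: pairing_diff => //; exact: knownV_diff kw (PA y By).
  rewrite -(derive_comp _ (dP y By) dmw).
  apply: (eq_open_derive _ oB _ By) => z; rewrite inE => Bz.
  exact: pairing_pull_push ch Bz.
split => //.
- exact: known_pull ch kl.
- exact: knownV_comp oB kPsi kf PA.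
- exact: known_push ch kw.
- by move=> y By; apply: (differentiable_pull kPsi By); exact: (cs_al S (PW y By)).
- move=> y u By; rewrite (pairing_pull _ _ (dP y By)) => lu u0.
  have [|v [lv dv]] := cs_nondeg S (PW y By) lu.
    by apply: contra u0 => /eqP h; rewrite -(chart_DPhi u ch By) h derive0.
  have vE : 'D_('D_v Phi (Psi y)) Psi y = v.
    by have := chart_DPsi v ch (PA y By); rewrite (PsiK y By).2.
  exists ('D_v Phi (Psi y)).
  rewrite (pairing_pull _ _ (dP y By)) vE; split => //.
  by rewrite (ext_deriv_pull u _ oB kPsi By (dl y By)) vE.
- move=> y By; have [v [fv lv]] := cs_trans S (PW y By).
  have vE : 'D_('D_v Phi (Psi y)) Psi y = v.
    by have := chart_DPsi v ch (PA y By); rewrite (PsiK y By).2.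
  exists ('D_v Phi (Psi y)).
  by rewrite (df y _ By) (pairing_pull _ _ (dP y By)) vE.
- by move=> y By; rewrite (df y _ By) (wE y By); apply: (cs_wf S); exact: PW.
- move=> y v By; rewrite (pairing_pull _ _ (dP y By)) => lv.
  rewrite (pairD lam y v By (dl y By)).
  rewrite (ext_deriv_pull _ _ oB kPsi By (dl y By)) (wE y By).
  apply: (cs_contact S) lv; exact: PW.
- move=> y u v By; rewrite !(df y _ By) => fu fv.
  rewrite (ext_deriv_pull _ _ oB kPsi By (cs_al S (PW y By))).
  apply: (cs_closed S) fu fv; exact: PW.
- move=> y v By; rewrite (df y _ By) !(pairing_pull _ _ (dP y By)) => fv.
  apply: (cs_ker S) fv; exact: PW.
- move=> y v By; rewrite (df y _ By) (pairD al y v By (cs_al S (PW y By))) => fv.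
  apply: (cs_const S) fv; exact: PW.
Qed.

(** Near p, known coordinates turn w into a known field V which is constant
    along the lines Y + t V(Y), so that these lines are its trajectories. *)
Definition straightened k (W : set 'rV[R]_k) (w : 'rV[R]_k -> 'rV[R]_k) p : Prop :=
  exists A r Th Th' V,
    [/\ chart A (ball (Th p) r) Th Th', A `<=` W, A p & 0 < r] /\
    [/\ forall x, A x -> 'D_(w x) Th x = V (Th x),
        forall Y (t : R), V (Y + t *: V Y) = V Y & knownV setT V].

Lemma chart_restrict k (A B B' : set 'rV[R]_k) Phi Psi : chart A B Phi Psi ->
  open B' -> B' `<=` B -> chart (A `&` Phi @^-1` B') B' Phi Psi.
Proof.
move=> [oA oB kPhi kPsi PhiK PsiK] oB' B'B.
have oA' : open (A `&` Phi @^-1` B').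
  rewrite openE => x [Ax Bx]; apply: filterI.
    exact: open_nbhs_nbhs (conj oA Ax).
  have c : Phi z @[z --> x] --> Phi x.
    exact: differentiable_continuous (knownV_diff kPhi Ax).
  exact: (c _ (open_nbhs_nbhs (conj oB' Bx))).
split => //.
- by apply: (known_restrictV kPhi oA') => x [].
- exact: (known_restrictV kPsi oB').
- by move=> x [Ax Bx]; split => //; exact: (PhiK x Ax).2.
- by move=> y By; have [? e] := PsiK y (B'B y By); rewrite /= e.
Qed.

Lemma straightened_push k (W A B : set 'rV[R]_k) w Phi Psi p :
  chart A B Phi Psi -> A `<=` W -> A p ->
  straightened B (push Phi Psi w) (Phi p) -> straightened W w p.
Proof.
move=> ch AW Ap [A2 [r [Th [Th' [V [[ch2 A2B A2p r0] [wV Vc kV]]]]]]].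
have ch1 := chart_restrict ch (chart_opA ch2) A2B.
have [oA1 _ kPhi kPsi PhiK PsiK] := ch1; have [oA2 oB2 kTh kTh' ThK Th'K] := ch2.
exists (A `&` Phi @^-1` A2), r, (fun x => Th (Phi x)), (fun y => Psi (Th' y)), V.
split; last split => //.
- split => //.
  + split => //.
    * by apply: (knownV_comp oA1 kPhi kTh) => x /PhiK[].
    * by apply: (knownV_comp oB2 kTh' kPsi) => y /Th'K[].
    * move=> x Ax; have [A2x Px] := PhiK x Ax; have [Bx Tx] := ThK _ A2x.
      by rewrite Tx.
    * move=> y By; have [A2y Ty] := Th'K y By; have [Ay Py] := PsiK _ A2y.
      by rewrite Py.
  + by move=> x [/AW].
- move=> x A1x; have [A2x Px] := PhiK x A1x.
  rewrite (derive_comp _ (knownV_diff kPhi A1x) (knownV_diff kTh A2x)).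
  by rewrite -(wV _ A2x) /push Px.
Qed.

End ContactSystems.

(** * Averages along partial scalings *)
Section PartialScaling.
Variables (R : realType) (N : nat) (D : stable_data R N) (k : nat) (P : pred 'I_k).
Notation known := (@known R N D).
Notation knownV := (@knownV R N D).
Notation mu := (@lebesgue_measure R).

(** Scaling of the coordinates selected by P, and its velocity. For the
    coordinates along the leaves this is the homotopy of the Poincare lemma,
    for a single coordinate that of Hadamard's lemma. *)
Definition scl (s : R) (y : 'rV[R]_k) : 'rV[R]_k :=
  \row_j (if P j then s * y 0 j else y 0 j).
Definition cut (y : 'rV[R]_k) : 'rV[R]_k := \row_j (if P j then y 0 j else 0).

Lemma sclE s y : scl s y = scl 0 y + s *: cut y.
Proof.
by apply/rowP => j; rewrite !mxE; case: ifP => _; rewrite ?mul0r ?add0r ?mulr0 ?addr0.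
Qed.

Lemma scl1 y : scl 1 y = y.
Proof. by apply/rowP => j; rewrite !mxE mul1r if_same. Qed.

Lemma ball0E (V : normedModType R) r (y : V) : ball (0 : V) r y = (`|y| < r) :> Prop.
Proof. by rewrite -ball_normE /= sub0r normrN. Qed.

Lemma scl_ball r s y : 0 <= s -> s <= 1 ->
  ball (0 : 'rV[R]_k) r y -> ball (0 : 'rV[R]_k) r (scl s y).
Proof.
rewrite !ball0E => s0 s1; apply: le_lt_trans; apply: rV_norm_le => // j.
rewrite mxE; case: ifP => _; last exact: coord_le_norm.
by rewrite normrM ger0_norm// (le_trans _ (coord_le_norm y j))// ler_piMl.
Qed.

Lemma scl_diff s y : differentiable (scl s) y /\ forall v, 'D_v (scl s) y = scl s v.
Proof.
have E : scl s = fun z => z *m \matrix_(i, j) (if i == j then (if P j then s else 1) else 0).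
  apply/funext => z; apply/rowP => j; rewrite !mxE (bigD1 j)//= mxE eqxx big1 => [|i /negPf ij].
    by case: ifP => _; rewrite addr0 ?mulr1// mulrC.
  by rewrite mxE ij mulr0.
have [d h] := differentiable_mulmxr (\matrix_(i, j) (if i == j then (if P j then s else 1) else 0) : 'M[R]_k) y.
by rewrite E; split => // v; rewrite h -[in RHS]E.
Qed.

(** Open, unlike the product of the ball with [0, 1]: the rule for integrals
    asks for an integrand known on an open set. *)
Definition scl_dom r : set 'rV[R]_(k + 1) :=
  [set Y : 'rV[R]_(k + 1) | ball (0 : 'rV[R]_k) r (scl (Y 0 (rshift k 0)) (lsubmx Y))].

Lemma known_scl_coord (A : set 'rV[R]_(k + 1)) : open A ->
  knownV A (fun Y : 'rV[R]_(k + 1) => scl (Y 0 (rshift k 0)) (lsubmx Y)).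
Proof.
move=> oA j; case Pj : (P j).
  apply: (@known_eq _ _ _ _ _ (fun Y : 'rV[R]_(k + 1) => Y 0 (rshift k 0) * Y 0 (lshift 1 j))).
    by apply: known_mul; exact: known_coord.
  by move=> Y _; rewrite !mxE Pj.
apply: (@known_eq _ _ _ _ _ (fun Y : 'rV[R]_(k + 1) => Y 0 (lshift 1 j))); first exact: known_coord.
by move=> Y _; rewrite !mxE Pj.
Qed.

Lemma open_scl_dom r : open (scl_dom r).
Proof.
have kS := known_scl_coord (@openT _).
have ob : open (ball (0 : 'rV[R]_k) r) by exact: ball_open.
rewrite openE => Y BY.
pose sc (Z : 'rV[R]_(k + 1)) := scl (Z 0 (rshift k 0)) (lsubmx Z).
have c : sc Z @[Z --> Y] --> sc Y.
  exact: differentiable_continuous (knownV_diff kS (I : setT Y)).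
exact: (c _ (open_nbhs_nbhs (conj ob BY))).
Qed.

Lemma row_mx_last (y : 'rV[R]_k) s : row_mx y (s%:M : 'rV[R]_1) 0 (rshift k 0) = s.
Proof. by rewrite row_mxEr mxE eqxx mulr1n. Qed.

Section Average.
Variables (r : R) (g : 'rV[R]_k -> R).
Hypothesis kg : known (ball (0 : 'rV[R]_k) r) g.

Definition average y := \int[mu]_(s in `[0, 1]) g (scl s y).

Let G (Y : 'rV[R]_(k + 1)) := g (scl (Y 0 (rshift k 0)) (lsubmx Y)).

Let kG : known (scl_dom r) G.
Proof. have oS := @open_scl_dom r; have kS := known_scl_coord oS.
have SB (Y : 'rV[R]_(k + 1)) : scl_dom r Y ->
    ball (0 : 'rV[R]_k) r (scl (Y 0 (rshift k 0)) (lsubmx Y)) by [].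
exact: (known_comp kg oS kS SB). Qed.

Let avgE y : average y = \int[mu]_(s in `[0, 1]) G (row_mx y s%:M).
Proof. by apply: eq_unit_integral => s _ _; rewrite /G row_mx_last row_mxKl. Qed.

Let domP y s : ball (0 : 'rV[R]_k) r y -> 0 <= s -> s <= 1 -> scl_dom r (row_mx y s%:M).
Proof. by move=> yr s0 s1; rewrite /scl_dom /= row_mx_last row_mxKl; exact: scl_ball. Qed.

Lemma known_average : known (ball (0 : 'rV[R]_k) r) average.
Proof.
have ob : open (ball (0 : 'rV[R]_k) r) by exact: ball_open.
apply: (known_eq (known_unit_integral kG (known_smooth kG) ob domP)) => y _.
exact: avgE.
Qed.

Lemma cont01_scl y : ball (0 : 'rV[R]_k) r y -> cont01 (fun s => g (scl s y)).
Proof.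
move=> yr s s0 s1.
have E : (fun s => g (scl s y)) = fun s => g (scl 0 y + s *: cut y).
  by apply/funext => t; rewrite sclE.
rewrite E; apply: differentiable_continuous; apply/derivable1_diffP.
have dg : differentiable g (scl 0 y + s *: cut y).
  by rewrite -sclE; apply: known_diff kg _; exact: scl_ball.
by have [] := is_derive_line dg.
Qed.

Lemma is_derive_scl y (s : R) : ball (0 : 'rV[R]_k) r y -> 0 <= s -> s <= 1 ->
  is_derive s 1 (fun s => g (scl s y)) ('D_(cut y) g (scl s y)).
Proof.
move=> yr s0 s1.
have E : (fun s => g (scl s y)) = fun s => g (scl 0 y + s *: cut y).
  by apply/funext => t; rewrite sclE.
have dg : differentiable g (scl 0 y + s *: cut y).
  by rewrite -sclE; apply: known_diff kg _; exact: scl_ball.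
by have := is_derive_line dg; rewrite -E -sclE.
Qed.

Lemma derive_average y v : ball (0 : 'rV[R]_k) r y ->
  'D_v average y = \int[mu]_(s in `[0, 1]) 'D_(scl s v) g (scl s y).
Proof.
move=> yr; have ob : open (ball (0 : 'rV[R]_k) r) by exact: ball_open.
have -> : average = fun y => \int[mu]_(s in `[0, 1]) G (row_mx y s%:M).
  by apply/funext => z; exact: avgE.
have h1 Y : scl_dom r Y -> differentiable G Y by move=> BY; exact: known_diff kG BY.
have h2 Y u : scl_dom r Y -> {for Y, continuous ('D_u G)}.
  by move=> BY; exact: known_continuous (known_D _ kG) BY.
have [_ ->] := differentiable_unit_integral (known_open kG) h1 h2 (fun s => domP yr).
apply: eq_unit_integral => s s0 s1.
have dG : differentiable G (row_mx y s%:M) by apply: known_diff kG _; exact: domP.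
have E : (fun z => G (row_mx z (s%:M : 'rV[R]_1))) = fun z => g (scl s z).
  by apply/funext => z; rewrite /G row_mx_last row_mxKl.
have [dr Dr] : differentiable (fun z : 'rV[R]_k => row_mx z (s%:M : 'rV[R]_1)) y /\
    forall v, 'D_v (fun z : 'rV[R]_k => row_mx z (s%:M : 'rV[R]_1)) y = row_mx v 0.
  have [d h] := differentiable_mulmxr (row_mx 1%:M 0 : 'M[R]_(k, k + 1)) y.
  have F : (fun z : 'rV[R]_k => row_mx z (s%:M : 'rV[R]_1)) =
      (fun z => z *m row_mx 1%:M 0) + cst (row_mx 0 s%:M).
    apply/funext => z; rewrite fctE /= mul_mx_row mulmx1 mulmx0.
    by rewrite add_row_mx addr0 add0r.
  rewrite F; split; first exact: differentiableD.
  move=> u; rewrite deriveD; last exact: derivable_cst.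
    by rewrite derive_cst addr0 h mul_mx_row mulmx1 mulmx0.
  exact: diff_derivable.
rewrite -(Dr v) -(derive_comp v dr dG) E.
have [ds Ds] := scl_diff s y.
rewrite (derive_comp v ds) ?Ds//.
by apply: known_diff kg _; exact: scl_ball.
Qed.

End Average.

Lemma average_derive r g y : known (ball (0 : 'rV[R]_k) r) g ->
  ball (0 : 'rV[R]_k) r y ->
  \int[mu]_(s in `[0, 1]) 'D_(cut y) g (scl s y) = g y - g (scl 0 y).
Proof.
move=> kg yr.
have h1 (s : R) : 0 <= s -> s <= 1 ->
    is_derive s 1 (fun s => g (scl s y)) ('D_(cut y) g (scl s y)).
  by move=> s0 s1; exact: (is_derive_scl kg yr).
have h2 : cont01 (fun s => 'D_(cut y) g (scl s y)) := cont01_scl (known_D _ kg) yr.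
by rewrite (Rintegral_FTC h1 h2) scl1.
Qed.

End PartialScaling.

(** * Darboux coordinates from a leafwise closed contact form *)
Section ScaledForm.
Variables (R : realType) (k : nat).

Lemma derive_scale_pairing (g : 'rV[R]_k -> R) (lam : 'rV[R]_k -> 'rV[R]_k) x u v :
  differentiable g x -> differentiable lam x ->
  'D_u (fun y => g y * pairing (lam y) v) x =
  g x * pairing ('D_u lam x) v + 'D_u g x * pairing (lam x) v.
Proof.
move=> dg dl; have dv : differentiable (fun _ : 'rV[R]_k => v) x by exact: differentiable_cst.
rewrite deriveM; try by apply: diff_derivable => //; exact: pairing_diff.
rewrite (derive_pairingl _ _ dl) -![_ *: _]/(_ * _).
by rewrite [X in _ + X]mulrC.
Qed.

Lemma ext_deriv_scale (g : 'rV[R]_k -> R) (lam : 'rV[R]_k -> 'rV[R]_k) x u v :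
  differentiable g x -> differentiable lam x ->
  ext_deriv (fun y => g y *: lam y) x u v =
  g x * ext_deriv lam x u v + 'D_u g x * pairing (lam x) v - 'D_v g x * pairing (lam x) u.
Proof.
move=> dg dl.
have dgl : differentiable (fun y => g y *: lam y) x.
  apply: differentiable_rV => i.
  rewrite (_ : (fun _ => _) = fun y => g y * lam y 0 i).
    by apply: differentiableM => //; exact: differentiable_rVP.
  by apply/funext => y; rewrite mxE.
have H a b : pairing ('D_a (fun y => g y *: lam y) x) b =
    g x * pairing ('D_a lam x) b + 'D_a g x * pairing (lam x) b.
  rewrite -(derive_pairingl _ _ dgl) -(derive_scale_pairing a b dg dl).
  by congr ('D_a _ x); apply/funext => y; rewrite pairingZl.
apply: (etrans (congr2 (fun a b : R => a - b) (H u v) (H v u))).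
rewrite /ext_deriv.
generalize (pairing ('D_u lam x) v) (pairing ('D_v lam x) u) ('D_u g x) ('D_v g x).
by move=> a b e d; ring.
Qed.

End ScaledForm.

Section NormalForm.
Variables (R : realType) (N : nat) (D : stable_data R N) (q : nat).
Notation known := (@known R N D).
Notation knownV := (@knownV R N D).
Notation mu := (@lebesgue_measure R).
Notation rVk := 'rV[R]_(q + (1 + q)).

(** In a straightened foliation the first q coordinates label the leaf and
    those selected by fibre are coordinates on it. *)
Definition fibre : pred 'I_(q + (1 + q)) := fun j => (q <= j)%N.

Lemma lsubmx_cut (y : rVk) : lsubmx (cut fibre y) = 0.
Proof. by apply/rowP => j; rewrite !mxE /fibre /= leqNgt ltn_ord. Qed.

Lemma cut_fibre (v : rVk) : lsubmx v = 0 -> cut fibre v = v.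
Proof.
move=> v0; apply/rowP => j; rewrite !mxE /fibre; case: leqP => // jq.
by move/rowP : v0 => /(_ (Ordinal jq)); rewrite !mxE => <-; congr (v 0 _); exact: val_inj.
Qed.

Lemma scl_fibre s (v : rVk) : lsubmx v = 0 -> scl fibre s v = s *: v.
Proof.
move=> v0; rewrite -{1}(cut_fibre v0); apply/rowP => j; rewrite -(cut_fibre v0) !mxE.
by case: (fibre j); rewrite ?mulr0.
Qed.

Lemma derive_cut (P : pred 'I_(q + (1 + q))) (y v : rVk) :
  differentiable (cut P) y /\ 'D_v (cut P) y = cut P v.
Proof.
have -> : cut P = scl (predC P) 0 :> (rVk -> rVk).
  apply/funext => z; apply/rowP => j; rewrite !mxE /=.
  by case: (P j); rewrite /= ?mul0r.
by have [d Dd] := @scl_diff R (q + (1 + q)) (predC P) 0 y.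
Qed.

Variables (r : R) (nu : rVk -> rVk).
Hypothesis knu : knownV (ball (0 : rVk) r) nu.
Hypothesis closed_nu : forall y u v, ball (0 : rVk) r y ->
  lsubmx u = 0 -> lsubmx v = 0 -> ext_deriv nu y u v = 0.

Let W := ball (0 : rVk) r.
Let oW : open W. Proof. exact: ball_open. Qed.

(** A potential of nu on each leaf, obtained by integrating nu along the radial
    segment of the leaf that ends at y. *)
Definition primitive (y : rVk) : R :=
  pairing (\row_j average fibre (fun z => nu z 0 j) y) (cut fibre y).

Lemma known_primitive : known W primitive.
Proof.
apply: known_pairing => // j.
  by apply: (known_eq (known_average fibre (knu j))) => y _; rewrite mxE.
case Pj : (fibre j).
  by apply: (@known_eq _ _ _ _ _ (fun y => y 0 j)) => [|y _]; [exact: known_coord|rewrite mxE Pj].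
by apply: (@known_eq _ _ _ _ _ (fun y => 0)) => [|y _]; [exact: known_cst|rewrite mxE Pj].
Qed.

(** Poincare lemma along a leaf. Closedness of nu exchanges v with the radial
    vector in the derivative of the integrand, which thereby becomes the
    derivative of s |-> s * nu (scl s y) v. *)
Lemma derive_primitive y v : W y -> lsubmx v = 0 ->
  'D_v primitive y = pairing (nu y) v.
Proof.
move=> Wy v0.
have dnu z : W z -> differentiable nu z by move=> Wz; exact: knownV_diff knu Wz.
pose av y : rVk := \row_j average fibre (fun z => nu z 0 j) y.
have kav : knownV W av.
  by move=> j; apply: (known_eq (known_average fibre (knu j))) => z _; rewrite mxE.
have dav : differentiable av y := knownV_diff kav Wy.
have [dcut Dcut] := derive_cut fibre y v.
have sW (s : R) : 0 <= s -> s <= 1 -> W (scl fibre s y).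
  by move=> s0 s1; exact: scl_ball.
have kg : known W (fun z => pairing (nu z) v).
  by apply: known_pairing => //; exact: knownV_cst.
pose F s := pairing (nu (scl fibre s y)) v.
pose F' s := 'D_(cut fibre y) (fun z => pairing (nu z) v) (scl fibre s y).
have cF : cont01 F := cont01_scl kg Wy.
have cF' : cont01 F' := cont01_scl (known_D _ kg) Wy.
have cid : cont01 (fun s : R => s) by move=> s _ _; exact: cvg_id.
have dF (s : R) : 0 <= s -> s <= 1 ->
    is_derive s 1 (fun s => s * F s) (F s + s * F' s).
  move=> s0 s1.
  have [Fd FD] : is_derive s 1 F (F' s) := is_derive_scl fibre kg Wy s0 s1.
  have id_d : derivable (id : R -> R) s 1 by exact: derivable_id.
  apply: DeriveDef; first exact: (derivableM id_d Fd).
  apply: (etrans (deriveM id_d Fd)); rewrite derive_id FD.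
  by rewrite -![_ *: _]/(_ * _) mulr1 addrC.
have FTC : \int[mu]_(s in `[0, 1]) (F s + s * F' s) = pairing (nu y) v.
  have cc : cont01 (fun s => F s + s * F' s).
    by apply: cont01D => //; exact: cont01M.
  by rewrite (Rintegral_FTC dF cc) mul1r mul0r subr0 /F scl1.
rewrite -FTC /primitive (derive_pairing _ dav dcut) Dcut (cut_fibre v0).
rewrite !pairingE -/(av y).
pose dn i s := 'D_v (fun z => nu z 0 i) (scl fibre s y).
have cdn i : cont01 (dn i) := cont01_scl (known_D v (knu i)) Wy.
have cn i : cont01 (fun s => nu (scl fibre s y) 0 i) := cont01_scl (knu i) Wy.
have Dav i : 'D_v av y 0 i = \int[mu]_(s in `[0, 1]) (s * dn i s).
  rewrite -(derive_rV v i dav).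
  rewrite (_ : (fun _ => _) = average fibre (fun z => nu z 0 i)); last first.
    by apply/funext => z; rewrite mxE.
  rewrite (derive_average fibre (knu i) v Wy); apply: eq_unit_integral => s s0 s1.
  by rewrite (scl_fibre _ v0) deriveZDir//; exact: known_diff (knu i) (sW s s0 s1).
have -> : \sum_i 'D_v av y 0 i * cut fibre y 0 i =
    \sum_i \int[mu]_(s in `[0, 1]) (cut fibre y 0 i * (s * dn i s)).
  apply: eq_bigr => i _; rewrite unit_integralZ; last exact: cont01M.
  by rewrite mulrC Dav.
have -> : \sum_i av y 0 i * v 0 i =
    \sum_i \int[mu]_(s in `[0, 1]) (v 0 i * nu (scl fibre s y) 0 i).
  apply: eq_bigr => i _; rewrite unit_integralZ; last exact: cn.
  by rewrite mxE mulrC.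
rewrite -!unit_integral_sum; last 2 first.
- by move=> i; apply: cont01M; [exact: cont01_cst|exact: cn].
- by move=> i; apply: cont01M; [exact: cont01_cst|apply: cont01M => //; exact: cdn].
rewrite -unit_integralD; last 2 first.
- apply: cont01_sum => i; apply: cont01M; [exact: cont01_cst|apply: cont01M => //; exact: cdn].
- by apply: cont01_sum => i; apply: cont01M; [exact: cont01_cst|exact: cn].
apply: eq_unit_integral => s s0 s1.
have Ws := sW s s0 s1; set z := scl fibre s y in Ws.
have F'E : F' s = pairing ('D_v nu z) (cut fibre y).
  rewrite /F' (derive_pairingl _ _ (dnu z Ws)); apply/esym/eqP; rewrite -subr_eq0.
  by apply/eqP; exact: closed_nu Ws v0 (lsubmx_cut y).
rewrite F'E addrC; congr (_ + _).
  by rewrite /F pairingE; apply: eq_bigr => i _; rewrite mulrC.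
rewrite pairingE mulr_sumr; apply: eq_bigr => i _.
by rewrite /dn (derive_rV v i (dnu z Ws)) mulrC mulrA.
Qed.

Definition coef (j : 'I_q) (y : rVk) : R :=
  nu y 0 (lshift (1 + q) j) - 'D_(delta_mx 0 (lshift (1 + q) j)) primitive y.

Lemma known_coef j : known W (coef j).
Proof. by apply: known_sub; [exact: knu|exact: known_D known_primitive]. Qed.

Lemma lsubmx_delta_rshift (i : 'I_(1 + q)) :
  lsubmx (delta_mx 0 (rshift q i) : rVk) = 0.
Proof.
apply/rowP => j; rewrite !mxE /=; case: eqP => // /(congr1 val) /= e.
by have := ltn_ord j; rewrite e ltnNge leq_addr.
Qed.

Let sumE (F : 'I_(q + (1 + q)) -> R) :
  \sum_i F i = \sum_j F (lshift (1 + q) j) + \sum_j F (rshift q j).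
Proof. exact: big_split_ord. Qed.

(** On leaf directions nu is dS; the a_j are defined to account for the
    remaining directions. *)
Lemma form_decomposition y v : W y ->
  pairing (nu y) v = 'D_v primitive y + \sum_j coef j y * v 0 (lshift (1 + q) j).
Proof.
move=> Wy; have dS := known_diff known_primitive Wy.
rewrite (derive_sum_coord v dS) pairingE !sumE.
rewrite addrAC -big_split /=; congr (_ + _); apply: eq_bigr => j _.
  by rewrite /coef -[_ *: _]/(_ * _) mulrBl [X in X + _]mulrC addrC subrK.
rewrite (derive_primitive Wy (lsubmx_delta_rshift j)) pairing_delta.
by rewrite -[_ *: _]/(_ * _) mulrC.
Qed.

(** d nu = sum_j da_j /\ dy_j, as ddS = 0 by symmetry of second
    derivatives. *)
Lemma ext_deriv_decomposition y u v : W y ->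
  ext_deriv nu y u v =
  \sum_j ('D_u (coef j) y * v 0 (lshift (1 + q) j) -
          'D_v (coef j) y * u 0 (lshift (1 + q) j)).
Proof.
move=> Wy; have dnu := knownV_diff knu Wy.
have H a b : pairing ('D_a nu y) b =
    'D_a ('D_b primitive) y + \sum_j 'D_a (coef j) y * b 0 (lshift (1 + q) j).
  rewrite -(derive_pairingl _ _ dnu).
  pose c : rVk := row_mx (\row_j b 0 (lshift (1 + q) j)) 0.
  pose cf (y : rVk) : rVk := row_mx (\row_j coef j y) 0.
  have kcf : knownV W cf.
    move=> i; rewrite /cf; case: (split_ordP i) => j ->.
      by apply: (known_eq (known_coef j)) => z _; rewrite row_mxEl mxE.
    by apply: (known_eq (known_cst _ 0 oW)) => z _; rewrite row_mxEr mxE.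
  have cfE z : \sum_j coef j z * b 0 (lshift (1 + q) j) = pairing (cf z) c.
    rewrite pairingE sumE [X in _ + X]big1 ?addr0 => [|j _].
      by apply: eq_bigr => j _; rewrite /cf /c !row_mxEl !mxE.
    by rewrite /c !row_mxEr mxE mulr0.
  have dcf := knownV_diff kcf Wy.
  rewrite (@eq_open_derive _ _ _ W _ (fun z => 'D_b primitive z + pairing (cf z) c) _ _ oW _ Wy).
    rewrite deriveD; last 2 first.
    - by apply: diff_derivable; exact: known_diff (known_D _ known_primitive) Wy.
    - by apply: diff_derivable; apply: pairing_diff => //; exact: differentiable_cst.
    congr (_ + _); rewrite (derive_pairingl _ _ dcf) pairingE sumE.
    rewrite [X in _ + X]big1 ?addr0 => [|j _].
      apply: eq_bigr => j _; rewrite /c row_mxEl mxE -(derive_rV _ _ dcf).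
      have -> // : (fun z => cf z 0 (lshift (1 + q) j)) = coef j.
      by apply/funext => z; rewrite /cf row_mxEl mxE.
    by rewrite /c row_mxEr mxE mulr0.
  by move=> z; rewrite inE => Wz; rewrite (form_decomposition _ Wz) cfE.
apply: (etrans (congr2 (fun a b : R => a - b) (H u v) (H v u))).
rewrite (known_schwarz u v known_primitive Wy) sumrB.
generalize ('D_v ('D_u primitive) y) => s.
by rewrite opprD addrACA subrr add0r.
Qed.

Definition darboux (y : rVk) : rVk :=
  row_mx (lsubmx y) (row_mx (primitive y)%:M (\row_j coef j y)).

Lemma known_darboux : knownV W darboux.
Proof.
move=> i; case: (split_ordP i) => j ->.
  apply: (@known_eq _ _ _ _ _ (fun y => y 0 (lshift (1 + q) j))); first exact: known_coord.
  by move=> y _; rewrite row_mxEl mxE.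
case: (split_ordP j) => m ->.
  apply: (known_eq known_primitive) => y _.
  by rewrite row_mxEr row_mxEl !mxE !ord1 eqxx mulr1n.
by apply: (known_eq (known_coef m)) => y _; rewrite !row_mxEr mxE.
Qed.

Lemma derive_darboux y v : W y ->
  'D_v darboux y = row_mx (lsubmx v) (row_mx ('D_v primitive y)%:M (\row_j 'D_v (coef j) y)).
Proof.
move=> Wy; have dd := knownV_diff known_darboux Wy.
apply/rowP => i; rewrite -(derive_rV _ _ dd); case: (split_ordP i) => j ->.
  rewrite row_mxEl mxE (_ : (fun _ => _) = fun y : rVk => y 0 (lshift (1 + q) j)).
    by rewrite (@derive_rV _ _ _ id)// derive_id.
  by apply/funext => z; rewrite row_mxEl mxE.
case: (split_ordP j) => m ->.
  rewrite row_mxEr row_mxEl !mxE !ord1 eqxx mulr1n.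
  have -> // : (fun z => darboux z 0 (rshift q (lshift q 0))) = primitive.
  by apply/funext => z; rewrite row_mxEr row_mxEl !mxE eqxx mulr1n.
rewrite !row_mxEr !mxE.
have -> // : (fun z => darboux z 0 (rshift q (rshift 1 m))) = coef m.
by apply/funext => z; rewrite !row_mxEr mxE.
Qed.

(** A vector killed by dy, dS and da is killed by nu and by d nu, hence zero
    because nu is a contact form. *)
Lemma darboux_inj y v : W y ->
  (forall u, pairing (nu y) u = 0 -> u != 0 ->
    exists v, ext_deriv nu y u v != 0) ->
  'D_v darboux y = 0 -> v = 0.
Proof.
move=> Wy nd; rewrite derive_darboux// => e.
have [e1] : lsubmx v = 0 /\ row_mx ('D_v primitive y)%:M (\row_j 'D_v (coef j) y) = 0 :> 'rV_(1 + q).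
  by move: e; rewrite -[0]hsubmxK => /eq_row_mx[-> ->]; rewrite !linear0.
rewrite -[0]hsubmxK => /eq_row_mx[e2 e3].
have vj j : v 0 (lshift (1 + q) j) = 0 by move/rowP : e1 => /(_ j); rewrite !mxE.
have aj j : 'D_v (coef j) y = 0 by move/rowP : e3 => /(_ j); rewrite !mxE.
have S0 : 'D_v primitive y = 0 by move/rowP : e2 => /(_ 0); rewrite !mxE eqxx.
apply/eqP; apply/negPn/negP => v0.
have [|u /eqP[]] := nd v _ v0.
  by rewrite (form_decomposition _ Wy) S0 add0r big1// => j _; rewrite vj mulr0.
by rewrite (ext_deriv_decomposition _ _ Wy) big1// => j _; rewrite vj aj mulr0 mul0r subr0.
Qed.

Variables (w : rVk -> rVk) (c : R) (b : 'cV[R]_q).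
Hypothesis w_fibre : forall y, W y -> lsubmx (w y) = 0.
Hypothesis w_energy : forall y, W y ->
  pairing (nu y) (w y) = c + (lsubmx y *m b) 0 0.
Hypothesis w_contact : forall y v, W y ->
  ext_deriv nu y (w y) v + (lsubmx v *m b) 0 0 = 0.

(** chi d/dS - sum_j (d chi / dy_j) d/da_j for the affine function
    chi(y) = c + y b. *)
Definition normal_field (Y : rVk) : rVk :=
  row_mx 0 (row_mx (c + (lsubmx Y *m b) 0 0)%:M (- b^T)).

Let sum_pick (A B d z : 'I_q -> R) j : (forall i, d i = (i == j)%:R) ->
  (forall i, z i = 0) -> \sum_i (A i * d i - B i * z i) = A j.
Proof.
move=> dE zE; rewrite (bigD1 j)//= dE zE eqxx mulr1 mulr0 subr0 big1 ?addr0//.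
by move=> i /negPf ij; rewrite dE zE ij !mulr0 subr0.
Qed.

(** w_energy gives the component w(S). As w is tangent to the leaves, the
    contraction of d nu with w is sum_j w(a_j) dy_j, so that w_contact applied
    to the j-th basis vector gives w(a_j). *)
Lemma derive_darboux_field y : W y -> 'D_(w y) darboux y = normal_field (darboux y).
Proof.
move=> Wy; rewrite (derive_darboux _ Wy) /normal_field (w_fibre Wy).
congr (row_mx _ (row_mx _ _)).
  rewrite /darboux row_mxKl -(w_energy Wy) (form_decomposition _ Wy) big1 ?addr0// => j _.
  by move/rowP : (w_fibre Wy) => /(_ j); rewrite !mxE => ->; rewrite mulr0.
apply/rowP => j; rewrite !mxE.
have := w_contact (delta_mx 0 (lshift (1 + q) j)) Wy.
rewrite (ext_deriv_decomposition _ _ Wy) => /eqP; rewrite addr_eq0 => /eqP e.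
have vz i : w y 0 (lshift (1 + q) i) = 0.
  by move/rowP : (w_fibre Wy) => /(_ i); rewrite !mxE.
have dE i : (delta_mx 0 (lshift (1 + q) j) : rVk) 0 (lshift (1 + q) i) = (i == j)%:R.
  by rewrite mxE /= (inj_eq (@lshift_inj _ _)).
have -> := etrans (esym (sum_pick (fun i => 'D_(w y) (coef i) y)
  (fun i => 'D_(delta_mx 0 (lshift (1 + q) j)) (coef i) y) dE vz)) e.
congr (- _); rewrite mxE (bigD1 j)//= !mxE !eqxx mul1r big1 ?addr0// => i ij.
by rewrite !mxE /= (inj_eq (@lshift_inj _ _)) (negPf ij) mul0r.
Qed.

Lemma normal_field_cst Y t : normal_field (Y + t *: normal_field Y) = normal_field Y.
Proof.
have E : lsubmx (Y + t *: normal_field Y) = lsubmx Y.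
  by rewrite linearD linearZ /= row_mxKl scaler0 addr0.
by rewrite {1}/normal_field E.
Qed.

Lemma known_normal_field : knownV setT normal_field.
Proof.
have oT : open (setT : set rVk) by exact: openT.
move=> i; case: (split_ordP i) => j ->.
  by apply: (known_eq (known_cst _ 0 oT)) => y _; rewrite row_mxEl mxE.
case: (split_ordP j) => m ->; last first.
  by apply: (known_eq (known_cst _ (- b m 0) oT)) => y _; rewrite !row_mxEr !mxE.
apply: (@known_eq _ _ _ _ _ (fun y => c + \sum_i y 0 (lshift (1 + q) i) * b i 0)).
  apply: known_add; first exact: known_cst.
  by apply: known_sum => // i'; apply: known_mul; [exact: known_coord|exact: known_cst].
move=> y _; rewrite row_mxEr row_mxEl !mxE !ord1 eqxx mulr1n; congr (_ + _).
by apply: eq_bigr => i' _; rewrite mxE.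
Qed.

Lemma straightened_normal : 0 < r ->
  (forall y u, W y -> pairing (nu y) u = 0 -> u != 0 ->
    exists v, ext_deriv nu y u v != 0) ->
  straightened D W w 0.
Proof.
move=> r0 nd; have W0 : W 0 by exact: ballxx.
have [A [r' [Th' [ch AW A0 r'0]]]] :=
  local_chart oW W0 known_darboux (fun v => darboux_inj W0 (fun u => nd 0 u W0)).
exists A, r', darboux, Th', normal_field; split; split => //.
- by move=> x /AW; exact: derive_darboux_field.
- by move=> Y t; exact: normal_field_cst.
- exact: known_normal_field.
Qed.

End NormalForm.

(** * Straightening the leaves, and systems with a factored energy *)
Section Straightening.
Variables (R : realType) (N : nat) (D : stable_data R N).
Notation known := (@known R N D).
Notation knownV := (@knownV R N D).
Notation chart := (@chart R N D).
Notation contact_sys := (@contact_sys R N D).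
Notation straightened := (@straightened R N D).

Lemma rank_complement q n (P : 'M[R]_(q + n, q)) : \rank P = q ->
  exists L : 'M[R]_(q + n, n), forall v : 'rV_(q + n), v *m P = 0 -> v *m L = 0 -> v = 0.
Proof.
move=> rP; exists (col_ebase P *m col_mx 0 1%:M) => v vP.
set u := v *m col_ebase P => vL.
have u0 : lsubmx u = 0.
  move: vP; rewrite -{1}(mulmx_ebase P) rP !mulmxA -/u => uP.
  have {}uP : u *m (pid_mx q : 'M[R]_(q + n, q)) = 0.
    by rewrite -(mulmxK (row_ebase_unit P) (u *m _)) uP mul0mx.
  move: uP; rewrite -[u]hsubmxK pid_mx_col mul_row_col mulmx1 mulmx0 addr0.
  by rewrite row_mxKl.
have u1 : rsubmx u = 0.
  move: vL; rewrite mulmxA -/u -[u]hsubmxK mul_row_col mulmx1 mulmx0 add0r.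
  by rewrite row_mxKr.
have uE : u = 0 by rewrite -[u]hsubmxK u0 u1 row_mx0.
by rewrite -(mulmxK (col_ebase_unit P) v) -/u uE mul0mx.
Qed.

(** The functions f completed by linear functions are local coordinates; L is
    injective on the kernel of df at p. *)
Lemma straightening_chart q n (W : set 'rV[R]_(q + n)) (f : 'rV[R]_(q + n) -> 'rV[R]_q)
    p (L : 'M[R]_(q + n, n)) : open W -> knownV W f -> W p ->
  (forall v, 'D_v f p = 0 -> v *m L = 0 -> v = 0) ->
  exists A r Phi Psi, [/\ chart A (ball (0 : 'rV[R]_(q + n)) r) Phi Psi, A `<=` W, A p & 0 < r] /\
    Phi p = 0 /\
    forall y, ball (0 : 'rV[R]_(q + n)) r y -> f (Psi y) = lsubmx y + f p.
Proof.
move=> oW kf Wp inj.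
pose Phi x : 'rV[R]_(q + n) := row_mx (f x - f p) ((x - p) *m L).
have kPhi : knownV W Phi.
  move=> i; case: (split_ordP i) => j ->.
    apply: (@known_eq _ _ _ _ _ (fun x => f x 0 j - f p 0 j)).
      by apply: known_sub => //; exact: known_cst.
    by move=> x _; rewrite row_mxEl !mxE.
  apply: (@known_eq _ _ _ _ _ (fun x => ((x - p) *m L) 0 j)).
    apply: (@knownV_mulmx _ _ _ _ _ _ _ (fun x => x - p) (fun=> L)) => //.
      move=> m; apply: (@known_eq _ _ _ _ _ (fun x => x 0 m - p 0 m)).
        by apply: known_sub; [exact: known_coord|exact: known_cst].
      by move=> x _; rewrite !mxE.
    by move=> *; exact: known_cst.
  by move=> x _; rewrite row_mxEr.
have df := knownV_diff kf Wp; have dPhi := knownV_diff kPhi Wp.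
have DPhi v : 'D_v Phi p = row_mx ('D_v f p) (v *m L).
  apply/rowP => i; rewrite -(derive_rV _ _ dPhi); case: (split_ordP i) => j ->.
    rewrite row_mxEl -(derive_rV _ _ df).
    have -> : (fun x => Phi x 0 (lshift n j)) = (fun x => f x 0 j) - cst (f p 0 j).
      by apply/funext => x; rewrite /Phi row_mxEl !mxE.
    rewrite deriveB; [|by apply: diff_derivable; exact: differentiable_rVP|exact: derivable_cst].
    by rewrite derive_cst subr0.
  rewrite row_mxEr.
  have [dm Dm] := differentiable_mulmxr L p.
  have -> : (fun x => Phi x 0 (rshift q j)) = (fun x => (x *m L) 0 j) - cst ((p *m L) 0 j).
    by apply/funext => x; rewrite /Phi row_mxEr mulmxBl mxE [X in _ + X]mxE.
  rewrite deriveB; [|by apply: diff_derivable; exact: differentiable_rVP|exact: derivable_cst].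
  by rewrite derive_cst subr0 (derive_rV _ _ dm) Dm.
have Phip : Phi p = 0 by rewrite /Phi !subrr mul0mx row_mx0.
have [v|A [r [Psi [ch AW Ap r0]]]] := local_chart oW Wp kPhi.
  rewrite DPhi => e; apply: inj.
    by rewrite -(row_mxKl ('D_v f p) (v *m L)) e linear0.
  by rewrite -(row_mxKr ('D_v f p) (v *m L)) e linear0.
rewrite Phip in ch; exists A, r, Phi, Psi; split => //; split => // y yr.
have [_ PPy] := chart_PsiK ch yr.
by rewrite -[in RHS]PPy /Phi row_mxKl subrK.
Qed.

Lemma contact_sys_restrict k q (W W' : set 'rV[R]_k) lam (f : 'rV[R]_k -> 'rV[R]_q) al w :
  contact_sys W lam f al w -> open W' -> W' `<=` W -> contact_sys W' lam f al w.
Proof.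
move=> S oW' W'W; split => //.
- exact: known_restrictV (cs_klam S) oW' W'W.
- exact: known_restrictV (cs_kf S) oW' W'W.
- exact: known_restrictV (cs_kw S) oW' W'W.
- by move=> x /W'W; exact: (cs_al S).
- by move=> x u /W'W; exact: (cs_nondeg S).
- by move=> x /W'W; exact: (cs_trans S).
- by move=> x /W'W; exact: (cs_wf S).
- by move=> x v /W'W; exact: (cs_contact S).
- by move=> x u v /W'W; exact: (cs_closed S).
- by move=> x v /W'W; exact: (cs_ker S).
- by move=> x v /W'W; exact: (cs_const S).
Qed.

Lemma straightened_sub k (W W' : set 'rV[R]_k) w p : W' `<=` W ->
  straightened W' w p -> straightened W w p.
Proof.
move=> W'W [A [r [Th [Th' [V [[ch AW Ap r0] h]]]]]].
exists A, r, Th, Th', V; split => //; split => //.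
exact: subset_trans W'W.
Qed.

Lemma ext_deriv_eq_on k (A : set 'rV[R]_k) (a b : 'rV[R]_k -> 'rV[R]_k) y u v :
  open A -> A y -> differentiable a y -> differentiable b y ->
  (forall z, A z -> pairing (a z) u = pairing (b z) u) ->
  (forall z, A z -> pairing (a z) v = pairing (b z) v) ->
  ext_deriv a y u v = ext_deriv b y u v.
Proof.
move=> oA Ay da db hu hv; apply: (congr2 (fun a b : R => a - b)).
  rewrite -(derive_pairingl _ _ da) -(derive_pairingl _ _ db).
  by apply: (eq_open_derive _ oA _ Ay) => z; rewrite inE; exact: hv.
rewrite -(derive_pairingl _ _ da) -(derive_pairingl _ _ db).
by apply: (eq_open_derive _ oA _ Ay) => z; rewrite inE; exact: hu.
Qed.

(** Along the line y + t d, y is a limit of points where g vanishes. *)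
Lemma known_eq0_dense k (W : set 'rV[R]_k) g y d : known W g -> W y ->
  (forall t, t != 0 -> W (y + t *: d) -> g (y + t *: d) = 0) -> g y = 0.
Proof.
move=> kg Wy g0; apply/eqP/negPn/negP => gy.
have oO := known_open_neq0 kg.
have /nbhs_ballP[e /= e0 eO] := open_nbhs_nbhs (conj oO (conj Wy gy)).
pose t := e / 2 / (`|d| + 1).
have d1 : 0 < `|d| + 1 by rewrite ltr_wpDl.
have t0 : 0 < t by rewrite !divr_gt0.
have td : ball y e (y + t *: d).
  rewrite ball_addl normrZ gtr0_norm// /t -(mulrA (e / 2)) (@le_lt_trans _ _ (e / 2))//; last lra.
  rewrite ger_pMr ?divr_gt0// mulrC ler_pdivrMr// mul1r; lra.
have [Wt /eqP[]] := eO _ td.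
by apply: g0 => //; exact: lt0r_neq0.
Qed.

Variables (q : nat) (r : R).
Notation rVk := 'rV[R]_(q + (1 + q)).
Let W := ball (0 : rVk) r.
Let oW : open W. Proof. exact: ball_open. Qed.
Variables (lam al w : rVk -> rVk) (f : rVk -> 'rV[R]_q) (c0 : 'rV[R]_q).
Hypothesis S : contact_sys W lam f al w.
Hypothesis fE : forall y, W y -> f y = lsubmx y + c0.

Lemma derive_straight y v : W y -> 'D_v f y = lsubmx v.
Proof.
move=> Wy; have df := knownV_diff (cs_kf S) Wy.
apply/rowP => j; rewrite -(derive_rV _ _ df) mxE.
rewrite (@eq_open_derive _ _ _ W _ ((fun y : rVk => y 0 (lshift (1 + q) j)) + cst (c0 0 j)) _ _ oW _ Wy).
  rewrite deriveD; [|by apply: diff_derivable; exact: differentiable_coord|exact: derivable_cst].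
  by rewrite derive_cst addr0 (@derive_rV _ _ _ id)// derive_id.
by move=> z; rewrite inE => Wz; rewrite (fE Wz) !mxE.
Qed.

Let energy y := pairing (lam y) (w y).

Let known_energy : known W energy.
Proof. by apply: known_pairing => //; [exact: cs_klam S|exact: cs_kw S]. Qed.

Let w_fibre y : W y -> lsubmx (w y) = 0.
Proof. by move=> Wy; rewrite -(derive_straight _ Wy); exact: (cs_wf S). Qed.

Variables (kk : rVk -> R) (c : R) (b : 'cV[R]_q).
Let chi (y : rVk) := c + (lsubmx y *m b) 0 0.
Hypothesis kkk : known W kk.
Hypothesis kk0 : forall y, W y -> kk y != 0.
Hypothesis energyE : forall y, W y -> energy y = chi y * kk y.
Hypothesis dense : forall y, W y -> chi y != 0 \/ exists d : rVk, (lsubmx d *m b) 0 0 = 1.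

Let g y := (kk y)^-1.
Let nu y := g y *: lam y.

Let kg : known W g. Proof. exact: known_inv. Qed.

Let pairing_nu y v : pairing (nu y) v = g y * pairing (lam y) v.
Proof. exact: pairingZl. Qed.

Let knu : knownV W nu.
Proof.
move=> i; apply: (known_eq (known_mul kg (cs_klam S i))) => y _.
by rewrite mxE.
Qed.

Let known_chi : known W chi.
Proof.
apply: known_add; first exact: known_cst.
apply: (@known_eq _ _ _ _ _ (fun y => \sum_i y 0 (lshift (1 + q) i) * b i 0)).
  by apply: known_sum => // i; apply: known_mul; [exact: known_coord|exact: known_cst].
by move=> y _; rewrite mxE; apply: eq_bigr => i _; rewrite mxE.
Qed.

Let derive_chi y v : 'D_v chi y = (lsubmx v *m b) 0 0.
Proof.
have E : chi = cst c + fun y : rVk => (y *m col_mx b 0) 0 0.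
  by apply/funext => z; rewrite fctE /= /chi -{2}[z]hsubmxK mul_row_col mulmx0 addr0.
have [dm Dm] := differentiable_mulmxr (col_mx b 0 : 'M[R]_(q + (1 + q), 1)) y.
rewrite E deriveD; [|exact: derivable_cst|by apply: diff_derivable; exact: differentiable_rVP].
rewrite derive_cst add0r (derive_rV _ _ dm) Dm.
by rewrite -{1}[v]hsubmxK mul_row_col mulmx0 addr0.
Qed.

Let alw y := pairing (al y) (w y).

(** al(w) vanishes only with lam(w), as w is tangent to the leaves. *)
Let alw_neq0 y : W y -> chi y != 0 -> alw y != 0.
Proof.
move=> Wy; apply: contra => /eqP aw.
have /(cs_ker S Wy) : 'D_(w y) f y = 0 by exact: (cs_wf S).
move=> [/(_ aw) + _]; rewrite -/(energy y) (energyE Wy) => /eqP.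
by rewrite mulf_eq0 (negPf (kk0 Wy)) orbF.
Qed.

(** On the leaf subtract from v the multiple of w that makes it lie in ker lam,
    hence in ker al. *)
Let nu_al y v : W y -> chi y != 0 -> lsubmx v = 0 ->
  pairing (nu y) v = chi y / alw y * pairing (al y) v.
Proof.
move=> Wy chiy v0; have h0 : energy y != 0.
  by rewrite (energyE Wy) mulf_neq0// kk0.
have aw := alw_neq0 Wy chiy.
pose u := v - (pairing (lam y) v / energy y) *: w y.
have lu : pairing (lam y) u = 0.
  by rewrite pairingBr pairingZr -/(energy y) divfK// subrr.
have fu : 'D_u f y = 0.
  by rewrite (derive_straight _ Wy) /u linearB linearZ /= v0 (w_fibre Wy) scaler0 subrr.
have := (cs_ker S Wy fu).2 lu; rewrite pairingBr pairingZr -/(alw y) => /eqP.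
rewrite subr_eq0 => /eqP ->; rewrite pairing_nu (energyE Wy) /g.
move: aw chiy (kk0 Wy); generalize (alw y) (chi y) (kk y) (pairing (lam y) v).
by move=> A C K L A0 C0 K0; field; rewrite A0 C0 K0.
Qed.

(** Where chi <> 0, nu is on the leaves the product of the closed form al with
    chi / al(w), which is constant on the leaves. Where chi = 0, the density
    hypothesis applies. *)
Let closed_nu y u v : W y -> lsubmx u = 0 -> lsubmx v = 0 -> ext_deriv nu y u v = 0.
Proof.
move=> Wy u0 v0.
have main z : W z -> chi z != 0 -> ext_deriv nu z u v = 0.
  move=> Wz chiz.
  pose A := W `&` [set x | chi x != 0].
  have oA : open A := known_open_neq0 known_chi.
  have Az : A z by [].
  have dal x : W x -> differentiable al x by exact: (cs_al S).
  have dw : differentiable w z := knownV_diff (cs_kw S) Wz.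
  have dalw : differentiable alw z by apply: pairing_diff => //; exact: dal.
  have aw := alw_neq0 Wz chiz.
  have dia : differentiable (fun x => (alw x)^-1) z by exact: differentiableV.
  have dchi : differentiable chi z := known_diff known_chi Wz.
  have dg : differentiable (fun x => chi x / alw x) z by exact: differentiableM.
  have dga : differentiable (fun x => (chi x / alw x) *: al x) z.
    apply: differentiable_rV => i.
    rewrite (_ : (fun _ => _) = fun x => chi x / alw x * al x 0 i).
      by apply: differentiableM => //; apply: differentiable_rVP; exact: dal.
    by apply/funext => x; rewrite mxE.
  have dnu : differentiable nu z := knownV_diff knu Wz.
  have fibre_cst t : lsubmx t = 0 -> 'D_t (fun x => chi x / alw x) z = 0.
    move=> t0; rewrite deriveM; try exact: diff_derivable.
    rewrite derive_chi t0 mul0mx mxE scaler0 addr0 deriveV//; last exact: diff_derivable.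
    rewrite (_ : 'D_t alw z = 0) ?scaler0//.
    by apply: (cs_const S) => //; rewrite (derive_straight _ Wz).
  rewrite (@ext_deriv_eq_on _ A _ (fun x => (chi x / alw x) *: al x))//; last 2 first.
  - by move=> x [Wx chix]; rewrite (nu_al Wx chix u0) pairingZl.
  - by move=> x [Wx chix]; rewrite (nu_al Wx chix v0) pairingZl.
  rewrite (ext_deriv_scale _ _ dg (dal z Wz)) (fibre_cst u u0) (fibre_cst v v0).
  rewrite (cs_closed S Wz) ?(derive_straight _ Wz)//.
  by rewrite mulr0 !mul0r addr0 subrr.
have ked : known W (fun z => ext_deriv nu z u v).
  by apply: known_sub; apply: known_pairing => //;
     [exact: knownV_D|exact: knownV_cst|exact: knownV_D|exact: knownV_cst].
have [/(main y Wy)//|[d d1]] := dense Wy.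
have [chi0|] := eqVneq (chi y) 0; last exact: main.
apply: (known_eq0_dense (d := d) ked Wy) => t t0 Wt.
apply: main => //; rewrite /chi linearD linearZ /= mulmxDl mxE addrA -/(chi y).
by rewrite chi0 add0r -scalemxAl mxE d1 mulr1.
Qed.

(** The contact equation for lam turns into the one for nu on ker lam. It
    holds on leaf directions as well, where both terms vanish, and the two
    spaces of directions together span everything. *)
Let contact_nu y v : W y -> ext_deriv nu y (w y) v + (lsubmx v *m b) 0 0 = 0.
Proof.
move=> Wy; rewrite -(derive_chi y v).
have dg : differentiable g y := known_diff kg Wy.
have dl : differentiable lam y := knownV_diff (cs_klam S) Wy.
have dnu : differentiable nu y := knownV_diff knu Wy.
have dh : differentiable energy y := known_diff known_energy Wy.
have onxi u : pairing (lam y) u = 0 -> ext_deriv nu y (w y) u + 'D_u chi y = 0.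
  move=> lu; rewrite (ext_deriv_scale _ _ dg dl) lu mulr0 addr0.
  rewrite (@eq_open_derive _ _ _ W chi (fun z => g z * energy z) y u oW _ Wy); last first.
    by move=> z; rewrite inE => Wz; rewrite (energyE Wz) mulrCA /g mulVf ?mulr1// kk0.
  rewrite deriveM; try exact: diff_derivable.
  have -> : ext_deriv lam y (w y) u = - 'D_u energy y.
    by apply/eqP; rewrite -addr_eq0; apply/eqP; exact: (cs_contact S Wy lu).
  rewrite -![_ *: _]/(_ * _) -/(energy y) mulrN (mulrC (energy y)).
  by rewrite addrACA addNr add0r addNr.
have [v1 [fv1 lv1]] := cs_trans S Wy.
have v10 : lsubmx v1 = 0 by rewrite -(derive_straight _ Wy).
pose t := pairing (lam y) v / pairing (lam y) v1.
have vE : v = (v - t *: v1) + t *: v1 by rewrite subrK.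
rewrite vE (ext_derivDr _ _ _ dnu) (ext_derivZr _ _ _ dnu).
rewrite (closed_nu Wy (w_fibre Wy) v10) mulr0 addr0.
have dchi : differentiable chi y := known_diff known_chi Wy.
rewrite (deriveDir _ _ dchi) (deriveZDir _ _ dchi) (derive_chi y v1) v10 mul0mx mxE.
rewrite scaler0 addr0.
by apply: onxi; rewrite pairingBr pairingZr divfK ?subrr.
Qed.

(** A factorisation lam(w) = chi kk, with chi affine in the coordinates
    labelling the leaves and kk nowhere zero, makes lam / kk closed on the leaves and leads to
    Darboux coordinates. *)
Lemma straightened_factor : 0 < r -> straightened W w 0.
Proof.
move=> r0; apply: (@straightened_normal _ _ _ _ r nu knu closed_nu w c b) => //.
- by move=> y Wy; rewrite pairing_nu -/(energy y) (energyE Wy) mulrCA /g mulVf ?mulr1// kk0.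
- move=> y u Wy; rewrite pairing_nu => /eqP; rewrite mulf_eq0 invr_eq0 (negPf (kk0 Wy)) /=.
  move=> /eqP lu u0; have [v [lv dv]] := cs_nondeg S Wy lu u0; exists v.
  have dg : differentiable g y := known_diff kg Wy.
  have dl : differentiable lam y := knownV_diff (cs_klam S) Wy.
  rewrite (ext_deriv_scale _ _ dg dl) lu lv !mulr0 addr0 subr0 mulf_neq0//.
  by rewrite invr_neq0// kk0.
Qed.

End Straightening.

(** * Factoring the energy lam(w) *)
Section EnergyCases.
Variables (R : realType) (N : nat) (D : stable_data R N).
Notation known := (@known R N D).
Notation knownV := (@knownV R N D).
Notation contact_sys := (@contact_sys R N D).
Notation straightened := (@straightened R N D).

Lemma scl00 k (P : pred 'I_k) s : scl P s (0 : 'rV[R]_k) = 0.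
Proof. by apply/rowP => j; rewrite !mxE mulr0 if_same. Qed.

(** The other part of v is tangent to the subspace on which h vanishes. *)
Lemma derive_vanishing k (P : pred 'I_k) r (h : 'rV[R]_k -> R) v : 0 < r ->
  known (ball (0 : 'rV[R]_k) r) h ->
  (forall y, ball (0 : 'rV[R]_k) r y -> h (scl P 0 y) = 0) ->
  'D_v h 0 = 'D_(cut P v) h 0.
Proof.
move=> r0 kh h0; have W0 : ball (0 : 'rV[R]_k) r 0 by exact: ballxx.
have oW : open (ball (0 : 'rV[R]_k) r) by exact: ball_open.
have dh := known_diff kh W0.
have vE : v = scl P 0 v + cut P v by rewrite -{1}(scl1 P v) sclE scale1r.
rewrite {1}vE (deriveDir _ _ dh).
have [ds Ds] := scl_diff P 0 (0 : 'rV[R]_k).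
have dh' : differentiable h (scl P 0 0) by rewrite scl00.
have := derive_comp v ds dh'; rewrite Ds scl00 => <-.
rewrite (@eq_open_derive _ _ _ (ball (0 : 'rV[R]_k) r) _ (cst 0) 0 v oW _ W0).
  by rewrite derive_cst add0r.
by move=> y; rewrite inE => Wy; exact: h0.
Qed.

(** Here w lies in ker lam, so d lam pairs it nontrivially with some v in
    ker lam, and on ker lam this pairing is minus the derivative of the
    energy. *)
Lemma energy_derive_neq0 k q (W : set 'rV[R]_k) lam (f : 'rV[R]_k -> 'rV[R]_q) al w x :
  contact_sys W lam f al w -> W x -> pairing (lam x) (w x) = 0 -> w x != 0 ->
  exists v, 'D_v (fun y => pairing (lam y) (w y)) x != 0.
Proof.
move=> S Wx h0 w0; have [v [lv dv]] := cs_nondeg S Wx h0 w0; exists v.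
apply: contra dv => /eqP e; have := cs_contact S Wx lv.
by rewrite e addr0 => ->.
Qed.

Variable (q : nat).
Notation rVk := 'rV[R]_(q + (1 + q)).
Notation energy lam w := (fun y => pairing (lam y) (w y)).

Lemma known_energy k q' (W : set 'rV[R]_k) lam (f : 'rV[R]_k -> 'rV[R]_q') al w :
  contact_sys W lam f al w -> known W (energy lam w).
Proof.
move=> S; apply: known_pairing; [exact: cs_open S|exact: cs_klam S|exact: cs_kw S].
Qed.

Lemma straightened_transverse r (lam al w : rVk -> rVk) (f : rVk -> 'rV[R]_q) c0 :
  0 < r -> contact_sys (ball (0 : rVk) r) lam f al w ->
  (forall y, ball (0 : rVk) r y -> f y = lsubmx y + c0) ->
  pairing (lam 0) (w 0) != 0 -> straightened (ball (0 : rVk) r) w 0.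
Proof.
move=> r0 S fE h0; have kh := known_energy S.
have W0 : ball (0 : rVk) r 0 by exact: ballxx.
have /nbhs_ballP[r' /= r'0 r'O] := open_nbhs_nbhs (conj (known_open_neq0 kh) (conj W0 h0)).
have r'W : ball (0 : rVk) r' `<=` ball (0 : rVk) r by move=> y /r'O[].
have S' := contact_sys_restrict S (@ball_open _ _ (0 : rVk) r') r'W.
apply: (straightened_sub r'W).
have fE' y : ball (0 : rVk) r' y -> f y = lsubmx y + c0 by move=> /r'W; exact: fE.
have kk0 y : ball (0 : rVk) r' y -> energy lam w y != 0 by move=> /r'O[].
have chi1 (y : rVk) : 1 + (lsubmx y *m (0 : 'cV[R]_q)) 0 0 = 1.
  by rewrite mulmx0 mxE addr0.
have hE y : ball (0 : rVk) r' y ->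
    pairing (lam y) (w y) = (1 + (lsubmx y *m (0 : 'cV[R]_q)) 0 0) * energy lam w y.
  by move=> _; rewrite chi1 mul1r.
apply: (straightened_factor S' fE' (known_energy S') kk0 hE) => // y _.
by left; rewrite chi1 oner_neq0.
Qed.

(** Hadamard's lemma: the energy is y_i times the average of its i-th partial
    derivative over the scalings of y_i. *)
Lemma straightened_coordinate r (lam al w : rVk -> rVk) (f : rVk -> 'rV[R]_q) c0 (i : 'I_q) :
  0 < r -> contact_sys (ball (0 : rVk) r) lam f al w ->
  (forall y, ball (0 : rVk) r y -> f y = lsubmx y + c0) ->
  (forall y, ball (0 : rVk) r y -> y 0 (lshift (1 + q) i) = 0 ->
     pairing (lam y) (w y) = 0) ->
  w 0 != 0 -> straightened (ball (0 : rVk) r) w 0.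
Proof.
move=> r0 S fE hi w0; have kh := known_energy S.
have W0 : ball (0 : rVk) r 0 by exact: ballxx.
pose h := energy lam w; pose l : 'I_(q + (1 + q)) := lshift (1 + q) i; pose P := pred1 l.
pose e : rVk := delta_mx 0 l.
have cutE (v : rVk) : cut P v = v 0 l *: e.
  apply/rowP => j; rewrite !mxE /P /=; case: eqP => [->|_]; rewrite ?mulr1 ?mulr0//.
have h0 (y : rVk) : ball (0 : rVk) r y -> h (scl P 0 y) = 0.
  move=> yr; apply: hi; first by apply: scl_ball.
  by rewrite mxE /P /= eqxx mul0r.
have kDe : known (ball (0 : rVk) r) ('D_e h) by exact: known_D.
pose kk := average P ('D_e h).
have kkk : known (ball (0 : rVk) r) kk := known_average P kDe.
have kk00 : kk 0 != 0.
  have -> : kk 0 = 'D_e h 0.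
    rewrite /kk /average (@eq_unit_integral _ _ (fun=> 'D_e h 0)) ?unit_integral_cst//.
    by move=> s _ _; rewrite scl00.
  have [|v] := energy_derive_neq0 S W0 _ w0; first by apply: hi => //; rewrite mxE.
  have dh : differentiable h 0 := known_diff kh W0.
  rewrite (derive_vanishing v r0 kh h0) cutE (deriveZDir _ _ dh).
  by apply: contra => /eqP ->; rewrite scaler0.
have hE y : ball (0 : rVk) r y -> h y = y 0 l * kk y.
  move=> yr; have := average_derive P (kh : known _ h) yr.
  rewrite (h0 y yr) subr0 => <-; rewrite /kk /average -unit_integralZ.
    apply: eq_unit_integral => s s0 s1; rewrite cutE deriveZDir//.
    by apply: (known_diff kh); exact: scl_ball.
  by have cD := cont01_scl (P := P) kDe yr; exact: cD.
have /nbhs_ballP[r' /= r'0 r'O] := open_nbhs_nbhs (conj (known_open_neq0 kkk) (conj W0 kk00)).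
have r'W : ball (0 : rVk) r' `<=` ball (0 : rVk) r by move=> y /r'O[].
have S' := contact_sys_restrict S (@ball_open _ _ (0 : rVk) r') r'W.
pose b : 'cV[R]_q := delta_mx i 0.
have bE (y : rVk) : (lsubmx y *m b) 0 0 = y 0 l.
  rewrite mxE (bigD1 i)//= !mxE !eqxx mulr1 big1 ?addr0// => j /negPf ji.
  by rewrite !mxE ji mulr0.
apply: (straightened_sub r'W).
have fE' y : ball (0 : rVk) r' y -> f y = lsubmx y + c0 by move=> /r'W; exact: fE.
have kkk' : known (ball (0 : rVk) r') kk.
  exact: known_restrict kkk (@ball_open _ _ (0 : rVk) r') r'W (fun _ _ => erefl).
have kk0 y : ball (0 : rVk) r' y -> kk y != 0 by move=> /r'O[].
have hE' y : ball (0 : rVk) r' y -> pairing (lam y) (w y) = (0 + (lsubmx y *m b) 0 0) * kk y.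
  by move=> /r'W/hE hy; rewrite add0r bE.
apply: (straightened_factor S' fE' kkk' kk0 hE') => // y _.
by right; exists e; rewrite bE /e mxE !eqxx.
Qed.

(** Vanishing of the energy is vanishing of al(w), which is constant on the
    leaf. *)
Lemma energy_fibre r (lam al w : rVk -> rVk) (f : rVk -> 'rV[R]_q) c0 y :
  0 < r -> contact_sys (ball (0 : rVk) r) lam f al w ->
  (forall y, ball (0 : rVk) r y -> f y = lsubmx y + c0) -> ball (0 : rVk) r y ->
  pairing (lam (scl (@fibre q) 0 y)) (w (scl (@fibre q) 0 y)) = 0 ->
  pairing (lam y) (w y) = 0.
Proof.
move=> r0 S fE yr.
have ker z : ball (0 : rVk) r z ->
    pairing (al z) (w z) = 0 <-> pairing (lam z) (w z) = 0.
  by move=> zr; apply: (cs_ker S zr); exact: (cs_wf S).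
have zr : ball (0 : rVk) r (scl (@fibre q) 0 y) by exact: scl_ball.
move=> /(ker _ zr) az; apply/(ker _ yr); rewrite -az.
have yE : y = scl (@fibre q) 0 y + cut (@fibre q) y by rewrite -{1}(scl1 (@fibre q) y) sclE scale1r.
rewrite {1 2}yE.
apply: (@const_along_segment R _ rVk (energy al w)) => s s0 s1.
have sr : ball (0 : rVk) r (scl (@fibre q) 0 y + s *: cut (@fibre q) y).
  by rewrite -sclE; exact: scl_ball.
split.
  by apply: pairing_diff; [exact: (cs_al S)|exact: knownV_diff (cs_kw S) sr].
by apply: (cs_const S) => //; rewrite (derive_straight S fE _ sr) lsubmx_cut.
Qed.

(** C is the energy on the transversal through 0, extended to be constant on
    the leaves; it has the same zeros as the energy. Since its derivative at 0
    is not zero it can replace a first integral, which leads to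
    straightened_coordinate after a second change of coordinates. *)
Lemma straightened_tangent r (lam al w : rVk -> rVk) (f : rVk -> 'rV[R]_q) c0 :
  0 < r -> contact_sys (ball (0 : rVk) r) lam f al w ->
  (forall y, ball (0 : rVk) r y -> f y = lsubmx y + c0) ->
  pairing (lam 0) (w 0) = 0 -> w 0 != 0 -> straightened (ball (0 : rVk) r) w 0.
Proof.
move=> r0 S fE h00 w0; have kh := known_energy S.
set W := ball (0 : rVk) r in S fE kh *.
have oW : open W by exact: ball_open.
have W0 : W 0 by exact: ballxx.
pose h := energy lam w; pose sc : rVk -> rVk := scl (@fibre q) 0.
have scW y : W y -> W (sc y) by move=> Wy; exact: scl_ball.
pose C y := h (sc y).
have ksc : knownV W sc.
  move=> j; case Pj : (fibre j).
    by apply: (known_eq (known_cst _ 0 oW)) => y _; rewrite mxE Pj mul0r.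
  by apply: (@known_eq _ _ _ _ _ (fun y => y 0 j)) => [|y _]; [exact: known_coord|rewrite mxE Pj].
have kC : known W C := known_comp kh oW ksc scW.
have Ch y : W y -> C y = 0 -> h y = 0 by move=> Wy; exact: (energy_fibre r0 S fE Wy).
have DC y v : W y -> 'D_v C y = 'D_(sc v) h (sc y).
  move=> Wy; have [ds Ds] := scl_diff (@fibre q) 0 y.
  by rewrite (derive_comp v ds (known_diff kh (scW y Wy))) Ds.
have DC0 y v : W y -> lsubmx v = 0 -> 'D_v C y = 0.
  by move=> Wy v0; rewrite (DC _ _ Wy) /sc (scl_fibre _ v0) scale0r derive0.
have [i Ci] : exists i, 'D_(delta_mx 0 (lshift (1 + q) i)) C 0 != 0.
  have [v hv] := energy_derive_neq0 S W0 h00 w0.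
  have cv : 'D_v C 0 != 0.
    rewrite (DC _ _ W0) /sc scl00.
    have E (u : rVk) : cut (predC (@fibre q)) u = scl (@fibre q) 0 u.
      by apply/rowP => j; rewrite !mxE /=; case: (fibre j); rewrite /= ?mul0r.
    have F (u : rVk) : scl (predC (@fibre q)) 0 u = cut (@fibre q) u.
      by apply/rowP => j; rewrite !mxE /=; case: (fibre j); rewrite /= ?mul0r.
    rewrite -E -(derive_vanishing v r0 kh)// => y Wy; rewrite F.
    have Wc : W (cut (@fibre q) y) by rewrite -F; exact: scl_ball.
    apply: Ch => //; rewrite /C (_ : sc _ = 0) //.
    by rewrite /sc (scl_fibre _ (lsubmx_cut y)) scale0r.
  apply/existsP; apply: contraNT cv => /existsPn n.
  rewrite (derive_sum_coord v (known_diff kC W0)) big_split_ord /=.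
  rewrite !big1 ?addr0// => j _.
    by rewrite (DC0 _ _ W0) ?scaler0//; exact: lsubmx_delta_rshift.
  by have := n j; rewrite negbK => /eqP ->; rewrite scaler0.
pose l : 'I_(q + (1 + q)) := lshift (1 + q) i; pose e : rVk := delta_mx 0 l.
have kkap : known W ('D_e C) by exact: known_D.
pose W1 := W `&` [set x | 'D_e C x != 0].
have oW1 : open W1 := known_open_neq0 kkap.
have W10 : W1 0 by [].
have W1W : W1 `<=` W by move=> y [].
pose f' (y : rVk) : 'rV[R]_q := \row_j (if j == i then C y else y 0 (lshift (1 + q) j)).
have kf' : knownV W1 f'.
  move=> j; case ji : (j == i).
    by apply: (known_restrict kC) => // y _; rewrite mxE ji.
  by apply: (@known_eq _ _ _ _ _ (fun y => y 0 (lshift (1 + q) j))) => [|y _]; [exact: known_coord|rewrite mxE ji].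
have Df' y v j : W1 y ->
    'D_v f' y 0 j = if j == i then 'D_v C y else v 0 (lshift (1 + q) j).
  move=> W1y; rewrite -(derive_rV v j (knownV_diff kf' W1y)); case ji : (j == i).
    have -> // : (fun z => f' z 0 j) = C by apply/funext => z; rewrite mxE ji.
  have -> : (fun z => f' z 0 j) = fun z => z 0 (lshift (1 + q) j).
    by apply/funext => z; rewrite mxE ji.
  by rewrite (@derive_rV _ _ _ id)// derive_id.
have kerf y v : W1 y -> 'D_v f' y = 0 -> lsubmx v = 0.
  move=> W1y; have [Wy ky] := W1y => /rowP e0.
  have vj j : j != i -> v 0 (lshift (1 + q) j) = 0.
    by move=> /negPf ji; have := e0 j; rewrite (Df' _ _ _ W1y) ji mxE.
  suff vi : v 0 (lshift (1 + q) i) = 0.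
    by apply/rowP => j; rewrite !mxE; have [->|/vj] := eqVneq j i.
  have := e0 i; rewrite (Df' _ _ _ W1y) eqxx mxE.
  rewrite (derive_sum_coord v (known_diff kC Wy)) big_split_ord /=.
  rewrite [X in _ + X]big1 => [|j _]; last first.
    by rewrite (DC0 _ _ Wy) ?scaler0//; exact: lsubmx_delta_rshift.
  rewrite (bigD1 i)//= [X in _ + X + _]big1 => [|j ji]; last by rewrite (vj j ji) scale0r.
  rewrite !addr0 -/l -/e => /eqP; rewrite scaler_eq0 => /orP[/eqP//|/eqP k0].
  by move: ky => /eqP[].
have kerf' y v : W1 y -> lsubmx v = 0 -> 'D_v f' y = 0.
  move=> W1y v0; apply/rowP => j; rewrite (Df' _ _ _ W1y) mxE; case: ifP => _.
    exact: DC0 (W1W _ W1y) v0.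
  by move/rowP : v0 => /(_ j); rewrite !mxE.
have S' : contact_sys W1 lam f' al w.
  have toF y v : W1 y -> 'D_v f' y = 0 -> 'D_v f y = 0.
    move=> W1y e0; rewrite (derive_straight S fE _ (W1W _ W1y)); exact: kerf e0.
  have ofF y v : W1 y -> 'D_v f y = 0 -> 'D_v f' y = 0.
    move=> W1y; rewrite (derive_straight S fE _ (W1W _ W1y)); exact: kerf'.
  have S1 := contact_sys_restrict S oW1 W1W.
  split => //.
  - exact: cs_klam S1.
  - exact: cs_kw S1.
  - exact: (cs_al S1).
  - exact: (cs_nondeg S1).
  - move=> x W1x; have [v [fv lv]] := cs_trans S1 W1x.
    by exists v; split => //; exact: ofF.
  - by move=> x W1x; apply: ofF => //; exact: (cs_wf S1).
  - exact: (cs_contact S1).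
  - by move=> x u v W1x /(toF _ _ W1x) fu /(toF _ _ W1x) fv; exact: (cs_closed S1).
  - by move=> x v W1x /(toF _ _ W1x) fv; exact: (cs_ker S1).
  - by move=> x v W1x /(toF _ _ W1x) fv; exact: (cs_const S1).
have inj (v : rVk) : 'D_v f' 0 = 0 -> v *m col_mx 0 1%:M = 0 -> v = 0.
  move=> /(kerf _ _ W10) v0; rewrite -{1}[v]hsubmxK mul_row_col mulmx0 add0r mulmx1.
  by move=> v1; rewrite -[v]hsubmxK v0 v1 row_mx0.
have [A [r2 [Phi [Psi [[ch AW1 A0 r20] [Phi0 f'E]]]]]] := straightening_chart oW1 kf' W10 inj.
apply: (straightened_push ch (subset_trans AW1 W1W) A0); rewrite Phi0.
have Psi0 : Psi 0 = 0 by have [_] := chart_PhiK ch A0; rewrite Phi0.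
apply: (straightened_coordinate (i := i) r20 (contact_sys_pull S' ch AW1) f'E).
  move=> y yr yi; rewrite (pairing_pull_push _ _ ch yr).
  have [Ay _] := chart_PsiK ch yr.
  apply: (Ch _ (W1W _ (AW1 _ Ay))).
  have := f'E y yr => /rowP /(_ i); rewrite !mxE eqxx => ->.
  by rewrite yi add0r /C /sc scl00.
rewrite /push Psi0; apply: contra w0 => /eqP e0.
by rewrite -(chart_DPsi (w 0) ch A0) e0 derive0.
Qed.

Theorem contact_straightened (W : set rVk) (lam al w : rVk -> rVk) (f : rVk -> 'rV[R]_q)
    p (L : 'M[R]_(q + (1 + q), 1 + q)) :
  contact_sys W lam f al w -> W p -> w p != 0 ->
  (forall v, 'D_v f p = 0 -> v *m L = 0 -> v = 0) ->
  straightened W w p.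
Proof.
move=> S Wp wp inj.
have [A [r [Phi [Psi [[ch AW Ap r0] [Phip fE]]]]]] :=
  straightening_chart (cs_open S) (cs_kf S) Wp inj.
have S' := contact_sys_pull S ch AW.
apply: (straightened_push ch AW Ap); rewrite Phip.
have Psi0 : Psi 0 = p by have [_] := chart_PhiK ch Ap; rewrite Phip.
have [h0|h0] := eqVneq (pairing (pull Psi lam 0) (push Phi Psi w 0)) 0.
  apply: (straightened_tangent r0 S' fE h0).
  rewrite /push Psi0; apply: contra wp => /eqP e0.
  by rewrite -(chart_DPsi (w p) ch Ap) e0 derive0.
exact: (straightened_transverse r0 S' fE h0).
Qed.

End EnergyCases.

(** * Solutions by quadratures *)
Section Flow.
Variables (R : realType) (N : nat) (D : stable_data R N).
Notation M := (sd_dom D).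
Notation quad := (quad M (sd_fun D)).

(** The flow is x |-> Th' (Th x + t V (Th x)). The domain U and the time eps
    are chosen such that the moving point stays in the ball where Th' is
    defined. *)
Lemma flow_of_straightened (w : 'rV[R]_N -> 'rV[R]_N) p :
  straightened D M w p -> flow_in_quadratures M (sd_fun D) w p.
Proof.
move=> [A [r [Th [Th' [V [[ch AM Ap r0] [wV Vc kV]]]]]]].
have [oA oB kTh kTh' ThK Th'K] := ch.
pose C := `|V (Th p)| + 1.
have C0 : 0 < C by rewrite ltr_wpDl.
have cV : V Y @[Y --> Th p] --> V (Th p).
  exact: differentiable_continuous (knownV_diff kV (I : setT (Th p))).
have r2 : 0 < r / 2 by rewrite divr_gt0.
have : \forall Y \near Th p, ball (Th p) (r / 2) Y /\ `|V Y| <= C.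
  have /cvgrPdist_le /(_ 1 ltr01) n1 := cV.
  have n2 : \forall Y \near Th p, ball (Th p) (r / 2) Y by exact: nbhsx_ballx.
  apply: filterS2 n1 n2 => Y h1 h2; split => //; rewrite /C -lerBlDl.
  by apply: le_trans (lerB_dist _ _) _; rewrite distrC.
move=> /nbhs_ballP[rho /= rho0 rhoP].
have rhoW : ball (Th p) rho `<=` ball (Th p) r.
  move=> Y /rhoP[+ _]; apply: le_ball; lra.
have ch' := chart_restrict ch (@ball_open _ _ (Th p) rho) rhoW.
pose U := A `&` Th @^-1` ball (Th p) rho.
have oU : open U := chart_opA ch'.
(* the starting point uses up half of the radius, the motion the other half *)
pose eps := r / 2 / C.
have eps0 : 0 < eps by rewrite divr_gt0.
have inb x t : U x -> `|t| < eps -> ball (Th p) r (Th x + t *: V (Th x)).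
  move=> [Ax /rhoP[]]; rewrite -!ball_normE /= => h1 h2 te.
  rewrite opprD addrA (le_lt_trans (ler_normB _ _))// (splitr r) ltrD//.
  rewrite normrZ (le_lt_trans (ler_wpM2l _ h2))//.
  by move: te; rewrite /eps ltr_pdivlMr.
exists U, eps, (fun x t => Th' (Th x + t *: V (Th x))); split.
- split => //; first by split => //; exact: ballxx.
  by move=> x [/AM].
- by move=> x [Ax _]; rewrite scale0r addr0; exact: (ThK x Ax).2.
- move=> x t Ux te; have Yr := inb x t Ux te.
  have [AY TY] := Th'K _ Yr; split; first exact: AM.
  have dTh' := knownV_diff kTh' Yr.
  have -> : w (Th' (Th x + t *: V (Th x))) = 'D_(V (Th x)) Th' (Th x + t *: V (Th x)).
    have := chart_DPsi (w (Th' (Th x + t *: V (Th x)))) ch AY.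
    by rewrite (wV _ AY) TY Vc => <-.
  exact: is_derive_line.
- move=> i.
  set S := [set z : 'rV[R]_(N + 1) | U (lsubmx z) /\ `|rsubmx z 0 0| < eps].
  have qTh j : quad S (fun z => Th (lsubmx z) 0 j).
    apply: (quad_comp (known_quad (kTh j))) => [m|z [[Az _] _]//].
    by apply: (quad_restrict (quad_coord _ _ S (lshift 1 m))) => // z _; rewrite mxE.
  have qV j : quad S (fun z => V (Th (lsubmx z)) 0 j).
    by apply: (@quad_comp _ _ _ _ _ _ S setT (fun Y => V Y 0 j) (fun z => Th (lsubmx z))) => //; exact: known_quad (kV j).
  have qt : quad S (fun z => rsubmx z 0 0).
    by apply: (quad_restrict (quad_coord _ _ S (rshift N 0))) => // z _; rewrite mxE.
  apply: (@quad_comp _ _ _ _ _ _ S (ball (Th p) r) (fun Y => Th' Y 0 i)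
    (fun z => Th (lsubmx z) + rsubmx z 0 0 *: V (Th (lsubmx z)))).
  + exact: known_quad (kTh' i).
  + move=> j; apply: (quad_restrict (quad_add (qTh j) (quad_mul qt (qV j)))) => // z _.
    by rewrite !mxE.
  + by move=> z [Uz tz]; exact: inb.
Qed.

End Flow.

Section Solutions.
Variables (R : realType) (N : nat) (M : set 'rV[R]_N) (data : set ('rV[R]_N -> R)).

Lemma solution_of_flow (w : 'rV[R]_N -> 'rV[R]_N) p :
  flow_in_quadratures M data w p -> solution_in_quadratures M data w p.
Proof.
move=> [U [eps [Phi [[oU Up UM eps0] Phi0 dPhi qPhi]]]].
exists eps, (Phi p); split => //; first exact: Phi0.
  by move=> t te; exact: dPhi.
move=> i; set S := [set z : 'rV[R]_1 | `|z 0 0| < eps].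
have q : quad M data S (fun z => Phi (lsubmx (row_mx p z)) (rsubmx (row_mx p z) 0 0) 0 i).
  apply: (quad_comp (qPhi i)) => [j|z Sz]; last by rewrite /= row_mxKl row_mxKr.
  case: (split_ordP j) => m ->.
    by apply: (quad_restrict (quad_cst _ _ S (p 0 m))) => // z _; rewrite row_mxEl.
  by apply: (quad_restrict (quad_coord _ _ S m)) => // z _; rewrite row_mxEr.
by apply: (quad_restrict q) => // z _; rewrite row_mxKl row_mxKr.
Qed.

Lemma solution_at_zero (w : 'rV[R]_N -> 'rV[R]_N) p :
  M p -> w p = 0 -> solution_in_quadratures M data w p.
Proof.
move=> Mp wp; exists 1, (fun=> p); split => //.
- by move=> t _; split => //; rewrite wp; exact: is_derive_cst.
- by move=> i; exact: quad_cst.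
Qed.

End Solutions.

(** * From the hypotheses on the system to coordinates *)
Section KnownData.
Variables (R : realType) (N q : nat) (M : set 'rV[R]_N).
Variables (lam w : 'rV[R]_N -> 'rV[R]_N) (f : 'rV[R]_N -> 'rV[R]_q).
Hypotheses (oM : open M) (sl : smooth M lam) (sf : smooth M f) (sw : smooth M w).

Lemma known_data_diff g x : known_data lam f w g -> M x -> differentiable g x.
Proof.
by case=> vs i Mx; apply: differentiable_rVP; [exact: sl|exact: sf|exact: sw].
Qed.

Lemma known_data_derive g v : known_data lam f w g ->
  exists2 g', known_data lam f w g' & forall x, M x -> 'D_v g x = g' x.
Proof.
case=> vs i.
- exists (fun x => iterD (v :: vs) lam x 0 i); first exact: known_form.
  by move=> x Mx; rewrite (derive_rV _ _ (sl vs Mx)).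
- exists (fun x => iterD (v :: vs) f x 0 i); first exact: Defs.known_integral.
  by move=> x Mx; rewrite (derive_rV _ _ (sf vs Mx)).
- exists (fun x => iterD (v :: vs) w x 0 i); first exact: known_field.
  by move=> x Mx; rewrite (derive_rV _ _ (sw vs Mx)).
Qed.

Definition contact_data : stable_data R N :=
  StableData oM known_data_diff known_data_derive.

End KnownData.

Section FromHypotheses.
Variables (R : realType) (q : nat).
Notation rVk := 'rV[R]_(q + (1 + q)).
Variables (M : set rVk) (lam al w : rVk -> rVk) (f : rVk -> 'rV[R]_q).
Hypotheses (oM : open M) (hlam : contact_form M lam) (hf : independent_functions M f)
  (hcoL : co_Legendrian M lam f) (hal : transverse_measure M lam f al)
  (hw : integrable_contact_system M lam f al w).

Let sl : smooth M lam := hlam.1.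
Let sf : smooth M f := hf.1.
Let sw : smooth M w. Proof. by case: hw => -[]. Qed.
Let sal : smooth M al. Proof. by case: hal. Qed.

Let D := contact_data oM sl sf sw.

Let kl : knownV D M lam.
Proof.
move=> i; apply: (@known_base _ _ D (fun x => lam x 0 i)).
exact: (@known_form _ _ _ lam f w [::] i).
Qed.

Let kf : knownV D M f.
Proof.
move=> i; apply: (@known_base _ _ D (fun x => f x 0 i)).
exact: (@Defs.known_integral _ _ _ lam f w [::] i).
Qed.

Let kw : knownV D M w.
Proof.
move=> i; apply: (@known_base _ _ D (fun x => w x 0 i)).
exact: (@known_field _ _ _ lam f w [::] i).
Qed.

Let tangentE x v : M x -> tangentF f x v <-> 'D_v f x = 0.
Proof. by move=> Mx; rewrite (deriveE _ (sf [::] Mx)). Qed.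

Lemma smooth_of_known k l (U : set 'rV[R]_k) (u : 'rV[R]_k -> 'rV[R]_l) :
  knownV D U u -> smooth U u.
Proof.
move=> ku vs; suff kvs : knownV D U (iterD vs u) by move=> x Ux; exact: knownV_diff kvs Ux.
by elim: vs => //= v vs IH; exact: knownV_D.
Qed.

Lemma fibre_complement p : M p -> exists L : 'M[R]_(q + (1 + q), 1 + q),
  forall v : rVk, 'D_v f p = 0 -> v *m L = 0 -> v = 0.
Proof.
move=> Mp; have [L hL] := rank_complement (hf.2 p Mp); exists L => v.
by rewrite (derive_jacobian v (sf [::] Mp)); exact: hL.
Qed.

(** The matrix B(x) combining the Jacobian of f with constant columns is
    invertible near p; keeping the product with B(x) constant keeps a vector
    in the kernel of df. *)
Lemma fibre_extension p : M p -> exists (U : set rVk) (E : rVk -> rVk -> rVk),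
  [/\ open U, U p, U `<=` M, forall v, knownV D U (E v) &
   forall v, 'D_v f p = 0 -> E v p = v /\ forall x, U x -> 'D_(E v x) f x = 0].
Proof.
move=> Mp; have [L hL] := fibre_complement Mp.
pose B x : 'M[R]_(q + (1 + q)) := row_mx ('J f x) L.
have kB i j : known D M (fun x => B x i j).
  case: (split_ordP j) => m ->.
    by apply: (known_eq (known_jac i m kf)) => x _; rewrite row_mxEl.
  by apply: (known_eq (known_cst D (L i m) oM)) => x _; rewrite row_mxEr.
have kdet : known D M (fun x => \det (B x)) by exact: known_det.
pose U := M `&` [set x | \det (B x) != 0].
have oU : open U := known_open_neq0 kdet.
have UM : U `<=` M by move=> x [].
have uB x : U x -> B x \in unitmx by move=> [_]; rewrite unitmxE unitfE.
have Up : U p.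
  split => //=; rewrite -unitfE -unitmxE; apply: unitmx_of_inj => v.
  rewrite mul_mx_row => vB; apply: hL.
    by rewrite (derive_jacobian v (sf [::] Mp)) -(row_mxKl (v *m 'J f p) (v *m L)) vB linear0.
  by rewrite -(row_mxKr (v *m 'J f p) (v *m L)) vB linear0.
exists U, (fun v x => (v *m B p) *m invmx (B x)); split => //.
  move=> v; apply: (knownV_mulmx (h := fun=> v *m B p) oU); first exact: knownV_cst.
  move=> i j; apply: known_invmx => // a b.
  exact: known_restrict (kB a b) oU UM (fun _ _ => erefl).
move=> v fv; split; first by rewrite mulmxK// uB.
move=> x Ux; rewrite (derive_jacobian _ (sf [::] (UM x Ux))).
have : v *m B p *m invmx (B x) *m B x = row_mx 0 (v *m L).
  rewrite mulmxKV ?uB// mul_mx_row -(derive_jacobian v (sf [::] Mp)) fv.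
  by [].
by rewrite [X in _ *m X = _]/B mul_mx_row => /eq_row_mx[].
Qed.

(** A vector u0 tangent to G extends to a field W tangent to G: extend u0 and a
    vector v1 transverse to ker lam within the leaves and subtract from the
    first field a multiple of the second. Then alpha(W) = 0 and the Lie
    derivative of alpha along W vanishes on the leaves, and Cartan's formula
    gives d alpha(u0, t) = 0. As G has codimension one in the leaf and d alpha
    is alternating, this determines d alpha on the leaf. *)
Lemma measure_closed x u v : M x -> 'D_u f x = 0 -> 'D_v f x = 0 ->
  ext_deriv al x u v = 0.
Proof.
move=> Mx fu fv; have dal := sal [::] Mx.
have [U [E [oU Ux UM kE EP]]] := fibre_extension Mx.
have [v1 [/(tangentE v1 Mx) fv1 lv1]] := hcoL.1 x Mx.
have onG u0 t : 'D_u0 f x = 0 -> pairing (lam x) u0 = 0 -> 'D_t f x = 0 ->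
    ext_deriv al x u0 t = 0.
  move=> fu0 lu0 ft.
  have [E0 F0] := EP u0 fu0; have [E1 F1] := EP v1 fv1.
  have kle y : knownV D U lam := known_restrictV kl oU UM.
  have kp t' : known D U (fun y => pairing (lam y) (E t' y)).
    by apply: known_pairing => //; exact: kle.
  pose U2 := U `&` [set y | pairing (lam y) (E v1 y) != 0].
  have oU2 : open U2 := known_open_neq0 (kp v1).
  have U2x : U2 x by split => //=; rewrite E1.
  have U2M : U2 `<=` M by move=> y [/UM].
  pose c y := pairing (lam y) (E u0 y) / pairing (lam y) (E v1 y).
  pose W y := E u0 y - c y *: E v1 y.
  have kp2 t' : known D U2 (fun y => pairing (lam y) (E t' y)).
    by apply: (known_restrict (kp t') oU2) => // y [].
  have kE2 t' : knownV D U2 (E t') by apply: (known_restrictV (kE t') oU2) => y [].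
  have kc : known D U2 c.
    by apply: known_mul => //; apply: known_inv => // y [].
  have kW : knownV D U2 W.
    move=> i; apply: (known_eq (known_sub (kE2 u0 i) (known_mul kc (kE2 v1 i)))) => y _.
    by rewrite !mxE.
  have Wx : W x = u0 by rewrite /W /c E0 lu0 mul0r scale0r subr0.
  have WG y : U2 y -> tangentG lam f y (W y).
    move=> U2y; have [Uy ly] := U2y; split.
      apply/(tangentE _ (UM y Uy)).
      have jE t' := derive_jacobian t' (sf [::] (UM y Uy)).
      rewrite jE mulmxBl -scalemxAl -!jE (F0 y Uy) (F1 y Uy).
      by rewrite scaler0 subrr.
    by rewrite /= /W pairingBr pairingZr divfK ?subrr.
  have [_ _ _ H] := hal.
  have [_ /(_ t ((tangentE t Mx).2 ft))] := H U2 W oU2 U2M (smooth_of_known kW) WG x U2x.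
  rewrite (lie_derivE _ dal (knownV_diff kW U2x)) Wx.
  rewrite (@eq_open_derive _ _ _ U2 _ (cst 0) x t oU2 _ U2x).
    by rewrite derive_cst addr0.
  by move=> y; rewrite inE => U2y; have [] := H U2 W oU2 U2M (smooth_of_known kW) WG y U2y.
have split_v t : 'D_t f x = 0 -> exists a t0, [/\ t = a *: v1 + t0, 'D_t0 f x = 0 & pairing (lam x) t0 = 0].
  move=> ft; pose a := pairing (lam x) t / pairing (lam x) v1.
  exists a, (t - a *: v1); apply: And3; first by rewrite addrC subrK.
    have jE t' := derive_jacobian t' (sf [::] Mx).
    by rewrite jE mulmxBl -scalemxAl -!jE ft fv1 scaler0 subrr.
  by rewrite pairingBr pairingZr divfK ?subrr.
have [a [u0 [uE fu0 lu0]]] := split_v u fu.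
have [b [w0 [vE fw0 lw0]]] := split_v v fv.
rewrite uE (ext_derivDl _ _ _ dal) (onG u0 v fu0 lu0 fv) addr0 (ext_derivZl _ _ _ dal).
rewrite vE (ext_derivDr _ _ _ dal) (ext_derivZr _ _ _ dal) ext_deriv_id mulr0 add0r.
by rewrite ext_deriv_sym (onG w0 v1 fw0 lw0 fv1) oppr0 mulr0.
Qed.

Lemma contact_sys_of_hypotheses : contact_sys D M lam f al w.
Proof.
have [hw1 hw2 hw3] := hw; have [hal1 hal2 hal3 hal4] := hal.
split => //.
- by move=> x Mx; exact: (sal [::] Mx).
- by move=> x u Mx lu u0; have [_ h] := hlam.2 x Mx; exact: h.
- move=> x Mx; have [v [/(tangentE v Mx) fv lv]] := hcoL.1 x Mx.
  by exists v.
- by move=> x Mx; apply/(tangentE _ Mx); exact: hw2.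
- move=> x v Mx lv; rewrite -(lie_derivE v (sl [::] Mx) (sw [::] Mx)).
  exact: hw1.2.
- exact: measure_closed.
- move=> x v Mx /(tangentE v Mx) fv; split.
    by move=> /(hal3 x Mx v fv)[].
  by move=> lv; apply/(hal3 x Mx v fv).
- move=> x v Mx fv; have := hw3 x Mx v ((tangentE v Mx).2 fv).
  have fw : 'D_(w x) f x = 0 by apply/(tangentE _ Mx); exact: hw2.
  by rewrite (lie_derivE v (sal [::] Mx) (sw [::] Mx)) (measure_closed Mx fw fv) add0r.
Qed.

Lemma contact_system_solvable : solvable_in_quadratures M (known_data lam f w) w.
Proof.
move=> p Mp; have [wp|wp] := eqVneq (w p) 0.
  by split => //; exact: solution_at_zero.
have [L inj] := fibre_complement Mp.
have fl : flow_in_quadratures M (known_data lam f w) w p.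
  exact: (@flow_of_straightened _ _ D w p
    (contact_straightened contact_sys_of_hypotheses Mp wp inj)).
by split => //; exact: solution_of_flow.
Qed.

End FromHypotheses.

Theorem theorem3p8 (R : realType) (n : nat) (hn : (0 < n)%N)
    (M : set 'rV[R]_(2 * n - 1))
    (lambda : 'rV[R]_(2 * n - 1) -> 'rV[R]_(2 * n - 1))
    (f : 'rV[R]_(2 * n - 1) -> 'rV[R]_(n - 1))
    (alpha w : 'rV[R]_(2 * n - 1) -> 'rV[R]_(2 * n - 1)) :
  open M ->
  contact_form M lambda ->
  independent_functions M f ->
  co_Legendrian M lambda f ->
  transverse_measure M lambda f alpha ->
  integrable_contact_system M lambda f alpha w ->
  solvable_in_quadratures M (known_data lambda f w) w.
Proof.
have : (2 * n - 1 = (n - 1) + (1 + (n - 1)))%N.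
  by rewrite -(prednK hn) !subn1 mul2n -addnn addSn /= add1n.
move: M lambda f alpha w; move: (2 * n - 1)%N (n - 1)%N => N q M lam f al w e.
subst N; exact: contact_system_solvable.
Qed.
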